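(* (1) Let $\mathfrak{g}\in\{W(n),S(n),H(n)\}$. For every universal Lie-Cartan module $M\in{}^u\mathcal{LC}$ and every $q\in\mathbb{Z}_{\ge0}$, the cohomology module $H^q_{{}^u\mathcal{LC}}(M)$ is the $q$-th cohomology of the cochain complex $\mathbf{C}(M)$: $$H^q_{{}^u\mathcal{LC}}(M)\cong H^q(\mathbf{C}(M))$$ as $\mathcal{R}$-modules. (2) Let $\mathfrak{g}=W(n)$. Then $$\mathrm{Ext}^\bullet_{{}^u\mathcal{LC}}(\mathcal{R},\mathcal{R})\cong H^\bullet(\mathfrak{gl}(n,\mathbb{F}))$$ as rings, where $H^\bullet(\mathfrak{gl}(n,\mathbb{F}))$ is the ordinary Lie algebra cohomology ring of $\mathfrak{gl}(n,\mathbb{F})$ with trivial coefficients.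
   Context: Ground field: $\mathbb{F}$ algebraically closed of characteristic $0$. $\mathcal{R}=\mathbb{F}[x_1,\dots,x_n]$, $\partial_i=\partial/\partial x_i$. $W(n)=\mathrm{Der}(\mathcal{R})=\bigoplus_i\mathcal{R}\partial_i$; $S(n)=\{\sum f_i\partial_i\in W(n):\sum_i\partial_i(f_i)=0\}$; for $n=2r$, $H(n)=\{D_H(f):f\in\mathcal{R}\}$, $D_H(f)=\sum_{i=1}^n\sigma(i)\partial_i(f)\partial_{i'}$, where $\sigma(i)=1,\ i'=i+r$ for $i\le r$ and $\sigma(i)=-1,\ i'=i-r$ for $i>r$. Category ${}^u\mathcal{LC}$ of universal Lie-Cartan modules: objects are vector spaces $M$ with a $\mathfrak{g}$-action $\rho$ and an $\mathcal{R}$-module structure $\theta$ with $[\rho(X),\theta(f)]=\theta(X(f))$ for all $X\in\mathfrak{g}$, $f\in\mathcal{R}$; morphisms are the linear maps that are both $\mathfrak{g}$- and $\mathcal{R}$-homomorphisms. $\mathcal{R}$ itself is an object (natural action of $\mathfrak g$ by derivations, and multiplication). $\mathrm{Ext}^\bullet_{{}^u\mathcal{LC}}$ denotes the Ext groups in this abelian category, i.e. the derived functors of $\mathrm{Hom}_{{}^u\mathcal{LC}}$; $\mathrm{Ext}^\bullet_{{}^u\mathcal{LC}}(\mathcal R,\mathcal R)$ is a ring under the usual (Yoneda) product. A $(\mathfrak{g},\mathcal{R})$-module is a vector space with a $\mathfrak{g}$-module and an $\mathcal{R}$-module structure, no compatibility required. Let $\omega:\mathcal{R}\to\mathbb{F}$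 be the algebra homomorphism with kernel $\sum_i\mathcal{R}x_i$. The ''unity action'' of $\mathcal{R}$ on a space of maps is $\Omega(f)\phi=\omega(f)\phi$. For $M\in{}^u\mathcal{LC}$ put $\Gamma(M)=\mathrm{Hom}_{{}^u\mathcal{LC}}(\mathcal{R},M)$, with trivial $\mathfrak{g}$-action and unity $\mathcal{R}$-action; this is a left exact functor from ${}^u\mathcal{LC}$ to $(\mathfrak{g},\mathcal{R})$-modules, and $H^q_{{}^u\mathcal{LC}}(M):=\mathsf{R}^q\Gamma(M)$ is its $q$-th right derived functor. Complex $\mathbf{C}(M)$: $C^q(M)=\mathrm{Hom}_{\mathcal{R}}(\mathcal{R}\otimes_{\mathbb{F}}\bigwedge^q\mathfrak{g},M)$, with unity $\mathcal{R}$-action and $\mathfrak{g}$-action $(X\phi)(y)=X(\phi(y))-\phi(X.y)$, where $X.(r\otimes w)=X(r)\otimes w+r\otimes X.w$. The differential $\mathsf{d}_q:C^q(M)\to C^{q+1}(M)$ is $$\mathsf{d}_q\phi(r\otimes(g_1\wedge\dots\wedge g_{q+1}))=\sum_{1\le s<t\le q+1}(-1)^{s+t}\phi(r\otimes([g_s,g_t]\wedge g_1\wedge\dots\wedge\hat g_s\wedge\dots\wedge\hat g_t\wedge\dots\wedge g_{q+1}))+\sum_{1\le s\le q+1}(-1)^{s+1}r\,g_s\,\phi(1\otimes(g_1\wedge\dots\wedge\hat g_s\wedge\dots\wedge g_{q+1})).$$ *)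

(* Defs.v *)
From HB Require Import structures.
From mathcomp Require Import all_boot all_fingroup all_algebra.
From mathcomp Require Import boolp functions.
From mathcomp Require Import freeg mpoly.
Set Implicit Arguments.
Unset Strict Implicit.
Unset Printing Implicit Defensive.
Import GRing.Theory.
Local Open Scope ring_scope.
Local Open Scope quotient_scope.

Section Submodules.
Variables (K : nzRingType) (V : lmodType K).

Record submod := Submod {
  smem :> V -> Prop;
  smem0 : smem 0;
  smemP : forall (a : K) u v, smem u -> smem v -> smem (a *: u + v) }.

Definition smemb (N : submod) : {pred V} := [pred v | `[< N v >]].

Lemma smembP (N : submod) v : reflect (N v) (v \in smemb N).
Proof. exact: asboolP. Qed.

Lemma smemb_closed (N : submod) : submod_closed (smemb N).
Proof.
split=> [|a u v /smembP Nu /smembP Nv]; apply/smembP; first exact: smem0.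
exact: smemP.
Qed.

HB.instance Definition _ (N : submod) :=
  GRing.isSubmodClosed.Build K V (smemb N) (smemb_closed N).

Definition sub_mod (N : submod) : Type := {v : V | v \in smemb N}.
HB.instance Definition _ (N : submod) := Choice.on (sub_mod N).
HB.instance Definition _ (N : submod) := SubChoice.on (sub_mod N).
HB.instance Definition _ (N : submod) :=
  [SubChoice_isSubLmodule of sub_mod N by <:].

Fact val_sub_mod (N : submod) (a : K) (u v : sub_mod N) :
  val (a *: u + v) = a *: val u + val v.
Proof. by []. Qed.

Definition quo_mod (N : submod) : Type := Quotient.quot (smemb N).
HB.instance Definition _ (N : submod) := GRing.Zmodule.on (quo_mod N).

Section QuoScale.
Variable N : submod.
Let Q := Quotient.quot (smemb N).

Definition pi_mod (v : V) : quo_mod N := \pi_Q v.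

Lemma pi_modE u v : pi_mod u = pi_mod v <-> N (u - v).
Proof.
rewrite /pi_mod; split=> [/eqmodP|Nuv]; first by move=> /smembP.
by apply/eqmodP; apply/smembP.
Qed.

Lemma pi_modD u v : pi_mod (u + v) = pi_mod u + pi_mod v.
Proof. exact: (raddfD \pi_Q). Qed.

Lemma pi_mod_surj (x : quo_mod N) : exists v, x = pi_mod v.
Proof. by exists (generic_quotient.repr x); rewrite /pi_mod reprK. Qed.

Definition quo_scale (a : K) (x : quo_mod N) : quo_mod N :=
  pi_mod (a *: generic_quotient.repr (x : Q)).

Lemma quo_scaleE a v : quo_scale a (pi_mod v) = pi_mod (a *: v).
Proof.
apply/pi_modE; rewrite -scalerBr -[_ *: _]addr0; apply: smemP; last exact: smem0.
by apply/pi_modE; rewrite /pi_mod reprK.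
Qed.

Fact quo_scaleA a b x : quo_scale a (quo_scale b x) = quo_scale (a * b) x.
Proof. by have [v ->] := pi_mod_surj x; rewrite !quo_scaleE scalerA. Qed.
Fact quo_scale1 : left_id 1 quo_scale.
Proof. by move=> x; have [v ->] := pi_mod_surj x; rewrite quo_scaleE scale1r. Qed.
Fact quo_scaleDr : right_distributive quo_scale +%R.
Proof.
move=> a x y; have [u ->] := pi_mod_surj x; have [v ->] := pi_mod_surj y.
by rewrite -pi_modD !quo_scaleE scalerDr pi_modD.
Qed.
Fact quo_scaleDl x : {morph quo_scale^~ x : a b / a + b}.
Proof.
by move=> a b; have [v ->] := pi_mod_surj x; rewrite !quo_scaleE scalerDl pi_modD.
Qed.

HB.instance Definition _ := GRing.Zmodule_isLmodule.Build K (quo_mod N)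
  quo_scaleA quo_scale1 quo_scaleDr quo_scaleDl.
End QuoScale.

Section Span.
Variable S : V -> Prop.
Definition in_span v := forall N : submod, (forall s, S s -> N s) -> N v.
Fact in_span0 : in_span 0. Proof. by move=> N _; exact: smem0. Qed.
Fact in_spanP (a : K) u v : in_span u -> in_span v -> in_span (a *: u + v).
Proof. by move=> su sv N SN; apply: smemP; [exact: su|exact: sv]. Qed.
Definition span_mod : submod := Submod in_span0 in_spanP.
End Span.
End Submodules.
Arguments pi_mod {K V} N v.

Section FfunTools.
Variables (q : nat) (V : Type).
Definition ffset (x : {ffun 'I_q -> V}) (i : 'I_q) (u : V) : {ffun 'I_q -> V} :=
  [ffun k => if k == i then u else x k].

(* The list of the entries of x other than those of index in s *)
Definition omit (x : {ffun 'I_q -> V}) (s : seq 'I_q) : seq V :=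
  [seq x k | k <- enum 'I_q & k \notin s].
End FfunTools.

Section ExteriorPower.
Variables (F : fieldType) (V : lmodType F) (q : nat).

Inductive ext_rel : {freeg {ffun 'I_q -> V} / F} -> Prop :=
| ExtLin (x : {ffun 'I_q -> V}) (i : 'I_q) (c : F) (u v : V) :
    ext_rel (<< ffset x i (c *: u + v) >>
             - (c *: << ffset x i u >> + << ffset x i v >>))
| ExtAlt (x : {ffun 'I_q -> V}) (i j : 'I_q) :
    i != j -> x i = x j -> ext_rel << x >>.

Definition ext_pow : lmodType F := quo_mod (span_mod ext_rel).
Definition ext_wedge (x : {ffun 'I_q -> V}) : ext_pow :=
  pi_mod (span_mod ext_rel) << x >>.
End ExteriorPower.

(* The A-module A (x)_F V: the free A-module on the symbols 1 (x) v, modulo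
   F-linearity in v. *)
Section ScalarExtension.
Variables (F : fieldType) (A : lalgType F) (V : lmodType F).

Inductive tens_rel : {freeg V / A} -> Prop :=
| TensLin (c : F) (u v : V) :
    tens_rel (<< c *: u + v >> - (c%:A *: << u >> + << v >>)).

Definition tens : lmodType A := quo_mod (span_mod tens_rel).
Definition tpure (a : A) (v : V) : tens :=
  pi_mod (span_mod tens_rel) (a *: << v >>).
End ScalarExtension.

(* The differential is given by its graph: [cdiff u v] means d u = v. This lets
   d u be specified on generators only, as is usual for cochains on an exterior
   power. The cohomology in degree q below is the module of u with d u = 0, modulo
   those that are of the form d w. *)
Record cochain_complex (K : nzRingType) := CochainComplex {
  cobj : nat -> lmodType K;
  cdiff : forall q, cobj q -> cobj q.+1 -> Prop;
  cdiff0 : forall q, cdiff (0 : cobj q) 0;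
  cdiffP : forall q (a : K) (u v : cobj q) (u' v' : cobj q.+1),
    cdiff u u' -> cdiff v v' -> cdiff (a *: u + v) (a *: u' + v') }.

Section Cohomology.
Variables (K : nzRingType) (C : cochain_complex K) (q : nat).

Definition is_cocycle (z : cobj C q) := cdiff z 0.
Fact is_cocycle0 : is_cocycle 0. Proof. exact: cdiff0. Qed.
Fact is_cocycleP (a : K) u v :
  is_cocycle u -> is_cocycle v -> is_cocycle (a *: u + v).
Proof.
move=> zu zv; rewrite /is_cocycle -[X in cdiff _ X]addr0 -[X in X + 0](scaler0 _ a).
exact: cdiffP.
Qed.
Definition cocycles : submod (cobj C q) := Submod is_cocycle0 is_cocycleP.
End Cohomology.

Section Cohomology2.
Variables (K : nzRingType) (C : cochain_complex K).

Definition is_coboundary (q : nat) : cobj C q -> Prop :=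
  match q with
  | 0 => fun z => z = 0
  | q'.+1 => fun z => exists u : cobj C q', cdiff u z
  end.

Definition bdry_in_cocycles (q : nat) (z : sub_mod (cocycles C q)) :=
  is_coboundary (val z).
Fact bdry_in_cocycles0 q : @bdry_in_cocycles q 0.
Proof.
by case: q => [//|q]; exists 0; exact: cdiff0.
Qed.
Fact bdry_in_cocyclesP q (a : K) (u v : sub_mod (cocycles C q)) :
  bdry_in_cocycles u -> bdry_in_cocycles v -> bdry_in_cocycles (a *: u + v).
Proof.
rewrite /bdry_in_cocycles val_sub_mod; case: q u v => [|q] u v /=.
  by move=> -> ->; rewrite scaler0 addr0.
by move=> [u' du] [v' dv]; exists (a *: u' + v'); exact: cdiffP.
Qed.
Definition coboundaries q : submod (sub_mod (cocycles C q)) :=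
  Submod (@bdry_in_cocycles0 q) (@bdry_in_cocyclesP q).

Definition coh (q : nat) : lmodType K := quo_mod (coboundaries q).

Definition coh_class (q : nat) (z : cobj C q) (c : coh q) : Prop :=
  exists2 z' : sub_mod (cocycles C q), val z' = z & c = pi_mod (coboundaries q) z'.
End Cohomology2.

Section VectorFields.
Variables (F : fieldType) (n : nat).
Local Notation R := {mpoly F[n]}.

(* X stands for \sum_i X_i \partial_i. *)
Definition vf : lmodType F := {ffun 'I_n -> R}.

Definition vf_act (X : {ffun 'I_n -> R}) (f : R) : R := \sum_i X i * f^`M(i).

Definition vf_bracket (X Y : {ffun 'I_n -> R}) : {ffun 'I_n -> R} :=
  [ffun j => vf_act X (Y j) - vf_act Y (X j)].

Definition vf_div (X : {ffun 'I_n -> R}) : R := \sum_i (X i)^`M(i).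

(* p \partial_i *)
Definition vf_single (p : R) (i : 'I_n) : {ffun 'I_n -> R} :=
  [ffun j => if j == i then p else 0].

Record lie_subalg := LieSubalg {
  lie_mem :> submod vf;
  lie_memB : forall X Y, lie_mem X -> lie_mem Y -> lie_mem (vf_bracket X Y) }.

Fact vf_actDr X f g : vf_act X (f + g) = vf_act X f + vf_act X g.
Proof. by rewrite -big_split; apply: eq_bigr => i _; rewrite mderivD mulrDr. Qed.

Fact vf_actZr X c f : vf_act X (c *: f) = c *: vf_act X f.
Proof. by rewrite scaler_sumr; apply: eq_bigr => i _; rewrite mderivZ -scalerAr. Qed.

Fact vf_act0r X : vf_act X 0 = 0.
Proof. by apply: big1 => i _; rewrite mderiv0 mulr0. Qed.

Fact vf_actBr X f g : vf_act X (f - g) = vf_act X f - vf_act X g.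
Proof. by rewrite vf_actDr -(scaleN1r g) vf_actZr scaleN1r. Qed.

Fact vf_act_sum X (I : finType) (f : I -> R) :
  vf_act X (\sum_i f i) = \sum_i vf_act X (f i).
Proof. exact: (big_morph _ (vf_actDr X) (vf_act0r X)). Qed.

Fact vf_actPl (c : F) (X Y : {ffun 'I_n -> R}) f :
  vf_act (c *: X + Y) f = c *: vf_act X f + vf_act Y f.
Proof.
rewrite scaler_sumr -big_split; apply: eq_bigr => i _.
by rewrite !ffunE mulrDl scalerAl.
Qed.

Fact vf_actM X f g : vf_act X (f * g) = vf_act X f * g + f * vf_act X g.
Proof.
rewrite mulr_suml mulr_sumr -big_split; apply: eq_bigr => i _ /=.
by rewrite mderivM mulrDr !mulrA (mulrC (X i) f).
Qed.

Fact vf_actC X c : vf_act X c%:MP = 0.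
Proof. by apply: big1 => i _; rewrite mderivC mulr0. Qed.

Fact mderiv_vf_act X f j :
  (vf_act X f)^`M(j) = \sum_i (X i)^`M(j) * f^`M(i) + vf_act X f^`M(j).
Proof.
rewrite raddf_sum -big_split; apply: eq_bigr => i _ /=.
by rewrite mderivM mderiv_comm.
Qed.

Fact vf_act_bracket X Y f :
  vf_act (vf_bracket X Y) f = vf_act X (vf_act Y f) - vf_act Y (vf_act X f).
Proof.
have aux (Z T : {ffun 'I_n -> R}) : vf_act Z (vf_act T f) =
    \sum_j vf_act Z (T j) * f^`M(j) + \sum_j \sum_i T j * (Z i * f^`M(j)^`M(i)).
  rewrite vf_act_sum -big_split; apply: eq_bigr => j _ /=.
  by rewrite vf_actM [vf_act Z (mderiv _ _)]/vf_act mulr_sumr.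
rewrite (aux X Y) (aux Y X) [X in _ = _ - (_ + X)]exchange_big /=.
rewrite [X in _ = _ - (_ + X)](_ : _ =
   \sum_j \sum_i Y j * (X i * f^`M(j)^`M(i))); last first.
  apply: eq_bigr => j _; apply: eq_bigr => i _.
  by rewrite mderiv_comm mulrCA.
rewrite opprD addrACA subrr addr0 -sumrB; apply: eq_bigr => j _.
by rewrite ffunE mulrBl.
Qed.

Fact vf_div_bracket X Y :
  vf_div (vf_bracket X Y) = vf_act X (vf_div Y) - vf_act Y (vf_div X).
Proof.
have aux (Z T : {ffun 'I_n -> R}) : \sum_j (vf_act Z (T j))^`M(j) =
    \sum_j \sum_i (Z i)^`M(j) * (T j)^`M(i) + vf_act Z (vf_div T).
  rewrite vf_act_sum -big_split; apply: eq_bigr => j _ /=.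
  by rewrite mderiv_vf_act.
rewrite (_ : vf_div _ = \sum_j (vf_act X (Y j))^`M(j)
                        - \sum_j (vf_act Y (X j))^`M(j)); last first.
  by rewrite -sumrB; apply: eq_bigr => j _; rewrite ffunE mderivB.
rewrite !aux [X in _ - (X + _)]exchange_big /=.
rewrite [X in _ - (X + _)](_ : _ =
   \sum_j \sum_i (X i)^`M(j) * (Y j)^`M(i)); last first.
  by apply: eq_bigr => j _; apply: eq_bigr => i _; rewrite mulrC.
by rewrite opprD addrACA subrr add0r.
Qed.

Definition W_submod : submod vf :=
  @Submod F vf (fun=> True) I (fun _ _ _ _ _ => I).
Definition W_alg : lie_subalg := @LieSubalg W_submod (fun _ _ _ _ => I).

Fact S_mem0 : vf_div 0 = 0.
Proof. by apply: big1 => i _; rewrite ffunE mderiv0. Qed.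
Fact S_memP (c : F) (X Y : vf) :
  vf_div X = 0 -> vf_div Y = 0 -> vf_div (c *: X + Y) = 0.
Proof.
move=> X0 Y0; rewrite (_ : vf_div _ = c *: vf_div X + vf_div Y).
  by rewrite X0 Y0 scaler0 addr0.
rewrite scaler_sumr -big_split; apply: eq_bigr => i _.
by rewrite !ffunE mderivD mderivZ.
Qed.
Definition S_submod : submod vf :=
  @Submod F vf (fun X => vf_div X = 0) S_mem0 S_memP.
Fact S_memB X Y : S_submod X -> S_submod Y -> S_submod (vf_bracket X Y).
Proof. by rewrite /= vf_div_bracket => -> ->; rewrite !vf_act0r subr0. Qed.
Definition S_alg : lie_subalg := LieSubalg S_memB.
End VectorFields.

Section Hamiltonian.
Variables (F : fieldType) (r : nat).
Local Notation R := {mpoly F[r + r]}.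

Definition hsgn (i : 'I_(r + r)) : F := if (i < r)%N then 1 else -1.

Definition hprime (i : 'I_(r + r)) : 'I_(r + r) :=
  match fintype.split i with inl k => rshift r k | inr k => lshift r k end.

Definition D_H (f : R) : vf F (r + r) :=
  \sum_i vf_single (hsgn i *: f^`M(i)) (hprime i).

Fact hprimeK : involutive hprime.
Proof.
move=> i; rewrite /hprime; case: (splitP i) => k ik.
  rewrite (_ : fintype.split _ = inr k); first exact/val_inj.
  exact: (unsplitK (inr k)).
rewrite (_ : fintype.split _ = inl k); first exact/val_inj.
exact: (unsplitK (inl k)).
Qed.

Fact hsgnN i : hsgn (hprime i) = - hsgn i.
Proof.
rewrite /hprime /hsgn; case: (splitP i) => k _ /=.
  by rewrite ltnNge leq_addr.
by rewrite ltn_ord opprK.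
Qed.

Fact D_HE f j : (D_H f : {ffun _ -> R}) j = - (hsgn j *: f^`M(hprime j)).
Proof.
rewrite sum_ffunE (bigD1 (hprime j)) //= ffunE hprimeK eqxx hsgnN scaleNr.
rewrite big1 ?addr0 // => i ij; rewrite ffunE ifN //.
by apply: contra ij => /eqP ->; rewrite hprimeK.
Qed.

Fact D_H_bracket f g : vf_bracket (D_H f) (D_H g) = D_H (vf_act (D_H f) g).
Proof.
have actN X p : vf_act X (- p) = - vf_act X p :> R.
  by rewrite -scaleN1r vf_actZr scaleN1r.
have key k : (vf_act (D_H f) g)^`M(k) =
    vf_act (D_H f) g^`M(k) - vf_act (D_H g) f^`M(k).
  rewrite mderiv_vf_act addrC; congr (_ + _).
  rewrite (reindex_inj (inv_inj hprimeK)) /= -sumrN; apply: eq_bigr => i _.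
  rewrite !D_HE hprimeK hsgnN scaleNr opprK mderivZ mulNr opprK.
  by rewrite -!scalerAl mderiv_comm mulrC.
apply/ffunP => j; rewrite ffunE !D_HE !actN !vf_actZr key.
by rewrite scalerBr opprB opprK addrC.
Qed.

Definition H_mem (X : vf F (r + r)) : Prop := exists f, X = D_H f.

Fact D_HP c f g : D_H (c *: f + g) = c *: D_H f + D_H g.
Proof.
apply/ffunP => j; rewrite !ffunE !D_HE mderivD mderivZ.
by rewrite scalerDr opprD scalerN !scalerA mulrC.
Qed.

Fact H_mem0 : H_mem 0.
Proof.
exists 0; apply/ffunP => j; by rewrite D_HE mderiv0 scaler0 oppr0 ffunE.
Qed.
Fact H_memP c X Y : H_mem X -> H_mem Y -> H_mem (c *: X + Y).
Proof. by move=> [f ->] [g ->]; exists (c *: f + g); rewrite D_HP. Qed.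
Definition H_submod : submod (vf F (r + r)) := Submod H_mem0 H_memP.
Fact H_memB X Y : H_submod X -> H_submod Y -> H_submod (vf_bracket X Y).
Proof. by move=> [f ->] [g ->]; eexists; exact: D_H_bracket. Qed.
Definition H_alg : lie_subalg F (r + r) := LieSubalg H_memB.
End Hamiltonian.

(* g is one of W(n), S(n), and, when n = 2r, H(n). *)
Inductive is_cartan (F : fieldType) : forall n, lie_subalg F n -> Prop :=
| IsW n : is_cartan (W_alg F n)
| IsS n : is_cartan (S_alg F n)
| IsH r : is_cartan (H_alg F r).

Section LieElements.
Variables (F : fieldType) (n : nat) (g : lie_subalg F n).

Definition lie_elt : lmodType F := sub_mod g.

Fact lie_brP (X Y : lie_elt) : vf_bracket (val X) (val Y) \in smemb g.
Proof. by apply/smembP; apply: lie_memB; apply/smembP; exact: valP. Qed.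
Definition lie_br (X Y : lie_elt) : lie_elt :=
  exist (fun Z => Z \in smemb g) _ (lie_brP X Y).

Definition lie_act (X : lie_elt) (f : {mpoly F[n]}) : {mpoly F[n]} :=
  vf_act (val X) f.
End LieElements.

Section LieCartan.
Variables (F : fieldType) (n : nat) (g : lie_subalg F n).
Local Notation R := {mpoly F[n]}.

(* The vector space structure of an R-module is its restriction along the
   constants: the scalar c acts as c%:MP. *)
Record lcmod := LCMod {
  lc_sort :> lmodType R;
  rho : lie_elt g -> lc_sort -> lc_sort;
  rho_linear : forall X (c : F) (u v : lc_sort),
    rho X (c%:MP *: u + v) = c%:MP *: rho X u + rho X v;
  rho_linearl : forall (c : F) X Y (v : lc_sort),
    rho (c *: X + Y) v = c%:MP *: rho X v + rho Y v;
  rho_bracket : forall X Y (v : lc_sort),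
    rho (lie_br X Y) v = rho X (rho Y v) - rho Y (rho X v);
  rho_compat : forall X (f : R) (v : lc_sort),
    rho X (f *: v) - f *: rho X v = lie_act X f *: v }.

Definition is_lchom (M N : lcmod) (f : M -> N) : Prop :=
  (forall (a : R) u v, f (a *: u + v) = a *: f u + f v) /\
  (forall X v, f (rho X v) = rho X (f v)).

Fact lcR_linear (X : lie_elt g) (c : F) (u v : R^o) :
  lie_act X (c%:MP *: u + v) = c%:MP *: (lie_act X u : R^o) + lie_act X v :> R^o.
Proof.
by rewrite /lie_act vf_actDr [c%:MP *: u]/(c%:MP * u : R) vf_actM vf_actC mul0r add0r.
Qed.
Fact lcR_linearl (c : F) (X Y : lie_elt g) (v : R^o) :
  lie_act (c *: X + Y) v = c%:MP *: (lie_act X v : R^o) + lie_act Y v :> R^o.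
Proof.
by rewrite /lie_act val_sub_mod vf_actPl [X in _ = X + _]mul_mpolyC.
Qed.
Fact lcR_bracket (X Y : lie_elt g) (v : R^o) :
  lie_act (lie_br X Y) v = lie_act X (lie_act Y v) - lie_act Y (lie_act X v) :> R^o.
Proof. exact: vf_act_bracket. Qed.
Fact lcR_compat (X : lie_elt g) (f : R) (v : R^o) :
  lie_act X (f *: v) - f *: (lie_act X v : R^o) = lie_act X f *: v :> R^o.
Proof. by rewrite /lie_act /GRing.scale /= vf_actM addrK. Qed.
Definition lcR : lcmod := LCMod lcR_linear lcR_linearl lcR_bracket lcR_compat.

Definition lc_injective (I : lcmod) : Prop :=
  forall (A B : lcmod) (i : A -> B) (f : A -> I),
    is_lchom i -> injective i -> is_lchom f ->
    exists2 h : B -> I, is_lchom h & forall a, h (i a) = f a.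

(* Monomorphisms and exactness in the category of Lie-Cartan modules are those
   of the underlying vector spaces. *)
Record injres (M : lcmod) := InjRes {
  ir_obj :> nat -> lcmod;
  ir_aug : M -> ir_obj 0;
  ir_d : forall q, ir_obj q -> ir_obj q.+1;
  ir_aug_hom : is_lchom ir_aug;
  ir_d_hom : forall q, is_lchom (@ir_d q);
  ir_inj : forall q, lc_injective (ir_obj q);
  ir_aug_inj : injective ir_aug;
  ir_exact0 : forall x, ir_d x = 0 <-> exists m, x = ir_aug m;
  ir_exact : forall q (x : ir_obj q.+1), ir_d x = 0 <-> exists y, x = @ir_d q y }.

Definition omega (f : R) : R := (f.@[fun=> 0])%:MP.

(* Spaces of maps into M, as R-modules through the unity action: f acts as the
   scalar omega f, not as multiplication by f. *)
Definition umap (T : Type) (M : lmodType R) : Type := T -> M.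
HB.instance Definition _ T M := GRing.Zmodule.copy (umap T M) (T -> M).

Section Unity.
Variables (T : Type) (M : lmodType R).
Definition unity_scale (f : R) (phi : umap T M) : umap T M :=
  fun t => omega f *: phi t.
Fact unity_scaleA a b phi :
  unity_scale a (unity_scale b phi) = unity_scale (a * b) phi.
Proof. by apply/funext => t; rewrite /unity_scale scalerA /omega mevalM mpolyCM. Qed.
Fact unity_scale1 : left_id 1 unity_scale.
Proof.
by move=> phi; apply/funext => t; rewrite /unity_scale /omega meval1 scale1r.
Qed.
Fact unity_scaleDr : right_distributive unity_scale +%R.
Proof. by move=> a u v; apply/funext => t; exact: scalerDr. Qed.
Fact unity_scaleDl phi : {morph unity_scale^~ phi : a b / a + b}.
Proof.
move=> a b; apply/funext => t.
by rewrite /unity_scale /omega mevalD mpolyCD scalerDl.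
Qed.
HB.instance Definition _ := GRing.Zmodule_isLmodule.Build R (umap T M)
  unity_scaleA unity_scale1 unity_scaleDr unity_scaleDl.

Fact umapP a (u v : umap T M) t : (a *: u + v) t = omega a *: u t + v t.
Proof. by []. Qed.
End Unity.

Section Gamma.
Variable M : lcmod.
Definition Gamma_mem (phi : umap R M) : Prop := is_lchom (phi : lcR -> M).

Fact rho0 X : rho X (0 : M) = 0.
Proof.
by have := rho_compat X 0 (0 : M); rewrite !scaler0 scale0r subr0.
Qed.

Fact Gamma_mem0 : Gamma_mem 0.
Proof. by split=> [a u v|X v]; rewrite /= ?scaler0 ?addr0 ?rho0. Qed.
Fact Gamma_memP a u v : Gamma_mem u -> Gamma_mem v -> Gamma_mem (a *: u + v).
Proof.
move=> [uL uX] [vL vX]; split=> [b x y|X x]; rewrite !umapP.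
  rewrite uL vL !scalerDr !scalerA (mulrC b) -!addrA; congr (_ + _).
  by rewrite addrCA.
by rewrite uX vX rho_linear.
Qed.
Definition Gamma : lmodType R := sub_mod (Submod Gamma_mem0 Gamma_memP).
End Gamma.

Section GammaComplex.
Variables (M : lcmod) (I : injres M).

Definition Gamma_diff q (phi : Gamma (I q)) (psi : Gamma (I q.+1)) : Prop :=
  forall r, val psi r = ir_d (val phi r).
Fact Gamma_diff0 q : Gamma_diff (0 : Gamma (I q)) 0.
Proof.
have [dL _] := ir_d_hom I q; move=> r /=.
by have := dL (-1) 0 0; rewrite scaler0 addr0 scaleN1r addNr => ->.
Qed.
Fact Gamma_diffP q a (u v : Gamma (I q)) (u' v' : Gamma (I q.+1)) :
  Gamma_diff u u' -> Gamma_diff v v' -> Gamma_diff (a *: u + v) (a *: u' + v').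
Proof.
have [dL _] := ir_d_hom I q; move=> du dv r.
by rewrite !val_sub_mod !umapP dL du dv.
Qed.
Definition Gamma_complex : cochain_complex R := CochainComplex Gamma_diff0 Gamma_diffP.

(* The right derived functor R^q Gamma of Gamma at M, computed from the injective
   resolution I of M (it does not depend on I up to isomorphism). *)
Definition RGamma q : lmodType R := coh Gamma_complex q.
End GammaComplex.

Section CEComplex.
Variable M : lcmod.

Definition CE_dom q : lmodType R := tens R (ext_pow (lie_elt g) q).

Definition CE_mem q (phi : umap (CE_dom q) M) : Prop :=
  forall (a : R) u v, phi (a *: u + v) = a *: phi u + phi v.
Fact CE_mem0 q : @CE_mem q 0.
Proof. by move=> a u v /=; rewrite scaler0 addr0. Qed.
Fact CE_memP q a u v : @CE_mem q u -> @CE_mem q v -> CE_mem (a *: u + v).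
Proof.
move=> uL vL b x y; rewrite !umapP uL vL !scalerDr !scalerA (mulrC b) -!addrA.
by congr (_ + _); rewrite addrCA.
Qed.
Definition CE q : lmodType R := sub_mod (Submod (@CE_mem0 q) (@CE_memP q)).

(* r (x) (w_1 /\ ... /\ w_q), for a list w of length q *)
Definition CE_gen q (r : R) (w : seq (lie_elt g)) : CE_dom q :=
  tpure r (ext_wedge [ffun i : 'I_q => w`_i]).

(* The indices s, t start at 0, so the sign (-1)^(s+t) is unchanged and
   (-1)^(s+1) becomes (-1)^s. *)
Definition CE_formula q (phi : umap (CE_dom q) M) (r : R)
    (x : {ffun 'I_q.+1 -> lie_elt g}) : M :=
  \sum_(s < q.+1) \sum_(t < q.+1 | (s < t)%N)
     (-1) ^+ (s + t) *:
       phi (CE_gen q r (lie_br (x s) (x t) :: omit x [:: s; t]))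
  + \sum_(s < q.+1)
     (-1) ^+ s *: (r *: rho (x s) (phi (CE_gen q 1 (omit x [:: s])))).

Definition CE_diff q (phi : CE q) (psi : CE q.+1) : Prop :=
  forall r (x : {ffun 'I_q.+1 -> lie_elt g}),
    val psi (tpure r (ext_wedge x)) = CE_formula (val phi) r x.

Fact CE_diff0 q : CE_diff (0 : CE q) 0.
Proof.
move=> r x; rewrite /CE_formula [X in _ + X]big1 => [|s _]; last first.
  by rewrite rho0 !scaler0.
by rewrite addr0 big1 // => s _; rewrite big1 // => t _; rewrite scaler0.
Qed.
Fact CE_diffP q a (u v : CE q) (u' v' : CE q.+1) :
  CE_diff u u' -> CE_diff v v' -> CE_diff (a *: u + v) (a *: u' + v').
Proof.
move=> du dv r x; rewrite !val_sub_mod umapP du dv /CE_formula.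
rewrite scalerDr addrACA; congr (_ + _); rewrite scaler_sumr -big_split /=.
  apply: eq_bigr => s _; rewrite scaler_sumr -big_split; apply: eq_bigr => t _.
  by rewrite umapP scalerDr !scalerA (mulrC (omega a)).
apply: eq_bigr => s _; rewrite umapP rho_linear !scalerDr !scalerA.
by congr (_ *: _ + _); rewrite -[LHS]mulrA mulrC mulrA.
Qed.
Definition CE_complex : cochain_complex R := CochainComplex CE_diff0 CE_diffP.
End CEComplex.
End LieCartan.

Section GL.
Variables (F : fieldType) (n : nat).
Local Notation gl := 'M[F]_n.

Definition gl_br (A B : gl) : gl := A *m B - B *m A.

(* q-cochains are alternating q-linear forms on gl(n, F) *)
Definition alt_mem q (phi : {ffun 'I_q -> gl} -> F^o) : Prop :=
  (forall x i (c : F) (u v : gl),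
     phi (ffset x i (c *: u + v)) = c * phi (ffset x i u) + phi (ffset x i v)) /\
  (forall (x : {ffun 'I_q -> gl}) i j, i != j -> x i = x j -> phi x = 0).
Fact alt_mem0 q : @alt_mem q 0.
Proof. by split=> // x i c u v; rewrite /= mulr0 addr0. Qed.
Fact alt_memP q (a : F) u v : @alt_mem q u -> @alt_mem q v -> alt_mem (a *: u + v).
Proof.
move=> [uL uA] [vL vA]; split=> [x i c y z|x i j ij xij].
  rewrite /= !addrfctE !scalrfctE uL vL /GRing.scale /= !mulrDr mulrCA -!addrA.
  by congr (_ + _); rewrite addrCA.
by rewrite addrfctE scalrfctE (uA _ _ _ ij xij) (vA _ _ _ ij xij) scaler0 addr0.
Qed.
Definition gl_cochain q : lmodType F :=
  sub_mod (Submod (@alt_mem0 q) (@alt_memP q)).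

Definition gl_diff q (phi : gl_cochain q) (psi : gl_cochain q.+1) : Prop :=
  forall x : {ffun 'I_q.+1 -> gl},
    val psi x =
    \sum_(s < q.+1) \sum_(t < q.+1 | (s < t)%N)
       (-1) ^+ (s + t) *
         val phi [ffun i : 'I_q => (gl_br (x s) (x t) :: omit x [:: s; t])`_i].
Fact gl_diff0 q : gl_diff (0 : gl_cochain q) 0.
Proof.
by move=> x; rewrite big1 // => s _; rewrite big1 // => t _; exact: mulr0.
Qed.
Fact gl_diffP q (a : F) (u v : gl_cochain q) (u' v' : gl_cochain q.+1) :
  gl_diff u u' -> gl_diff v v' -> gl_diff (a *: u + v) (a *: u' + v').
Proof.
move=> du dv x; rewrite !val_sub_mod addrfctE scalrfctE du dv.
rewrite /GRing.scale /= mulr_sumr -big_split; apply: eq_bigr => s _ /=.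
rewrite mulr_sumr -big_split; apply: eq_bigr => t _ /=.
by rewrite addrfctE mulrDr; congr (_ + _); rewrite mulrCA.
Qed.
Definition gl_complex : cochain_complex F := CochainComplex gl_diff0 gl_diffP.

Definition is_shuffle p q (s : 'S_(p + q)) : bool :=
  [forall i : 'I_p, forall j : 'I_p,
     (i < j)%N ==> (s (lshift q i) < s (lshift q j))%N] &&
  [forall i : 'I_q, forall j : 'I_q,
     (i < j)%N ==> (s (rshift p i) < s (rshift p j))%N].

Definition alt_wedge p q (a : {ffun 'I_p -> gl} -> F^o)
    (b : {ffun 'I_q -> gl} -> F^o) (x : {ffun 'I_(p + q) -> gl}) : F^o :=
  \sum_(s : 'S_(p + q) | is_shuffle s)
    (-1) ^+ s * (a [ffun i => x (s (lshift q i))]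
                 * b [ffun j => x (s (rshift p j))]).

(* [gl_cup a b c]: c is the cup product of a and b *)
Definition gl_cup p q (a : coh gl_complex p) (b : coh gl_complex q)
    (c : coh gl_complex (p + q)) : Prop :=
  exists (u : gl_cochain p) (v : gl_cochain q) (w : gl_cochain (p + q)),
    [/\ @coh_class _ gl_complex p u a, @coh_class _ gl_complex q v b,
        @coh_class _ gl_complex (p + q) w c &
        forall x, val w x = alt_wedge (val u) (val v) x].

Definition gl_one (e : coh gl_complex 0) : Prop :=
  exists2 u : gl_cochain 0, @coh_class _ gl_complex 0 u e & forall x, val u x = 1.
End GL.

Section Yoneda.
Variables (F : fieldType) (n : nat) (g : lie_subalg F n).
Local Notation R := {mpoly F[n]}.
Variable I : injres (lcR g).

(* As Gamma = Hom(R, -), Ext^q(R, R) is R^q Gamma(R). *)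
Definition ExtRR q : lmodType R := RGamma I q.

(* [yoneda a b c]: c is the Yoneda product of a and b. The cocycle v : R -> I^q
   representing b extends to an endomorphism B of degree q of the resolution, and
   c is the class of B o u, where u : R -> I^p represents a. *)
Definition yoneda p q (a : ExtRR p) (b : ExtRR q) (c : ExtRR (p + q)) : Prop :=
  exists (u : Gamma (I p)) (v : Gamma (I q)) (w : Gamma (I (p + q)))
         (B : forall k, I k -> I (k + q)%N),
    [/\ [/\ @coh_class _ (Gamma_complex I) p u a,
             @coh_class _ (Gamma_complex I) q v b &
             @coh_class _ (Gamma_complex I) (p + q) w c],
        forall k, is_lchom (B k),
        forall k (x : I k), B k.+1 (ir_d x) = ir_d (B k x),
        forall r, B 0%N (ir_aug I r) = val v r &
        forall r, val w r = B p (val u r)].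

Definition ext_one (e : ExtRR 0) : Prop :=
  exists2 u : Gamma (I 0), @coh_class _ (Gamma_complex I) 0 u e &
                           forall r, val u r = ir_aug I r.
End Yoneda.

(* Main.v *)
Require Import Defs.
From HB Require Import structures.
From mathcomp Require Import all_boot all_fingroup all_algebra.
From mathcomp Require Import boolp classical_sets functions.
From mathcomp Require Import freeg mpoly zify.
Set Implicit Arguments.
Unset Strict Implicit.
Unset Printing Implicit Defensive.
Import GRing.Theory.
Local Open Scope ring_scope.

(* Cochains are functions on lists of elements of g, with the differential given
   by (d a)(x :: s) = (L_x a)(s) - d (a (x :: -)) s, so that d d = 0, the Leibniz
   rule and naturality are inductions on lists.

   (1) Let I be an injective resolution of M and consider the double complex
   C^p(g, I^k).  In the p-direction it is acyclic: I^k is a direct summand of the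
   module Hom(S(W(n)), I^k), with W(n) acting on itself by the pre-Lie product
   X |> Y = X(Y_1) d_1 + ... + X(Y_n) d_n, and a contraction of S(W(n)) (x) /\ g is
   transported to that module.  In the k-direction exactness is that of I, since
   cochains lift along surjections of vector spaces.  The staircases between the
   two edges of the double complex compare Gamma(I) with C(M).

   (2) By (1) the Ext group is H(W(n); R).  Restricting a cochain to the linear
   fields and evaluating at 0 gives a map to the cochains of gl(n).  It is onto in
   cohomology and injective because its kernel is acyclic: with e the Euler field
   and sigma a = 2 sum_i x_i a(d_i, -) - a(e, -), the operator d sigma + sigma d
   is triangular for the filtration by deg c + sum_s |deg X_s - 1|, and its
   diagonal entries are the values of that weight, which are positive on the
   kernel of the restriction.

   Multiplicativity: an endomorphism B of the resolution that lifts v turns the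
   staircase of u into one that continues with the staircase of v, multiplied by the
   cocycle of u.  This gives the cup product up to the sign (-1)^(pq), which the
   factor (-1)^(q(q-1)/2) in the isomorphism absorbs. *)

(** * Cochains on a Lie algebra *)

(** Neither homotopy operator is invertible at sight: d kappa + kappa d and d sigma + sigma d are
    only triangular, for filtrations with infinitely many layers. They are inverted pointwise,
    through the infinite product of the factors 1 - Q / lambda_i. A factor clears one eigenvalue on
    one layer, and only after all lower layers have been cleared; so every eigenvalue must recur
    infinitely often among the lambda_i, and the sequence is indexed by 2-adic valuations. The
    eigenvalues are nonzero integers, invertible in characteristic 0.

    The symmetric algebra of the whole of W(n) appears because S(n) and H(n) are not closed under
    |>; g is reached through a linear retraction of W(n). With X acting on s by X s + X |> s,
    S(W(n)) is a model of the enveloping algebra of W(n) that needs no ordered basis.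

    The factor 2 in sigma: on the diagonal, e alone gives deg c - sum_s (deg X_s - 1), which may
    have either sign, and sum_i x_i a(d_i, -) gives deg c plus the number of constant fields. Twice
    the second minus the first is the weight with absolute values. *)

(* [zmod] decides identities between elements of an abelian group, as [ring] does
   for rings. *)
Inductive zexp := ZVar of nat | ZAdd of zexp & zexp | ZOpp of zexp | ZNil.

Fixpoint zeval (M : zmodType) (env : seq M) e : M :=
  match e with
  | ZVar i => nth 0 env i
  | ZAdd a b => zeval env a + zeval env b
  | ZOpp a => - zeval env a
  | ZNil => 0
  end.

Fixpoint zcoef e (i : nat) : int :=
  match e with
  | ZVar j => if i == j then 1 else 0
  | ZAdd a b => zcoef a i + zcoef b i
  | ZOpp a => - zcoef a i
  | ZNil => 0
  end.

Lemma zevalE (M : zmodType) (env : seq M) e :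
  zeval env e = \sum_(i < size env) nth 0 env i *~ zcoef e i.
Proof.
elim: e => [j|a IHa b IHb|a IHa|] /=; rewrite ?IHa ?IHb.
- have [jn|nj] := ltnP j (size env).
    rewrite (bigD1 (Ordinal jn)) //= eqxx mulr1z big1 ?addr0 // => i.
    by rewrite -val_eqE /= => /negPf ->; rewrite mulr0z.
  rewrite nth_default // big1 // => i _.
  by rewrite ifN ?mulr0z // neq_ltn (leq_trans (ltn_ord i) nj).
- by rewrite -big_split; apply: eq_bigr => i _; rewrite mulrzDr.
- by rewrite -sumrN; apply: eq_bigr => i _; rewrite mulrNz.
- by rewrite big1 // => i _; rewrite mulr0z.
Qed.

Lemma zmod_reflect (M : zmodType) (env : seq M) e1 e2 :
  all (fun i => zcoef e1 i == zcoef e2 i) (iota 0 (size env)) ->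
  zeval env e1 = zeval env e2.
Proof.
move=> /allP h; rewrite !zevalE; apply: eq_bigr => i _; congr (_ *~ _).
by apply/eqP/h; rewrite mem_iota /= ltn_ord.
Qed.

(** Atoms are compared up to conversion, because rewriting leaves different spellings of one and the
    same contraction. In [zindex] and [zmem], the [match] on a constant term runs this test inside a
    tactic that returns a term, so that a failing test selects the next branch. *)
Ltac zsame x y :=
  first [constr_eq x y | let _ := constr:(@erefl _ x : x = y) in idtac].

Ltac zindex x env :=
  lazymatch env with
  | cons ?y ?env' =>
    match constr:(Set) with
    | _ => let _ := match constr:(Set) with _ => zsame x y end in constr:(0%N)
    | _ => let i := zindex x env' in constr:(S i)
    end
  end.

Ltac zmem x env :=
  lazymatch env with
  | nil => constr:(false)
  | cons ?y ?env' =>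
    match constr:(Set) with
    | _ => let _ := match constr:(Set) with _ => zsame x y end in constr:(true)
    | _ => zmem x env'
    end
  end.

Ltac zatoms t env :=
  lazymatch t with
  | @Algebra.add _ ?a ?b => let env := zatoms a env in zatoms b env
  | @Algebra.opp _ ?a => zatoms a env
  | @Algebra.zero _ => env
  | _ => let b := zmem t env in
         lazymatch b with true => env | false => constr:(cons t env) end
  end.

Ltac zreify t env :=
  lazymatch t with
  | @Algebra.add _ ?a ?b =>
    let a := zreify a env in let b := zreify b env in constr:(ZAdd a b)
  | @Algebra.opp _ ?a => let a := zreify a env in constr:(ZOpp a)
  | @Algebra.zero _ => constr:(ZNil)
  | _ => let i := zindex t env in constr:(ZVar i)
  end.

Ltac zmod :=
  lazymatch goal with
  | |- @eq ?T ?a ?b =>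
    let env := zatoms a (@nil T) in
    let env := zatoms b env in
    let e1 := zreify a env in
    let e2 := zreify b env in
    apply: (@zmod_reflect _ env e1 e2); vm_compute; reflexivity
  end.

Lemma fctD (T : Type) (M : zmodType) (f g : T -> M) t : (f + g) t = f t + g t.
Proof. by []. Qed.
Lemma fctN (T : Type) (M : zmodType) (f : T -> M) t : (- f) t = - f t.
Proof. by []. Qed.
Lemma fct0 (T : Type) (M : zmodType) t : (0 : T -> M) t = 0.
Proof. by []. Qed.
Lemma fctZ (K : pzRingType) (T : Type) (M : lmodType K) (k : K) (f : T -> M) t :
  (k *: f) t = k *: f t.
Proof. by []. Qed.
Definition fctE := (fctD, fctN, fct0, fctZ).

Section Derivation.
Variables (E : Type) (M : zmodType).
Implicit Types (f g : seq E -> M) (T : E -> E).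

(** Contraction with [x]. A function on lists carries all degrees at once and is determined by its
    value on the empty list and by its contractions. An operator can therefore be given by its value
    on the empty list and its commutation rule with [ins]. *)
Definition ins (x : E) f : seq E -> M := fun s => f (x :: s).

Arguments ins : simpl never.

Fixpoint der T f (s : seq E) : M :=
  if s is y :: s' then f (T y :: s') + der T (ins y f) s' else 0.

Lemma insD x f g : ins x (f + g) = ins x f + ins x g. Proof. by []. Qed.
Lemma insN x f : ins x (- f) = - ins x f. Proof. by []. Qed.
Lemma insB x f g : ins x (f - g) = ins x f - ins x g. Proof. by []. Qed.
Lemma ins0 x : ins x 0 = 0. Proof. by []. Qed.

Lemma derD T f g : der T (f + g) = der T f + der T g.
Proof.
apply/funext => s; elim: s f g => [|y s IH] f g /=; first by rewrite !fctE addr0.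
by rewrite insD IH !fctE /=; zmod.
Qed.
Lemma derN T f : der T (- f) = - der T f.
Proof.
apply/funext => s; elim: s f => [|y s IH] f /=; first by rewrite !fctE oppr0.
by rewrite insN IH !fctE /=; zmod.
Qed.
Lemma derB T f g : der T (f - g) = der T f - der T g.
Proof. by rewrite derD derN. Qed.
Lemma der0 T : der T 0 = 0.
Proof. by have := derB T 0 0; rewrite !subrr. Qed.

Lemma insE x f s : ins x f s = f (x :: s). Proof. by []. Qed.

Lemma ins_der y T f : ins y (der T f) = ins (T y) f + der T (ins y f).
Proof. by []. Qed.
End Derivation.

Lemma ins_scale (K : pzRingType) (E : Type) (M : lmodType K) x k (f : seq E -> M) :
  ins x (k *: f) = k *: ins x f.
Proof. by []. Qed.

Lemma der_scale (K : pzRingType) (E : Type) (M : lmodType K) T k (f : seq E -> M) :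
  der T (k *: f) = k *: der T f.
Proof.
apply/funext => s; elim: s f => [|y s IH] f /=; first by rewrite fctE scaler0.
by rewrite ins_scale IH !fctE scalerDr.
Qed.

(** The lock keeps Lie derivatives folded in comparisons up to conversion, those of [zmod] in
    particular. *)
Fact lieD_key : unit. Proof. exact: tt. Qed.

Section Lie.
Variables (F : fieldType) (L : lmodType F).

Record lie_bracket := LieBracket {
  bra :> L -> L -> L;
  bra_linr : forall x c y z, bra x (c *: y + z) = c *: bra x y + bra x z;
  bra_linl : forall x c y z, bra (c *: y + z) x = c *: bra y x + bra z x;
  bra_alt : forall x, bra x x = 0;
  bra_jac : forall x y z, bra x (bra y z) = bra (bra x y) z + bra y (bra x z) }.

Variable br : lie_bracket.

Section Modules.
Variables (K : comNzRingType) (iota : {rmorphism F -> K}).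

(** Two coefficient rings [K] occur: the polynomial ring, over which a Lie-Cartan module is a module
    although g acts linearly over the constants only, and F itself, for gl(n). Hence linearity is
    required through [iota]. *)
Record lie_rep (M : lmodType K) := LieRep {
  act :> L -> M -> M;
  act_linr : forall x c m m', act x (iota c *: m + m') = iota c *: act x m + act x m';
  act_linl : forall c x y m, act (c *: x + y) m = iota c *: act x m + act y m;
  act_br : forall x y m, act (br x y) m = act x (act y m) - act y (act x m) }.

Section MultilinearMaps.
Variables (E : lmodType F) (M : lmodType K).
Implicit Types f : seq E -> M.
Definition multilin f := forall s1 c x y s2,
  f (s1 ++ (c *: x + y) :: s2) = iota c *: f (s1 ++ x :: s2) + f (s1 ++ y :: s2).
Definition altern f := forall s1 x s2, f (s1 ++ x :: x :: s2) = 0.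
Definition symm f := forall s1 x y s2, f (s1 ++ x :: y :: s2) = f (s1 ++ y :: x :: s2).
Definition supp (q : nat) f := forall s, size s != q -> f s = 0.

Record cochain f : Prop := Cochain { coch_lin : multilin f; coch_alt : altern f }.

Lemma multilin_ins x f : multilin f -> multilin (ins x f).
Proof. by move=> lf s1 c y z s2; apply: (lf (x :: s1)). Qed.

Lemma multilin_cons f c x y :
  multilin f -> ins (c *: x + y) f = iota c *: ins x f + ins y f.
Proof. by move=> lf; apply/funext => s; apply: (lf [::]). Qed.

Lemma multilin_consD f x y : multilin f -> ins (x + y) f = ins x f + ins y f.
Proof. by move=> lf; have := multilin_cons 1 x y lf; rewrite rmorph1 !scale1r. Qed.

Lemma multilin_cons0 f : multilin f -> ins 0 f = 0.
Proof.
move=> lf; have := multilin_cons (-1) 0 0 lf.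
by rewrite rmorphN1 !scaleN1r !addNr.
Qed.

Lemma multilin_consZ f c x : multilin f -> ins (c *: x) f = iota c *: ins x f.
Proof.
by move=> lf; have := multilin_cons c x 0 lf; rewrite (multilin_cons0 lf) !addr0.
Qed.

Lemma multilin_consN f x : multilin f -> ins (- x) f = - ins x f.
Proof. by move=> lf; rewrite -scaleN1r (multilin_consZ _ _ lf) rmorphN1 scaleN1r. Qed.

Lemma multilin_consB f x y : multilin f -> ins (x - y) f = ins x f - ins y f.
Proof. by move=> lf; rewrite (multilin_consD _ _ lf) (multilin_consN _ lf). Qed.

Lemma cochain_ins x f : cochain f -> cochain (ins x f).
Proof. by move=> [lf af]; split; [exact: multilin_ins|move=> s1; apply: (af (x :: s1))]. Qed.

Lemma cochain_insins x f : cochain f -> ins x (ins x f) = 0.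
Proof. by move=> [_ af]; apply/funext => s; apply: (af [::]). Qed.

(** Polarization of the alternating property in the first two arguments. *)
Lemma cochain_swap x y f : cochain f -> ins x (ins y f) = - ins y (ins x f).
Proof.
move=> cf; have := cochain_insins (x + y) cf; have [lf _] := cf.
rewrite (multilin_consD _ _ lf) insD !multilin_consD; try exact: multilin_ins.
rewrite !cochain_insins // add0r addr0 => /eqP.
by rewrite addr_eq0 -eqr_oppLR => /eqP <-.
Qed.

Lemma multilin0 : multilin 0.
Proof. by move=> *; rewrite !fctE scaler0 addr0. Qed.

Lemma multilin_comb (a b : K) f g :
  multilin f -> multilin g -> multilin (a *: f + b *: g).
Proof.
move=> lf lg s1 c x y s2; rewrite !fctE lf lg !scalerDr !scalerA !(mulrC (iota c)).
by rewrite addrACA.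
Qed.

Lemma multilinD f g : multilin f -> multilin g -> multilin (f + g).
Proof. by move=> lf lg; have := multilin_comb 1 1 lf lg; rewrite !scale1r. Qed.

Lemma multilinN f : multilin f -> multilin (- f).
Proof.
move=> lf; have := multilin_comb (-1) 0 lf multilin0.
by rewrite scaleN1r scaler0 addr0.
Qed.

Lemma cochain_comb (a b : K) f g :
  cochain f -> cochain g -> cochain (a *: f + b *: g).
Proof.
move=> [lf af] [lg ag]; split; first exact: multilin_comb.
by move=> s1 x s2; rewrite !fctE af ag !scaler0 addr0.
Qed.
Lemma cochain0 : cochain 0.
Proof. by split; [exact: multilin0|]. Qed.
Lemma cochainD f g : cochain f -> cochain g -> cochain (f + g).
Proof. by move=> lf lg; have := cochain_comb 1 1 lf lg; rewrite !scale1r. Qed.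
Lemma cochainZ a f : cochain f -> cochain (a *: f).
Proof. by move=> lf; have := cochain_comb a 0 lf cochain0; rewrite scaler0 addr0. Qed.
Lemma cochainN f : cochain f -> cochain (- f).
Proof. by rewrite -scaleN1r; apply: cochainZ. Qed.
Lemma cochainB f g : cochain f -> cochain g -> cochain (f - g).
Proof. by move=> cf cg; apply: cochainD => //; apply: cochainN. Qed.

Lemma suppD q f g : supp q f -> supp q g -> supp q (f + g).
Proof. by move=> sf sg s qs; rewrite !fctE sf // sg // addr0. Qed.
Lemma suppN q f : supp q f -> supp q (- f).
Proof. by move=> sf s qs; rewrite !fctE sf // oppr0. Qed.
Lemma suppB q f g : supp q f -> supp q g -> supp q (f - g).
Proof. by move=> cf cg; apply: suppD => //; apply: suppN. Qed.
Lemma suppZ q a f : supp q f -> supp q (a *: f).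
Proof. by move=> sf s qs; rewrite !fctE sf // scaler0. Qed.
Lemma supp_ins q x f : supp q.+1 f -> supp q (ins x f).
Proof. by move=> sf s qs; apply: sf. Qed.

Lemma supp_ins0 x f : supp 0 f -> ins x f = 0.
Proof. by move=> sf; apply/funext => s; apply: sf. Qed.

Lemma supp_der q T f : supp q f -> supp q (der T f).
Proof.
move=> sf s; elim: s q f sf => [|y s IH] q f sf //= qs.
rewrite sf // add0r; case: q sf qs => [|q] sf qs.
  by rewrite supp_ins0 // der0.
by apply: (IH q) => //; apply: supp_ins.
Qed.

Lemma multilin_der T f : (forall c x y, T (c *: x + y) = c *: T x + T y) ->
  multilin f -> multilin (der T f).
Proof.
move=> Tlin lf s1; elim: s1 f lf => [|z s1 IH] f lf c x y s2 /=.
  have /= e := lf [::] c (T x) (T y) s2.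
  rewrite Tlin e (multilin_cons c x y lf) derD der_scale !fctE scalerDr.
  by rewrite addrACA.
have := lf (T z :: s1) c x y s2; rewrite /= => ->.
by rewrite IH ?scalerDr 1?addrACA //; exact: multilin_ins.
Qed.

Lemma cochain_der T f : (forall c x y, T (c *: x + y) = c *: T x + T y) ->
  cochain f -> cochain (der T f).
Proof.
move=> Tlin cf; split; first by apply: multilin_der => //; case: cf.
move=> s1; elim: s1 f cf => [|z s1 IH] f cf x s2 /=.
  have e : f [:: T x, x & s2] = - f [:: x, T x & s2].
    by have := congr1 (@^~ s2) (cochain_swap x (T x) cf).
  by rewrite e cochain_insins // der0 !insE !fctE; zmod.
have [_ af] := cf; rewrite (af (T z :: s1)) add0r; exact/IH/cochain_ins.
Qed.
End MultilinearMaps.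

Section Differential.
Variables (M : lmodType K) (rho : lie_rep M).
Implicit Types f : seq L -> M.

Lemma actD x m m' : rho x (m + m') = rho x m + rho x m'.
Proof. by have := act_linr rho x 1 m m'; rewrite rmorph1 !scale1r. Qed.
Lemma act0 x : rho x 0 = 0.
Proof. by apply: (addrI (rho x 0)); rewrite -actD !addr0. Qed.
Lemma actZ x c m : rho x (iota c *: m) = iota c *: rho x m.
Proof. by have := act_linr rho x c m 0; rewrite act0 !addr0. Qed.
Lemma actN x m : rho x (- m) = - rho x m.
Proof. by apply: (addrI (rho x m)); rewrite -actD !subrr act0. Qed.
Lemma actB x m m' : rho x (m - m') = rho x m - rho x m'.
Proof. by rewrite actD actN. Qed.

Definition lieD x f : seq L -> M :=
  locked_with lieD_key (fun s => rho x (f s) - der (br x) f s).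
Lemma lieDE x f : lieD x f = fun s => rho x (f s) - der (br x) f s.
Proof. by rewrite /lieD unlock. Qed.

Fixpoint cdf f (s : seq L) : M :=
  if s is x :: s' then lieD x f s' - cdf (ins x f) s' else 0.

Lemma lieDD x f g : lieD x (f + g) = lieD x f + lieD x g.
Proof. by apply/funext => s; rewrite !lieDE derD !fctE actD; zmod. Qed.
Lemma lieDN x f : lieD x (- f) = - lieD x f.
Proof. by apply/funext => s; rewrite !lieDE derN !fctE actN; zmod. Qed.
Lemma lieDB x f g : lieD x (f - g) = lieD x f - lieD x g.
Proof. by rewrite lieDD lieDN. Qed.
Lemma cdfD f g : cdf (f + g) = cdf f + cdf g.
Proof.
apply/funext => s; elim: s f g => [|x s IH] f g /=; first by rewrite !fctE addr0.
by rewrite insD IH lieDD !fctE /=; zmod.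
Qed.
Lemma cdfN f : cdf (- f) = - cdf f.
Proof.
apply/funext => s; elim: s f => [|x s IH] f /=; first by rewrite !fctE oppr0.
by rewrite insN IH lieDN !fctE /=; zmod.
Qed.
Lemma cdfB f g : cdf (f - g) = cdf f - cdf g.
Proof. by rewrite cdfD cdfN. Qed.
Lemma cdf0 : cdf 0 = 0.
Proof. by have := cdfB 0 0; rewrite !subrr. Qed.

Lemma lieD_scale x c f : lieD x (iota c *: f) = iota c *: lieD x f.
Proof.
by apply/funext => s; rewrite !lieDE der_scale !fctE actZ scalerBr.
Qed.

Lemma cdf_scale c f : cdf (iota c *: f) = iota c *: cdf f.
Proof.
apply/funext => s; elim: s f => [|x s IH] f /=; first by rewrite fctE scaler0.
by rewrite ins_scale IH lieD_scale !fctE /= scalerBr.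
Qed.

Lemma ins_lieD x y f : ins y (lieD x f) = lieD x (ins y f) - ins (br x y) f.
Proof.
apply/funext => s; rewrite !fctE !lieDE !insE /=; zmod.
Qed.

Lemma ins_cdf x f : ins x (cdf f) = lieD x f - cdf (ins x f).
Proof. by []. Qed.

Lemma lieD_nil x f : lieD x f [::] = rho x (f [::]).
Proof. by rewrite !lieDE subr0. Qed.

Lemma cochain_lieD x f : cochain f -> cochain (lieD x f).
Proof.
rewrite lieDE.
move=> [lf af]; apply: cochainB.
  by split=> [s1 c y z s2|s1 y s2]; rewrite ?lf ?act_linr // af act0.
by apply: cochain_der => // *; rewrite bra_linr.
Qed.

Lemma supp_lieD q x f : supp q f -> supp q (lieD x f).
Proof.
rewrite lieDE.
move=> sf; apply: suppB; last exact: supp_der.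
by move=> s qs; rewrite sf // act0.
Qed.

Lemma lieD_linl c x y f : multilin f ->
  lieD (c *: x + y) f = iota c *: lieD x f + lieD y f.
Proof.
move=> lf; apply/funext => s.
elim: s f lf => [|z s IH] f lf; first by rewrite !fctE !lieD_nil act_linl.
rewrite -[LHS]/(ins z _ s) ins_lieD !fctE IH; last exact: multilin_ins.
rewrite bra_linl (multilin_cons _ _ _ lf) !fctE.
rewrite -[lieD x f _]/(ins z _ s) -[lieD y f _]/(ins z _ s) !ins_lieD !fctE.
by rewrite scalerBr; zmod.
Qed.

Lemma supp_cdf q f : supp q f -> supp q.+1 (cdf f).
Proof.
move=> sf s; elim: s q f sf => [|x s IH] q f sf //= qs.
rewrite (supp_lieD x sf) // sub0r; case: q sf qs => [|q] sf qs.
  by rewrite supp_ins0 // cdf0 fctE oppr0.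
by rewrite (IH q) ?oppr0 //; apply: supp_ins.
Qed.

Lemma lieD_comm x y f : multilin f ->
  lieD x (lieD y f) - lieD y (lieD x f) = lieD (br x y) f.
Proof.
move=> lf; apply/funext => s.
elim: s f lf => [|z s IH] f lf; first by rewrite !fctE !lieD_nil act_br.
rewrite -[LHS]/(ins z _ s) -[RHS]/(ins z _ s) insB !ins_lieD !lieDB.
rewrite !fctE -IH; last exact: multilin_ins.
have -> : br (br x y) z = br x (br y z) - br y (br x z).
  by rewrite bra_jac addrK.
by rewrite (multilin_consB _ _ lf) !fctE; zmod.
Qed.

(** Contraction with y turns the commutator of L_x and d into [L_x, L_y] - L_[x,y], which is 0,
    minus the same commutator on the contracted cochain. *)
Lemma lieD_cdf x f : multilin f -> lieD x (cdf f) = cdf (lieD x f).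
Proof.
move=> lf; apply/funext => s.
elim: s x f lf => [|y s IH] x f lf; first by rewrite lieD_nil act0.
rewrite -[LHS]/(ins y _ s) -[RHS]/(ins y _ s) ins_lieD !ins_cdf lieDB ins_lieD.
have := congr1 (@^~ s) (lieD_comm x y lf); rewrite !fctE => <-.
by rewrite (IH _ _ (multilin_ins y lf)) cdfB !fctE; zmod.
Qed.

Lemma cdf_cdf f : multilin f -> cdf (cdf f) = 0.
Proof.
move=> lf; apply/funext => s; elim: s f lf => [//|y s IH] f lf.
rewrite -[LHS]/(ins y _ s) !ins_cdf lieD_cdf // cdfB !fctE IH ?subr0 ?subrr //.
exact: multilin_ins.
Qed.

Lemma cochain_cdf f : cochain f -> cochain (cdf f).
Proof.
move=> cf; split=> s1; elim: s1 f cf => [|z s1 IH] f cf.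
- move=> c x y s2; have [lf _] := cf.
  rewrite -[LHS]/(ins _ _ s2) -[_ (_ ++ x :: s2)]/(ins _ _ s2).
  rewrite -[_ (_ ++ y :: s2)]/(ins _ _ s2) !ins_cdf lieD_linl // multilin_cons //.
  by rewrite cdfD cdf_scale !fctE scalerBr; zmod.
- move=> c x y s2; have [lf _] := cochain_lieD z cf.
  rewrite /= lf (IH _ (cochain_ins z cf)) scalerBr; zmod.
(* Here i_x i_x d = d i_x i_x - i_[x,x]. *)
- move=> x s2; rewrite -[LHS]/(ins x (ins x _) s2) ins_cdf insB ins_lieD ins_cdf.
  rewrite cochain_insins // bra_alt (multilin_cons0 (coch_lin cf)) cdf0 !fctE.
  by zmod.
- move=> x s2; have [_ af] := cochain_lieD z cf.
  by rewrite /= af (IH _ (cochain_ins z cf)) subrr.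
Qed.
End Differential.

Section Sign.
Variables (M : lmodType K) (rho : lie_rep M).
Implicit Types f : seq L -> M.

(** The grading involution. It stands for the Koszul sign of the first factor in [cup] and in its
    Leibniz rule, since a function on lists need not be homogeneous. *)
Definition sgnf f : seq L -> M := fun s => (-1) ^+ size s *: f s.

Lemma sgnfD f g : sgnf (f + g) = sgnf f + sgnf g.
Proof. by apply/funext => s; rewrite /sgnf !fctE scalerDr. Qed.
Lemma sgnfN f : sgnf (- f) = - sgnf f.
Proof. by apply/funext => s; rewrite /sgnf !fctE scalerN. Qed.
Lemma sgnfZ k f : sgnf (k *: f) = k *: sgnf f.
Proof. by apply/funext => s; rewrite /sgnf !fctE !scalerA mulrC. Qed.
Lemma ins_sgnf x f : ins x (sgnf f) = - sgnf (ins x f).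
Proof. by apply/funext => s; rewrite /sgnf /ins fctE /= exprS mulN1r scaleNr. Qed.
Lemma sgnfK f : sgnf (sgnf f) = f.
Proof.
apply/funext => s; rewrite /sgnf scalerA -exprMn mulrNN mulr1 expr1n.
by rewrite scale1r.
Qed.
Lemma sgnf_nil f : sgnf f [::] = f [::]. Proof. exact: scale1r. Qed.

Lemma sgnf_supp p f : supp p f -> sgnf f = (-1) ^+ p *: f.
Proof.
move=> sf; apply/funext => s; rewrite /sgnf fctE.
by have [->//|ps] := eqVneq (size s) p; rewrite sf // !scaler0.
Qed.

Lemma lieD_sgnf x f : lieD rho x (sgnf f) = sgnf (lieD rho x f).
Proof.
apply/funext => s.
elim: s f => [|y s IH] f; first by rewrite sgnf_nil !lieD_nil sgnf_nil.
rewrite -[LHS]/(ins y _ s) -[RHS]/(ins y _ s) ins_lieD !ins_sgnf lieDN ins_lieD.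
by rewrite sgnfD sgnfN !fctE IH; zmod.
Qed.

Lemma cdf_sgnf f : cdf rho (sgnf f) = - sgnf (cdf rho f).
Proof.
apply/funext => s; elim: s f => [|x s IH] f; first by rewrite /= fctE sgnf_nil oppr0.
rewrite -[LHS]/(ins x _ s) -[RHS]/(ins x _ s) ins_cdf ins_sgnf lieD_sgnf.
by rewrite insN ins_sgnf ins_cdf sgnfD sgnfN cdfN !fctE IH !fctE; zmod.
Qed.

End Sign.

Section Cup.
Variables (M : lmodType K) (rho : lie_rep M) (del : lie_rep K^o).
Hypothesis compat : forall x (k : K^o) (m : M),
  rho x (k *: m) = del x k *: m + k *: rho x m.
Implicit Types (a : seq L -> K^o) (h : seq L -> M).

(** The exterior product, defined by the requirement that contractions act on it as antiderivations;
    [wed_cup] identifies it with the sum over shuffles. *)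
Fixpoint cup a h (s : seq L) : M :=
  if s is x :: s' then cup (ins x a) h s' + cup (sgnf a) (ins x h) s'
  else (a [::] : K) *: h [::].

Lemma ins_cup x a h : ins x (cup a h) = cup (ins x a) h + cup (sgnf a) (ins x h).
Proof. by []. Qed.

Lemma cupDl a b h : cup (a + b) h = cup a h + cup b h.
Proof.
apply/funext => s; elim: s a b h => [|x s IH] a b h /=.
  by rewrite !fctE /= scalerDl.
by rewrite insD sgnfD !IH !fctE /=; zmod.
Qed.
Lemma cupDr a h k : cup a (h + k) = cup a h + cup a k.
Proof.
apply/funext => s; elim: s a h k => [|x s IH] a h k /=.
  by rewrite !fctE /= scalerDr.
by rewrite insD !IH !fctE /=; zmod.
Qed.
Lemma cupZl c a h : cup (c *: a) h = c *: cup a h.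
Proof.
apply/funext => s; elim: s a h => [|x s IH] a h /=.
  by rewrite !fctE /= scalerA.
by rewrite ins_scale sgnfZ !IH !fctE /= scalerDr.
Qed.
Lemma cupZr c a h : cup a (c *: h) = c *: cup a h.
Proof.
apply/funext => s; elim: s a h => [|x s IH] a h /=.
  by rewrite !fctE /= !scalerA mulrC.
by rewrite ins_scale !IH !fctE /= scalerDr.
Qed.
Lemma cupNl a h : cup (- a) h = - cup a h.
Proof. by rewrite -scaleN1r cupZl scaleN1r. Qed.
Lemma cupNr a h : cup a (- h) = - cup a h.
Proof. by rewrite -scaleN1r cupZr scaleN1r. Qed.
Lemma cup0l h : cup 0 h = 0.
Proof. by rewrite -[X in cup X](scale0r 0) cupZl scale0r. Qed.
Lemma cup0r a : cup a 0 = 0.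
Proof. by rewrite -[X in cup _ X](scale0r 0) cupZr scale0r. Qed.

Lemma supp_cup p q a h : supp p a -> supp q h -> supp (p + q) (cup a h).
Proof.
move=> sa sh s; elim: s p q a h sa sh => [|x s IH] p q a h sa sh /= pq.
  have [p0|p0] := eqVneq p 0%N; last by rewrite sa ?scale0r // eq_sym.
  by rewrite sh ?scaler0 // eq_sym; move: pq; rewrite p0 eq_sym.
have -> : cup (ins x a) h s = 0.
  case: p sa pq => [|p] sa pq; first by rewrite supp_ins0 // cup0l.
  by apply: (IH p q) => //; apply: supp_ins.
rewrite add0r (sgnf_supp sa) cupZl fctE.
case: q sh pq => [|q] sh pq; first by rewrite supp_ins0 // cup0r scaler0.
rewrite (IH p q) ?scaler0 //; first exact: supp_ins.
by move: pq; rewrite addnS.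
Qed.

Lemma lieD_cup x a h :
  lieD rho x (cup a h) = cup (lieD del x a) h + cup a (lieD rho x h).
Proof.
apply/funext => s; elim: s a h => [|y s IH] a h.
  by rewrite !fctE /= !lieD_nil /= compat.
rewrite -[LHS]/(ins y _ s) -[RHS]/(ins y _ s) insD ins_lieD !ins_cup lieDD !ins_lieD.
rewrite -lieD_sgnf !cupDl !cupDr cupNl cupNr !fctE !IH !fctE.
by zmod.
Qed.

Lemma cdf_cup a h :
  cdf rho (cup a h) = cup (cdf del a) h + cup (sgnf a) (cdf rho h).
Proof.
apply/funext => s; elim: s a h => [|x s IH] a h.
  by rewrite !fctE /= scale0r scaler0 addr0.
rewrite -[LHS]/(ins x _ s) -[RHS]/(ins x _ s) ins_cdf insD !ins_cup cdfD !fctE !IH.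
rewrite !ins_cdf ins_sgnf cdf_sgnf sgnfK lieD_cup.
rewrite !cupDl !cupDr !cupNl !cupNr !fctE; zmod.
Qed.

Lemma multilin_sgnf f : @multilin L K^o f -> @multilin L K^o (sgnf f).
Proof.
move=> lf s1 c x y s2; rewrite /sgnf lf !size_cat /= scalerDr; congr (_ + _).
by rewrite !scalerA mulrC.
Qed.

Lemma cochain_sgnfK f : @cochain L K^o f -> @cochain L K^o (sgnf f).
Proof.
move=> [lf af]; split; first exact: multilin_sgnf.
by move=> s1 x s2; rewrite /sgnf af scaler0.
Qed.

Lemma cochain_cup a h : cochain a -> cochain h -> cochain (cup a h).
Proof.
move=> ca ch; split=> s1; elim: s1 a h ca ch => [|z s1 IH] a h ca ch.
- move=> c x y s2 /=; have [la _] := ca; have [lh _] := ch.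
  by rewrite !multilin_cons // cupDl cupDr cupZl cupZr !fctE scalerDr; zmod.
- move=> c x y s2 /=; rewrite !IH ?scalerDr //; first by zmod.
  + exact: cochain_sgnfK.
  + exact: cochain_ins.
  + exact: cochain_ins.
- move=> x s2; rewrite -[LHS]/(ins x (ins x _) s2) ins_cup insD !ins_cup ins_sgnf.
  by rewrite !cochain_insins // cup0l cup0r cupNl !fctE; zmod.
- move=> x s2 /=; rewrite !IH ?addr0 //.
  + exact: cochain_sgnfK.
  + exact: cochain_ins.
  + exact: cochain_ins.
Qed.

Lemma cup_supp0 a h s : supp 0 h -> cup a h s = (a s : K) *: h [::].
Proof.
move=> sh; elim: s a => [//|x s IH] a /=.
by rewrite IH supp_ins0 // cup0r fctE addr0.
Qed.
End Cup.
End Modules.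

End Lie.

Section Pullback.
Variables (F : fieldType) (L1 L2 : lmodType F).
Variables (br1 : lie_bracket L1) (br2 : lie_bracket L2).
Variables (K1 K2 : comNzRingType) (iota1 : {rmorphism F -> K1}) (iota2 : {rmorphism F -> K2}).
Variables (M1 : lmodType K1) (M2 : lmodType K2).
Variables (rho1 : lie_rep br1 iota1 M1) (rho2 : lie_rep br2 iota2 M2).
Variables (h : L2 -> L1) (w : M1 -> M2).
Hypothesis h_lin : forall c x y, h (c *: x + y) = c *: h x + h y.
Hypothesis h_br : forall x y, h (br2 x y) = br1 (h x) (h y).
Hypothesis w_lin : forall c u v, w (iota1 c *: u + v) = iota2 c *: w u + w v.
Hypothesis w_act : forall x m, w (rho1 (h x) m) = rho2 x (w m).
Implicit Types f : seq L1 -> M1.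

(** One construction covers three cases: change of coefficients ([h] is the identity), restriction
    to gl(n) ([hat] followed by evaluation at 0), and extension from gl(n) along [linpart]. The last
    map preserves no brackets, so that only the statements on linearity and support apply to it. *)
Definition pull f : seq L2 -> M2 := fun s => w (f (map h s)).

Let wD u v : w (u + v) = w u + w v.
Proof. by have := w_lin 1 u v; rewrite !rmorph1 !scale1r. Qed.
Let w0 : w 0 = 0.
Proof. by apply: (addrI (w 0)); rewrite -wD !addr0. Qed.
Let wN u : w (- u) = - w u.
Proof. by apply: (addrI (w u)); rewrite -wD !subrr w0. Qed.
Let wZ c u : w (iota1 c *: u) = iota2 c *: w u.
Proof. by have := w_lin c u 0; rewrite w0 !addr0. Qed.

Lemma pullD f g : pull (f + g) = pull f + pull g.
Proof. by apply/funext => s; rewrite /pull !fctE wD. Qed.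
Lemma pullN f : pull (- f) = - pull f.
Proof. by apply/funext => s; rewrite /pull !fctE wN. Qed.
Lemma pullB f g : pull (f - g) = pull f - pull g.
Proof. by rewrite pullD pullN. Qed.
Lemma pull0 : pull 0 = 0.
Proof. by apply/funext => s; exact: w0. Qed.
Lemma pullZ c f : pull (iota1 c *: f) = iota2 c *: pull f.
Proof. by apply/funext => s; rewrite /pull !fctE wZ. Qed.

Lemma ins_pull x f : ins x (pull f) = pull (ins (h x) f). Proof. by []. Qed.

Lemma supp_pull q f : supp q f -> supp q (pull f).
Proof. by move=> sf s qs; rewrite /pull sf ?w0 ?size_map. Qed.

Lemma multilin_pull f : multilin iota1 f -> multilin iota2 (pull f).
Proof. by move=> lf s1 c x y s2; rewrite /pull !map_cat /= h_lin lf w_lin. Qed.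

Lemma cochain_pull f : cochain iota1 f -> cochain iota2 (pull f).
Proof.
move=> [lf af]; split; first exact: multilin_pull.
by move=> s1 x s2; rewrite /pull !map_cat /= af w0.
Qed.

Lemma der_pull x f : der (br2 x) (pull f) = pull (der (br1 (h x)) f).
Proof.
apply/funext => s; elim: s f => [|y s IH] f; first by rewrite /pull w0.
by rewrite /= ins_pull IH /pull /= h_br wD.
Qed.

Lemma lieD_pull x f : lieD rho2 x (pull f) = pull (lieD rho1 (h x) f).
Proof.
by apply/funext => s; rewrite lieDE der_pull lieDE /pull wD wN w_act.
Qed.

Lemma cdf_pull f : cdf rho2 (pull f) = pull (cdf rho1 f).
Proof.
apply/funext => s; elim: s f => [|x s IH] f; first by rewrite /pull w0.
by rewrite /= lieD_pull ins_pull IH /pull /= wD wN.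
Qed.

Section PullCup.
Variable (v : K1^o -> K2^o).
Hypothesis v_scale : forall k u, w (k *: u) = v k *: w u.
Hypothesis v_lin : forall (e : bool) k, v ((-1) ^+ e * k) = (-1) ^+ e * v k.

Lemma pull_cup (a : seq L1 -> K1^o) f :
  cup (fun s => v (a (map h s))) (pull f) = pull (cup a f).
Proof.
apply/funext => s; elim: s a f => [|x s IH] a f /=; first by rewrite /pull /= v_scale.
rewrite /pull /= wD -/(pull _ _) -/(pull (cup (sgnf a) _) _) -!IH; congr (_ + _).
congr (cup _ _ s); apply/funext => t.
rewrite /sgnf size_map -signr_odd [in RHS]/GRing.scale /= -[in RHS]signr_odd.
by rewrite v_lin.
Qed.
End PullCup.
End Pullback.

(** * Linear selections from linear relations *)

Section Selection.
Variable F : fieldType.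

(* A copy of the carrier of an additive group on which F acts by sc. *)
Record fspace := FSpace {
  fs_sort :> zmodType;
  fsc : F -> fs_sort -> fs_sort;
  fscD : forall c u v, fsc c (u + v) = fsc c u + fsc c v;
  fscA : forall a b u, fsc a (fsc b u) = fsc (a * b) u;
  fsc1 : forall u, fsc 1 u = u;
  fscDl : forall a b u, fsc (a + b) u = fsc a u + fsc b u }.

Lemma fsc0r (U : fspace) c : fsc c (0 : U) = 0.
Proof. by apply: (addrI (fsc c 0)); rewrite -fscD !addr0. Qed.
Lemma fsc0 (U : fspace) (u : U) : fsc 0 u = 0.
Proof. by apply: (addrI (fsc 0 u)); rewrite -fscDl !addr0. Qed.
Lemma fscN (U : fspace) c (u : U) : fsc c (- u) = - fsc c u.
Proof. by apply: (addrI (fsc c u)); rewrite -fscD !subrr fsc0r. Qed.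
Lemma fscNl (U : fspace) c (u : U) : fsc (- c) u = - fsc c u.
Proof. by apply: (addrI (fsc c u)); rewrite -fscDl !subrr fsc0. Qed.

Variables U V : fspace.

Definition fsub (G : U * V -> Prop) := forall c p q, G p -> G q ->
  G (fsc c p.1 + q.1, fsc c p.2 + q.2).

Lemma fsub_comb G c u v u' v' : fsub G -> G (u, v) -> G (u', v') ->
  G (fsc c u + u', fsc c v + v').
Proof. by move=> sG Gu Gu'; apply: (sG c (u, v) (u', v')). Qed.

(** Zorn's lemma for the graphs of partial linear maps that lie in [G] over the domain of [G]. This
    is the only form in which complements of subspaces are needed: it extends linear maps along
    injections, lifts along surjections, and retracts W(n) onto g. *)
Lemma linear_selection (G : U * V -> Prop) : G (0, 0) -> fsub G ->
  exists f : U -> V, (forall c u v, f (fsc c u + v) = fsc c (f u) + f v) /\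
    forall u v, G (u, v) -> G (u, f u).
Proof.
move=> G0 sG.
pose P (H : set (U * V)) := [/\ fsub H, forall v, H (0, v) -> v = 0
  & forall u v, H (u, v) -> (exists w, G (u, w)) -> G (u, v)].
have P0 : P [set (0, 0)]%classic.
  split=> [c [p p'] [q q'] [-> ->] [-> ->] /=|v [->]|u v [-> ->]] //.
  by rewrite !fsc0r !addr0.
have [FF FP totF|H [[sH H0 HG] maxH]] := @Zorn_bigcup _ P.
  split=> [c p q [A FA Ap] [B FB Bq]|v [A FA Av]|u v [A FA Auv]].
  - have [AB|BA] := totF _ _ FA FB.
      by exists B => //; have [sB _ _] := FP _ FB; apply: sB => //; apply: AB.
    by exists A => //; have [sA _ _] := FP _ FA; apply: sA => //; apply: BA.
  - by have [_ A0 _] := FP _ FA; exact: A0.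
  - by have [_ _ AG] := FP _ FA; exact: AG.
have HP p : H p -> H (0, 0).
  move=> Hp; have := sH (-1) p p Hp Hp.
  by rewrite !fscNl !fsc1 !addNr.
(* The empty relation satisfies [P] too, so that even (0, 0) has to come from maximality. *)
have H00 : H (0, 0).
  apply: contrapT => nH; apply: (maxH [set (0, 0)]%classic) => //; split.
    by move=> p Hp; case: nH; exact: HP Hp.
  by move=> /(_ (0, 0) erefl); exact: nH.
have HZ c u v : H (u, v) -> H (fsc c u, fsc c v).
  by move=> Huv; have := sH c _ _ Huv H00; rewrite /= !addr0.
have HD u v u' v' : H (u, v) -> H (u', v') -> H (u + u', v + v').
  by move=> Huv Huv'; have := sH 1 _ _ Huv Huv'; rewrite /= !fsc1.
have Huniq u v v' : H (u, v) -> H (u, v') -> v = v'.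
  move=> Hv Hv'; apply/eqP; rewrite -subr_eq0; apply/eqP/H0.
  have := sH (-1) _ _ Hv' Hv; rewrite /= !fscNl !fsc1 addNr.
  by rewrite addrC.
have GZ c u v : G (u, v) -> G (fsc c u, fsc c v).
  by move=> Huv; have := sG c _ _ Huv G0; rewrite /= !addr0.
have GD u v u' v' : G (u, v) -> G (u', v') -> G (u + u', v + v').
  by move=> Huv Huv'; have := sG 1 _ _ Huv Huv'; rewrite /= !fsc1.
have dom u : exists v, H (u, v).
  apply: contrapT => nu.
  have nuc c h h' : H (h, h') -> fsc c u = h -> c = 0.
    move=> Hh uh; apply/eqP/negPn/negP => c0; apply: nu; exists (fsc c^-1 h').
    have := HZ c^-1 _ _ Hh; rewrite -uh fscA mulVf //.
    by rewrite fsc1.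
  (* The value [v] at the new vector [u]. If some h0 + u lies in the domain of [G], its value w
     there forces v = w - h0'. Otherwise no h + c u with c != 0 lies in that domain, by rescaling,
     and 0 will do. *)
  have [v Gv] : exists v, forall c h h', H (h, h') ->
      (exists w, G (h + fsc c u, w)) -> G (h + fsc c u, h' + fsc c v).
    have [[h0 [h0' [w [Hh0 Gw]]]]|nex] := pselect (exists h0 h0' w,
        H (h0, h0') /\ G (h0 + u, w)).
      exists (w - h0') => c h h' Hh [w' Gw'].
      have Hd : H (h - fsc c h0, h' - fsc c h0').
        by apply: HD => //; rewrite -!fscNl; exact: HZ.
      have GcW := GZ c _ _ Gw.
      have Gd : G (h - fsc c h0, h' - fsc c h0').
        apply: HG => //; exists (w' - fsc c w).
        have := GD _ _ _ _ Gw' (GZ (-1) _ _ GcW).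
        rewrite !fscNl !fsc1 fscD; congr (G (_, _)); zmod.
      have := GD _ _ _ _ Gd GcW; rewrite !fscD fscN; congr (G (_, _)); zmod.
    exists 0 => c h h' Hh [w Gw]; rewrite fsc0r addr0.
    have [c0|c0] := eqVneq c 0.
      move: Gw; rewrite c0 fsc0 addr0 => Gw; apply: HG => //; by exists w.
    case: nex; exists (fsc c^-1 h), (fsc c^-1 h'), (fsc c^-1 w).
    split; first exact: HZ.
    by have := GZ c^-1 _ _ Gw; rewrite fscD fscA mulVf // fsc1.
  pose B : set (U * V) := fun p => exists h h' c, H (h, h') /\
    p = (h + fsc c u, h' + fsc c v).
  apply: (maxH B).
    split=> [[h h'] Hh|/(_ (u, v)) HB].
      by exists h, h', 0; split => //; rewrite !fsc0 !addr0.
    apply: nu; exists v; apply: HB; exists 0, 0, 1; split => //.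
    by rewrite !fsc1 !add0r.
  split.
  - move=> c _ _ [h [h' [b [Hh ->]]]] [k [k' [b' [Hk ->]]]] /=.
    exists (fsc c h + k), (fsc c h' + k'), (c * b + b').
    split; first exact: (fsub_comb c sH Hh Hk).
    rewrite !fscD !fscA !fscDl; congr (_, _); zmod.
  - move=> x [h [h' [c [Hh [/esym hc ->]]]]].
    have c0 : - c = 0.
      apply: (nuc _ _ _ Hh); rewrite fscNl; apply/eqP.
      by rewrite eq_sym -addr_eq0; apply/eqP.
    move: hc c0; move=> + /eqP; rewrite oppr_eq0 => + /eqP c0.
    rewrite c0 !fsc0 !addr0 => h0; apply: H0; by rewrite -h0.
  - by move=> x y [h [h' [c [Hh [-> ->]]]]]; exact: Gv.
have /choice[f fP] := dom.
exists f; split=> [c u v|u v Guv]; last by apply: HG => //; exists v.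
apply: (Huniq (fsc c u + v)); first exact: fP.
exact: (fsub_comb c sH (fP u) (fP v)).
Qed.
End Selection.

(** * Injective Lie-Cartan modules *)

Section VfBracket.
Variables (F : fieldType) (n : nat).
Local Notation R := {mpoly F[n]}.
Implicit Types X Y Z : vf F n.

Definition vf_tri X Y : vf F n := [ffun j => vf_act X (Y j)].

Lemma vf_ext X Y : (forall j, (X : {ffun _ -> _}) j = (Y : {ffun _ -> _}) j) -> X = Y.
Proof. by move=> h; apply/ffunP. Qed.

Lemma vf_tri_linr X c Y Z : vf_tri X (c *: Y + Z) = c *: vf_tri X Y + vf_tri X Z.
Proof.
by apply: vf_ext => j; rewrite !ffunE vf_actDr vf_actZr.
Qed.
Lemma vf_tri_linl X c Y Z : vf_tri (c *: Y + Z) X = c *: vf_tri Y X + vf_tri Z X.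
Proof. by apply: vf_ext => j; rewrite !ffunE vf_actPl. Qed.

Lemma vf_bracketE X Y : vf_bracket X Y = vf_tri X Y - vf_tri Y X.
Proof. by apply: vf_ext => j; rewrite !ffunE. Qed.

(* [vf_tri] is a pre-Lie product *)
Lemma vf_tri_bracket X Y Z :
  vf_tri (vf_bracket X Y) Z = vf_tri X (vf_tri Y Z) - vf_tri Y (vf_tri X Z).
Proof. by apply: vf_ext => j; rewrite !ffunE vf_act_bracket. Qed.

Lemma vf_triDr X Y Z : vf_tri X (Y + Z) = vf_tri X Y + vf_tri X Z.
Proof. by have := vf_tri_linr X 1 Y Z; rewrite !scale1r. Qed.
Lemma vf_triNr X Y : vf_tri X (- Y) = - vf_tri X Y.
Proof.
apply/eqP; rewrite -addr_eq0 -vf_triDr addNr; apply/eqP.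
by apply: vf_ext => j; rewrite !ffunE vf_act0r.
Qed.

Lemma vf_jacobi X Y Z : vf_bracket X (vf_bracket Y Z) =
  vf_bracket (vf_bracket X Y) Z + vf_bracket Y (vf_bracket X Z).
Proof.
rewrite (vf_bracketE X (vf_bracket Y Z)) (vf_bracketE (vf_bracket X Y) Z).
rewrite (vf_bracketE Y (vf_bracket X Z)).
rewrite !vf_tri_bracket !vf_bracketE !vf_triDr !vf_triNr; zmod.
Qed.

Lemma vf_bracket_linr X c Y Z :
  vf_bracket X (c *: Y + Z) = c *: vf_bracket X Y + vf_bracket X Z.
Proof. by rewrite !vf_bracketE vf_tri_linr vf_tri_linl scalerBr; zmod. Qed.
Lemma vf_bracket_linl X c Y Z :
  vf_bracket (c *: Y + Z) X = c *: vf_bracket Y X + vf_bracket Z X.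
Proof. by rewrite !vf_bracketE vf_tri_linr vf_tri_linl scalerBr; zmod. Qed.
Lemma vf_bracketxx X : vf_bracket X X = 0.
Proof. by rewrite vf_bracketE subrr. Qed.

Variable g : lie_subalg F n.
Definition lie_elt_bracket : lie_bracket (lie_elt g).
refine (@LieBracket _ _ (@lie_br F n g) _ _ _ _).
- by move=> x c y z; apply: val_inj; apply: vf_bracket_linr.
- by move=> x c y z; apply: val_inj; apply: vf_bracket_linl.
- by move=> x; apply: val_inj; apply: vf_bracketxx.
- by move=> x y z; apply: val_inj; apply: vf_jacobi.
Defined.

Definition lmod_fspace (V : lmodType F) : fspace F.
refine (@FSpace F V (fun c v => c *: v) _ _ _ _).
- by move=> *; rewrite scalerDr.
- by move=> *; rewrite scalerA.
- by move=> *; rewrite scale1r.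
- by move=> *; rewrite scalerDl.
Defined.

Definition rmod_fspace (M : lmodType R) : fspace F.
refine (@FSpace F M (fun c v => c%:MP *: v) _ _ _ _).
- by move=> *; rewrite scalerDr.
- by move=> *; rewrite scalerA mpolyCM.
- by move=> *; rewrite mpolyC1 scale1r.
- by move=> *; rewrite mpolyCD scalerDl.
Defined.

Definition lc_rep (M : lcmod g) : lie_rep lie_elt_bracket (mpolyC n (R := F)) M.
refine (@LieRep _ _ _ _ _ _ (@rho F n g M) _ _ _).
- exact: (@rho_linear F n g M).
- exact: (@rho_linearl F n g M).
- exact: (@rho_bracket F n g M).
Defined.
End VfBracket.

Lemma rhoD (F : fieldType) n (g : lie_subalg F n) (M : lcmod g) X (u v : M) :
  rho X (u + v) = rho X u + rho X v.
Proof. exact: (actD (lc_rep M)). Qed.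
Lemma rhoB (F : fieldType) n (g : lie_subalg F n) (M : lcmod g) X (u v : M) :
  rho X (u - v) = rho X u - rho X v.
Proof. exact: (actB (lc_rep M)). Qed.

Section LchomFacts.
Variables (F : fieldType) (n : nat) (g : lie_subalg F n).
Local Notation R := {mpoly F[n]}.
Variables M N : lcmod g.
Variable f : M -> N.
Hypothesis fh : is_lchom f.
Lemma lchomD u v : f (u + v) = f u + f v.
Proof. by have [fl _] := fh; have := fl 1 u v; rewrite !scale1r. Qed.
Lemma lchom0 : f 0 = 0.
Proof. by apply: (addrI (f 0)); rewrite -lchomD !addr0. Qed.
Lemma lchomN u : f (- u) = - f u.
Proof. by apply: (addrI (f u)); rewrite -lchomD !subrr lchom0. Qed.
Lemma lchomB u v : f (u - v) = f u - f v.
Proof. by rewrite lchomD lchomN. Qed.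
Lemma lchomZ a u : f (a *: u) = a *: f u.
Proof. by have [fl _] := fh; have := fl a u 0; rewrite lchom0 !addr0. Qed.
Lemma lchom_act X u : f (rho X u) = rho X (f u).
Proof. by case: fh. Qed.
End LchomFacts.

Lemma lchom_comp (F : fieldType) n (g : lie_subalg F n) (M N P : lcmod g)
  (f : N -> P) (h : M -> N) : is_lchom f -> is_lchom h -> is_lchom (f \o h).
Proof.
move=> [fl fX] [hl hX]; split=> [a u v|X v] /=; first by rewrite hl fl.
by rewrite hX fX.
Qed.

Section Cofree.
Variables (F : fieldType) (n : nat) (g : lie_subalg F n).
Local Notation R := {mpoly F[n]}.
Local Notation letter := (R + lie_elt g)%type.

Definition letter_act (M : lcmod g) (a : letter) (m : M) : M :=
  match a with inl r => r *: m | inr X => rho X m end.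
Definition word_act (M : lcmod g) (w : seq letter) (m : M) : M :=
  foldr (@letter_act M) m w.

Lemma word_act_cat (M : lcmod g) w w' (m : M) :
  word_act (w ++ w') m = word_act w (word_act w' m).
Proof. exact: foldr_cat. Qed.

Lemma letter_actD (M : lcmod g) a (m m' : M) :
  letter_act a (m + m') = letter_act a m + letter_act a m'.
Proof.
case: a => [r|X] /=; first exact: scalerDr.
by have := rho_linear X 1 m m'; rewrite mpolyC1 !scale1r.
Qed.
Lemma word_actD (M : lcmod g) w (m m' : M) :
  word_act w (m + m') = word_act w m + word_act w m'.
Proof. by elim: w => [//|a w IH] /=; rewrite IH letter_actD. Qed.

Variable M : lcmod g.

(* The elements of the cofree module on M are the functions on words in the
   generators of the smash product of R and U(g) that respect its relations,
   i.e. Hom_F(R # U(g), M), where M is only used as a vector space. *)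
Record cofree_rel (f : seq letter -> M) : Prop := CofreeRel {
  cf_head : forall (c : F) v, f (inl c%:MP :: v) = c%:MP *: f v;
  cf_D : forall u (a b : R) v,
    f (u ++ inl (a + b) :: v) = f (u ++ inl a :: v) + f (u ++ inl b :: v);
  cf_1 : forall u v, f (u ++ inl 1 :: v) = f (u ++ v);
  cf_M : forall u (a b : R) v, f (u ++ inl (a * b) :: v) = f (u ++ inl a :: inl b :: v);
  cf_lin : forall u (c : F) X Y v, f (u ++ inr (c *: X + Y) :: v) =
     f (u ++ inl c%:MP :: inr X :: v) + f (u ++ inr Y :: v);
  cf_br : forall u X Y v, f (u ++ inr (lie_br X Y) :: v) =
     f (u ++ inr X :: inr Y :: v) - f (u ++ inr Y :: inr X :: v);
  cf_compat : forall u X (a : R) v, f (u ++ inr X :: inl a :: v) =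
     f (u ++ inl a :: inr X :: v) + f (u ++ inl (lie_act X a) :: v) }.

Fact cofree_rel0 : cofree_rel 0.
Proof.
split=> // *; [apply/esym/scaler0|apply/esym/addr0| apply/esym/addr0
  |apply/esym/subr0|apply/esym/addr0].
Qed.
Fact cofree_relP (a : R) f h : cofree_rel f -> cofree_rel h -> cofree_rel (a *: f + h).
Proof.
move=> cf ch; split=> *; rewrite !fctE.
- by rewrite (cf_head cf) (cf_head ch) scalerDr !scalerA mulrC.
- by rewrite (cf_D cf) (cf_D ch) scalerDr; zmod.
- by rewrite (cf_1 cf) (cf_1 ch).
- by rewrite (cf_M cf) (cf_M ch).
- by rewrite (cf_lin cf) (cf_lin ch) scalerDr; zmod.
- by rewrite (cf_br cf) (cf_br ch) scalerBr; zmod.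
- by rewrite (cf_compat cf) (cf_compat ch) scalerDr; zmod.
Qed.

Definition cofree_sub := Submod cofree_rel0 cofree_relP.
(** Only the additive group of [sub_mod cofree_sub] is kept: polynomials act by appending a letter
    to the word ([cscale]), and not on the values. *)
Definition cofree := sub_mod cofree_sub.
HB.instance Definition _ := GRing.Zmodule.copy cofree (sub_mod cofree_sub).
Implicit Types f h : cofree.

Definition cval f : seq letter -> M := val (f : sub_mod cofree_sub).
Lemma cval_rel f : cofree_rel (cval f).
Proof. exact: (elimT (smembP _ _) (valP (f : sub_mod cofree_sub))). Qed.
Definition mkc (f : seq letter -> M) (cf : cofree_rel f) : cofree :=
  exist (fun x => x \in smemb cofree_sub) f (introT (smembP cofree_sub f) cf).
Lemma cval_inj f h : (forall w, cval f w = cval h w) -> f = h.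
Proof. by move=> e; apply/val_inj/funext. Qed.
Lemma cvalD f h w : cval (f + h) w = cval f w + cval h w. Proof. by []. Qed.
Lemma cvalN f w : cval (- f) w = - cval f w. Proof. by []. Qed.
Fact cofree_shift f (a : letter) : cofree_rel (fun w => cval f (w ++ [:: a])).
Proof.
have cf := cval_rel f.
split=> *.
- exact: (cf_head cf).
- by rewrite -!catA /= (cf_D cf).
- by rewrite -!catA /= (cf_1 cf).
- by rewrite -!catA /= (cf_M cf).
- by rewrite -!catA /= (cf_lin cf).
- by rewrite -!catA /= (cf_br cf).
- by rewrite -!catA /= (cf_compat cf).
Qed.
Definition cact (a : letter) f : cofree := mkc (cofree_shift f a).
Lemma cval_act a f w : cval (cact a f) w = cval f (w ++ [:: a]).
Proof. by []. Qed.

Definition cscale (a : R) f := cact (inl a) f.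

Fact cscaleA a b f : cscale a (cscale b f) = cscale (a * b) f.
Proof.
apply: cval_inj => w; rewrite !cval_act -catA /=.
by rewrite (cf_M (cval_rel f)).
Qed.
Fact cscale1 : left_id 1 cscale.
Proof.
move=> f; apply: cval_inj => w; rewrite !cval_act.
by rewrite (cf_1 (cval_rel f)) cats0.
Qed.
Fact cscaleDr : right_distributive cscale +%R.
Proof. by move=> a f h; apply: cval_inj => w; rewrite cvalD !cval_act cvalD. Qed.
Fact cscaleDl f : {morph cscale^~ f : a b / a + b}.
Proof.
move=> a b; apply: cval_inj => w; rewrite cvalD !cval_act.
by rewrite (cf_D (cval_rel f)).
Qed.

HB.instance Definition _ := GRing.Zmodule_isLmodule.Build R cofree
  cscaleA cscale1 cscaleDr cscaleDl.

Lemma cvalZ a f w : cval (a *: f) w = cval f (w ++ [:: inl a]). Proof. by []. Qed.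

Definition cofree_lc : lcmod g.
refine (@LCMod F n g cofree (fun X => cact (inr X)) _ _ _ _).
- move=> X c u v; apply: cval_inj => w; cbv beta; rewrite cvalD ?cval_act cvalD ?cvalZ ?cval_act.
  rewrite -!catA /= (cf_compat (cval_rel u)) /lie_act vf_actC; congr (_ + _).
  (* By additivity in a letter, a word that contains the zero polynomial has value 0. *)
  have := cf_D (cval_rel u) w 0 0 [::]; rewrite addr0 -[X in X = _]addr0.
  by move=> /addrI <-; rewrite addr0.
- move=> c X Y v; apply: cval_inj => w; cbv beta; rewrite cvalD cvalZ ?cval_act -catA /=.
  by rewrite (cf_lin (cval_rel v)).
- move=> X Y v; apply: cval_inj => w; cbv beta; rewrite cvalD cvalN ?cval_act -!catA /=.
  by rewrite (cf_br (cval_rel v)).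
- move=> X f v; apply: cval_inj => w; cbv beta; rewrite cvalD cvalN ?cval_act ?cvalZ ?cval_act.
  by rewrite -!catA /= (cf_compat (cval_rel v)) addrC addKr.
Defined.

Lemma cval_word (u : cofree_lc) w w' :
  cval (word_act w u : cofree) w' = cval (u : cofree) (w' ++ w).
Proof.
elim: w w' => [|a w IH] w' /=; first by rewrite cats0.
by case: a => a; rewrite [LHS]IH -catA.
Qed.

Section Adjunction.
Variables (B : lcmod g) (h : B -> M).
Hypothesis h_lin : forall (c : F) u v, h (c%:MP *: u + v) = c%:MP *: h u + h v.

Let hD u v : h (u + v) = h u + h v.
Proof. by have := h_lin 1 u v; rewrite mpolyC1 !scale1r. Qed.
Let h0 : h 0 = 0.
Proof. by apply: (addrI (h 0)); rewrite -hD !addr0. Qed.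

Fact cofree_adj_rel (b : B) : cofree_rel (fun w => h (word_act w b)).
Proof.
split=> [c v|u a a' v|u v|u a a' v|u c X Y v|u X Y v|u X a v].
- by rewrite /=; have := h_lin c (word_act v b) 0; rewrite h0 !addr0.
- by rewrite !word_act_cat /= scalerDl word_actD hD.
- by rewrite !word_act_cat /= scale1r.
- by rewrite !word_act_cat /= scalerA.
- by rewrite !word_act_cat /= rho_linearl word_actD hD.
- rewrite !word_act_cat /= rho_bracket; apply/eqP; rewrite eq_sym subr_eq -hD.
  by rewrite -word_actD subrK.
- rewrite !word_act_cat /= -hD -word_actD -rho_compat addrC subrK //.
Qed.
Definition cofree_adj (b : B) : cofree_lc := mkc (cofree_adj_rel b).

Lemma cofree_adj_hom : is_lchom cofree_adj.
Proof.
split=> [a u v|X v]; apply: cval_inj => w; last first.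
  by rewrite cval_act /cval /= word_act_cat.
rewrite cvalD cvalZ /cval /= word_actD hD; congr (_ + _).
by rewrite word_act_cat.
Qed.
End Adjunction.

Lemma lchom_word (B C : lcmod g) (f : B -> C) w b : is_lchom f ->
  f (word_act w b) = word_act w (f b).
Proof.
move=> fh; elim: w => [//|[r|X] w IH] /=; first by rewrite (lchomZ fh) IH.
by rewrite (lchom_act fh) IH.
Qed.

(** By the adjunction [cofree_adj], a morphism into the cofree module amounts to a linear map into
    [M], namely its value at the empty word, and linear maps extend along injections of vector
    spaces. *)
Lemma cofree_injective : lc_injective cofree_lc.
Proof.
move=> A B i f ih i_inj fh.
pose G (p : rmod_fspace B * rmod_fspace M) := exists a : A,
  p = (i a, cval (f a : cofree) [::]).
have [||h [hl hG]] := linear_selection (G := G).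
- by exists 0; rewrite (lchom0 ih) (lchom0 fh).
- move=> c _ _ [a ->] [a' ->]; exists (c%:MP *: a + a').
  case: ih fh => il _ [fl _]; rewrite il fl; congr (_, _).
  by rewrite cvalD cvalZ /= -(cf_head (cval_rel _)).
exists (cofree_adj hl) => [|a]; first exact: cofree_adj_hom.
have hi a' : h (i a') = cval (f a' : cofree) [::].
  have [|a'' [/i_inj -> //]] := hG (i a') (cval (f a' : cofree) [::]).
  by exists a'.
apply: cval_inj => w.
by rewrite /cval /= -(lchom_word _ _ ih) hi (lchom_word _ _ fh) cval_word.
Qed.

Lemma id_lin (c : F) (u v : M) : id (c%:MP *: u + v) = c%:MP *: id u + id v.
Proof. by []. Qed.
Definition cofree_unit : M -> cofree_lc := cofree_adj id_lin.
Lemma cofree_unit_hom : is_lchom cofree_unit.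
Proof. exact: cofree_adj_hom. Qed.
Lemma cofree_unit_inj : injective cofree_unit.
Proof. by move=> u v /(congr1 (fun x : cofree => cval x [::])). Qed.
End Cofree.

Section Quotient.
Variables (F : fieldType) (n : nat) (g : lie_subalg F n).
Local Notation R := {mpoly F[n]}.
Variables (M N : lcmod g) (f : M -> N).
Hypothesis fh : is_lchom f.

Fact im_mem0 : exists m, 0 = f m. Proof. by exists 0; rewrite (lchom0 fh). Qed.
Fact im_memP (a : R) u v :
  (exists m, u = f m) -> (exists m, v = f m) -> exists m, a *: u + v = f m.
Proof.
move=> [m ->] [m' ->]; exists (a *: m + m').
by rewrite (lchomD fh) (lchomZ fh).
Qed.
Definition im_sub : submod N := @Submod R N (fun v => exists m, v = f m) im_mem0 im_memP.
Definition coker := quo_mod im_sub.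
Definition coker_pi : N -> coker := pi_mod im_sub.

Lemma coker_piE u v : coker_pi u = coker_pi v <-> exists m, u - v = f m.
Proof. exact: (pi_modE im_sub). Qed.
Lemma coker_piD u v : coker_pi (u + v) = coker_pi u + coker_pi v.
Proof. exact: (pi_modD im_sub). Qed.
Lemma coker_piZ a u : coker_pi (a *: u) = a *: coker_pi u.
Proof. by rewrite /coker_pi -quo_scaleE. Qed.
Lemma coker_piN u : coker_pi (- u) = - coker_pi u.
Proof. by rewrite -scaleN1r coker_piZ scaleN1r. Qed.

Definition coker_rho (X : lie_elt g) (x : coker) : coker :=
  coker_pi (rho X (projT1 (cid (pi_mod_surj x)))).
Lemma coker_rhoE X v : coker_rho X (coker_pi v) = coker_pi (rho X v).
Proof.
rewrite /coker_rho; case: cid => u /= /coker_piE[m e]; apply/coker_piE.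
exists (- rho X m); rewrite (lchomN fh) (lchom_act fh) -e.
by rewrite rhoB opprB.
Qed.

Definition coker_lc : lcmod g.
refine (@LCMod F n g coker coker_rho _ _ _ _).
- move=> X c x y; have [u ->] := pi_mod_surj x; have [v ->] := pi_mod_surj y.
  by rewrite -!/(coker_pi _) -coker_piZ -coker_piD !coker_rhoE rho_linear
    coker_piD coker_piZ.
- move=> c X Y x; have [u ->] := pi_mod_surj x.
  by rewrite -!/(coker_pi _) !coker_rhoE rho_linearl coker_piD coker_piZ.
- move=> X Y x; have [u ->] := pi_mod_surj x.
  by rewrite -!/(coker_pi _) !coker_rhoE rho_bracket coker_piD coker_piN.
- move=> X a x; have [u ->] := pi_mod_surj x.
  by rewrite -!/(coker_pi _) -coker_piZ !coker_rhoE -coker_piZ -coker_piN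
    -coker_piD rho_compat coker_piZ.
Defined.

Lemma coker_pi_hom : is_lchom (coker_pi : N -> coker_lc).
Proof.
split=> [a u v|X v]; first by rewrite coker_piD coker_piZ.
exact/esym/coker_rhoE.
Qed.

Lemma coker_pi_surj (x : coker_lc) : exists v, x = coker_pi v.
Proof. exact: pi_mod_surj. Qed.
End Quotient.

Section Resolution.
Variables (F : fieldType) (n : nat) (g : lie_subalg F n) (M : lcmod g).

(** The resolution is spliced from the short exact sequences that embed each cosyzygy into its
    cofree module, with the next cosyzygy as cokernel. *)
Fixpoint cosyzygy (k : nat) : lcmod g :=
  if k is k'.+1 then coker_lc (cofree_unit_hom (cosyzygy k')) else M.

Definition cofree_d k (x : cofree_lc (cosyzygy k)) : cofree_lc (cosyzygy k.+1) :=
  @cofree_unit F n g (cosyzygy k.+1) (coker_pi (cofree_unit_hom (cosyzygy k)) x).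

Lemma cofree_d_hom k : is_lchom (@cofree_d k).
Proof. exact: (lchom_comp (cofree_unit_hom _) (coker_pi_hom _)). Qed.

Lemma cofree_d_ker k (x : cofree_lc (cosyzygy k)) :
  cofree_d x = 0 <-> exists m, x = cofree_unit m.
Proof.
rewrite /cofree_d -(lchom0 (cofree_unit_hom _)); split.
  move=> /(@cofree_unit_inj _ _ _ _ _ _).
  rewrite -(lchom0 (coker_pi_hom (cofree_unit_hom (cosyzygy k)))).
  by move=> /coker_piE; rewrite subr0.
move=> [m ->]; congr (cofree_unit _).
rewrite -(lchom0 (coker_pi_hom (cofree_unit_hom (cosyzygy k)))).
by apply/coker_piE; rewrite subr0; exists m.
Qed.

Theorem injres_exists : inhabited (injres M).
Proof.
constructor.
apply: (@InjRes F n g M (fun k => cofree_lc (cosyzygy k)) (@cofree_unit F n g M)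
  cofree_d).
- exact: cofree_unit_hom.
- exact: cofree_d_hom.
- by move=> q; apply: cofree_injective.
- exact: cofree_unit_inj.
- by move=> x; apply: (@cofree_d_ker 0).
- move=> q x; split=> [/cofree_d_ker[m ->]|[y ->]].
    by have [y ->] := coker_pi_surj m; exists y.
  by apply/cofree_d_ker; eexists.
Qed.
End Resolution.

(** * Acyclicity of injective modules *)

Section EventuallyEqual.
Variables (M : Type).
(** Convergence in a discrete space. Limits of cochains are taken pointwise in this sense. *)
Definition evl (u : nat -> M) (l : M) := exists N0, forall N, (N0 <= N)%N -> u N = l.

Lemma evl_cst l : evl (fun=> l) l. Proof. by exists 0%N. Qed.
Lemma evl_uniq u l l' : evl u l -> evl u l' -> l = l'.
Proof.
move=> [N ul] [N' ul']; rewrite -(ul (maxn N N')) ?leq_maxl //.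
by rewrite ul' ?leq_maxr.
Qed.
End EventuallyEqual.

Lemma evl_map (M M' : Type) (h : M -> M') u l :
  evl u l -> evl (fun N => h (u N)) (h l).
Proof. by move=> [N ul]; exists N => k /ul ->. Qed.
Lemma evl_map2 (M M' M'' : Type) (h : M -> M' -> M'') u l u' l' :
  evl u l -> evl u' l' -> evl (fun N => h (u N) (u' N)) (h l l').
Proof.
move=> [N ul] [N' ul']; exists (maxn N N') => k; rewrite geq_max => /andP[Nk Nk'].
by rewrite ul // ul'.
Qed.

(** The 2-adic valuation of N + 1 takes every value infinitely often. A sequence of eigenvalues
    indexed by it returns to each of them after any given stage. *)
Lemma recurrent_logn (j N : nat) : exists2 N', (N <= N')%N & logn 2 N'.+1 = j.
Proof.
have pos : (0 < 2 ^ j * N.*2.+1)%N by rewrite muln_gt0 expn_gt0.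
exists (2 ^ j * N.*2.+1).-1.
  rewrite -ltnS prednK //; apply: leq_trans (leq_pmull _ _); last by rewrite expn_gt0.
  by rewrite ltnS -addnn leq_addr.
rewrite prednK // lognM ?expn_gt0 // pfactorK // [logn 2 _.*2.+1]lognE.
by rewrite dvdn2 /= odd_double addn0.
Qed.

Lemma natS_neq0 (F : fieldType) k : [pchar F] =i pred0 -> k.+1%:R != 0 :> F.
Proof. by move/pcharf0P ->. Qed.

Section LocalInverse.
Variables (F : fieldType) (K : comNzRingType) (iota : {rmorphism F -> K}).
Variables (V : lmodType K) (T : Type) (J : Type) (ev : T -> V -> J).
Hypothesis ev_sep : forall u v, (forall p, ev p u = ev p v) -> u = v.

(** Pointwise convergence, with [ev p] as evaluation at the point p. The subspace [S] below will
    consist of the cochains in one application, and of the cochains with zero restriction to gl(n)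
    in the other. *)
Definition conv (b : nat -> V) l := forall p, evl (fun N => ev p (b N)) (ev p l).

Variables (S : V -> Prop) (d kappa : V -> V).
Hypothesis S_comb : forall c u v, S u -> S v -> S (iota c *: u + v).
Hypothesis S0 : S 0.
Hypothesis S_d : forall v, S v -> S (d v).
Hypothesis S_kappa : forall v, S v -> S (kappa v).
Hypothesis d_lin : forall c u v, d (iota c *: u + v) = iota c *: d u + d v.
Hypothesis kappa_lin : forall c u v, S u -> S v -> kappa (iota c *: u + v) = iota c *: kappa u + kappa v.
Hypothesis dd0 : forall v, S v -> d (d v) = 0.
Hypothesis d_conv : forall b l, (forall N, S (b N)) -> S l -> conv b l -> conv (fun N => d (b N)) (d l).
Hypothesis kappa_conv : forall b l, (forall N, S (b N)) -> S l -> conv b l -> conv (fun N => kappa (b N)) (kappa l).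
Hypothesis S_lim : forall b, (forall N, S (b N)) ->
  (forall p, exists l, evl (fun N => ev p (b N)) l) -> exists2 l, S l & conv b l.
Hypothesis ev_comb : forall p c u u' v, ev p u = ev p u' ->
  ev p (iota c *: u + v) = ev p (iota c *: u' + v).

Definition hlap v := d (kappa v) + kappa (d v).

Let S_lap v : S v -> S (hlap v).
Proof.
move=> Sv; rewrite /hlap -[d (kappa v)]scale1r -(rmorph1 iota).
by apply: S_comb; [apply/S_d/S_kappa|apply/S_kappa/S_d].
Qed.

Let d0 : d 0 = 0.
Proof. by have := d_lin (-1) 0 0; rewrite rmorphN1 !scaleN1r !addNr. Qed.
Let kappa0 : kappa 0 = 0.
Proof. by have := kappa_lin (-1) S0 S0; rewrite rmorphN1 !scaleN1r !addNr. Qed.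
Let d_lap v : S v -> d v = 0 -> d (hlap v) = 0.
Proof. by move=> Sv dv; rewrite /hlap dv kappa0 addr0 dd0 //; apply: S_kappa. Qed.

Variables (lam : nat -> F).
Variable a : V.
Hypotheses (Sa : S a) (da0 : d a = 0).

Fixpoint residual (N : nat) : V :=
  if N is N'.+1 then iota (- (lam N')^-1) *: hlap (residual N') + residual N' else a.

Fixpoint primitive (N : nat) : V :=
  if N is N'.+1 then iota (lam N')^-1 *: residual N' + primitive N' else 0.

Let residual_closed N : S (residual N) /\ d (residual N) = 0.
Proof.
elim: N => [//|N [SN dN]] /=; split; first by apply: S_comb => //; apply: S_lap.
by rewrite d_lin d_lap // dN scaler0 addr0.
Qed.

Let primitive_closed N : S (primitive N) /\ d (primitive N) = 0.
Proof.
elim: N => [|N [SN dN]] /=; first by split.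
have [SR dR] := residual_closed N.
by split; [exact: S_comb|rewrite d_lin dR dN scaler0 addr0].
Qed.

(** The residuals are cocycles, on which [hlap] reduces to d kappa, so the sum telescopes. *)
Let d_kappa_primitive N : d (kappa (primitive N)) = a - residual N.
Proof.
elim: N => [|N IH] /=; first by rewrite kappa0 d0 subrr.
have [SR dR] := residual_closed N.
have [SP _] := primitive_closed N.
rewrite kappa_lin // d_lin IH -[d (kappa _)]addr0 -kappa0 -dR -/(hlap _).
by rewrite rmorphN scaleNr; zmod.
Qed.

Lemma residual_S N : S (residual N). Proof. by have [] := residual_closed N. Qed.

(* With Q = d kappa + kappa d, primitive N is ((1 - P_N)/X)(Q) a and residual N is
   P_N(Q) a, where P_N is the product of the 1 - X / lam i for i < N. *)
Lemma local_homotopy : conv residual 0 ->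
  exists2 b, S b /\ d b = a & conv (fun N => kappa (primitive N)) b.
Proof.
move=> r0; have kr0 : conv (fun N => kappa (residual N)) 0.
  by rewrite -kappa0; apply: kappa_conv => // N; apply: residual_S.
have [|p|b Sb cb] := @S_lim (fun N => kappa (primitive N)).
- by move=> N; have [SN _] := primitive_closed N; apply: S_kappa.
(* The increments of [kappa (primitive N)] are multiples of [kappa (residual N)], which is 0 at p
   from stage N0 on. *)
- have [N0 hN] := kr0 p; exists (ev p (kappa (primitive N0))); exists N0 => N N0N.
  rewrite -(subnKC N0N); elim: (N - N0)%N => [|k IH]; first by rewrite addn0.
  have [SP _] := primitive_closed (N0 + k); have [SR _] := residual_closed (N0 + k).
  rewrite addnS /= kappa_lin // (ev_comb _ _ (hN (N0 + k)%N (leq_addr _ _))).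
  by rewrite scaler0 add0r.
exists b => //; split => //; apply: ev_sep => p.
have c1 : conv (fun N => d (kappa (primitive N))) (d b).
  by apply: d_conv => // N; have [SN _] := primitive_closed N; apply: S_kappa.
apply: evl_uniq (c1 p) _; have [N0 hN] := r0 p; exists N0 => N /hN e.
rewrite d_kappa_primitive addrC -scaleN1r -(rmorphN1 iota) (ev_comb _ _ e).
by rewrite scaler0 add0r.
Qed.
End LocalInverse.

Section DerFacts.
Variables (E : Type) (M M' : zmodType).

Lemma der_map T (w : M -> M') (f : seq E -> M) : (forall u v, w (u + v) = w u + w v) ->
  der T (fun s => w (f s)) = fun s => w (der T f s).
Proof.
move=> wD; have w0 : w 0 = 0 by apply: (addrI (w 0)); rewrite -wD !addr0.
apply/funext => s; elim: s f => [|y s IH] f /=; first by rewrite w0.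
by rewrite wD -IH.
Qed.
End DerFacts.

Section DerLinear.
Variables (F : fieldType) (K : comNzRingType) (iota : {rmorphism F -> K}).
Variables (E : lmodType F) (M : lmodType K).
Implicit Types f : seq E -> M.

Lemma der_comm T T' U f : multilin iota f -> (forall y, U y = T' (T y) - T (T' y)) ->
  der T (der T' f) - der T' (der T f) = der U f.
Proof.
move=> lf UE; apply/funext => s; elim: s f lf => [|y s IH] f lf.
  by rewrite !fctE subrr.
rewrite -[LHS]/(ins y _ s) -[RHS]/(ins y (der U f) s) insB !ins_der !derD UE.
rewrite (multilin_consB _ _ lf) [in RHS]fctD -(IH _ (multilin_ins y lf)) !fctE.
by zmod.
Qed.

Lemma der_linT c T T' f : multilin iota f ->
  der (fun y => c *: T y + T' y) f = iota c *: der T f + der T' f.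
Proof.
move=> lf; apply/funext => s; elim: s f lf => [|y s IH] f lf.
  by rewrite !fctE scaler0 addr0.
rewrite -[LHS]/(ins y (der _ f) s) ins_der (multilin_cons _ _ _ lf) fctD IH; last exact: multilin_ins.
by rewrite !fctE /= scalerDr; zmod.
Qed.

Lemma symm_swap f x y : symm f -> ins x (ins y f) = ins y (ins x f).
Proof. by move=> sf; apply/funext => s; apply: (sf [::]). Qed.
Lemma symm_ins f x : symm f -> symm (ins x f).
Proof. by move=> sf s1; apply: (sf (x :: s1)). Qed.

Lemma symm_der T f : symm f -> symm (der T f).
Proof.
move=> sf s1; elim: s1 f sf => [|z s1 IH] f sf x y s2 /=.
  have e a b : f [:: a, b & s2] = f [:: b, a & s2] by exact: (sf [::]).
  by rewrite !insE (e (T x)) (e x (T y)) (symm_swap y x sf); zmod.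
by rewrite (sf (T z :: s1)) (IH _ (symm_ins z sf)).
Qed.
End DerLinear.

(* symJ_lc is the module Hom_F(S(W), J), which contains J as the functions
   supported on the empty list. *)
Section SymmetricModule.
Variables (F : fieldType) (n : nat) (g : lie_subalg F n) (J : lcmod g).
Local Notation R := {mpoly F[n]}.
Local Notation W := (vf F n).
Local Notation iota := (mpolyC n (R := F)).

Record symrel (f : seq W -> J) : Prop := SymRel {
  sym_lin : multilin iota f; sym_symm : symm f }.

Fact symrel0 : symrel 0.
Proof. by split=> //; apply: multilin0. Qed.
Fact symrelP (a : R) f h : symrel f -> symrel h -> symrel (a *: f + h).
Proof.
move=> [lf sf] [lh sh]; split; last by move=> *; rewrite !fctE sf sh.
by rewrite -(scale1r h); apply: multilin_comb.
Qed.
Definition sym_sub := Submod symrel0 symrelP.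
Definition symJ : lmodType R := sub_mod sym_sub.

Definition symv (f : symJ) : seq W -> J := val f.
Lemma symv_rel f : symrel (symv f). Proof. exact: (elimT (smembP _ _) (valP f)). Qed.
Definition mks (f : seq W -> J) (sf : symrel f) : symJ :=
  exist (fun x => x \in smemb sym_sub) f (introT (smembP sym_sub f) sf).
Lemma symv_inj (f h : symJ) : (forall s, symv f s = symv h s) -> f = h.
Proof. by move=> e; apply/val_inj/funext. Qed.
Lemma symvD (f h : symJ) s : symv (f + h) s = symv f s + symv h s. Proof. by []. Qed.
Lemma symvN (f : symJ) s : symv (- f) s = - symv f s. Proof. by []. Qed.
Lemma symvZ a (f : symJ) s : symv (a *: f) s = a *: symv f s. Proof. by []. Qed.
Lemma symv0 s : symv 0 s = 0. Proof. by []. Qed.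
Definition symvE := (symvD, symvN, symvZ, symv0).

(** The action on a space of maps, dual to X acting on s in S(W(n)) by X s + X |> s. The latter is
    left multiplication in the enveloping algebra of W(n), transported to the symmetric algebra by
    means of the pre-Lie product. *)
Definition sact_fun X (f : seq W -> J) : seq W -> J :=
  (fun s => rho X (f s)) - ins (val X) f - der (vf_tri (val X)) f.

(** The double insertions cancel by symmetry, the insertions of X |> Y and Y |> X combine to that of
    [X, Y], and the derivation terms agree by the pre-Lie identity. *)
Lemma sact_fun_br X Y f : symrel f -> sact_fun (lie_br X Y) f =
  sact_fun X (sact_fun Y f) - sact_fun Y (sact_fun X f).
Proof.
move=> [lf sf]; pose x : W := val X; pose y : W := val Y.
have der_rho Z T (h : seq W -> J) : der T (fun s => rho Z (h s)) = fun s => rho Z (der T h s).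
  by apply: der_map => u v; apply: rhoD.
have e1 := der_comm lf (fun z => vf_tri_bracket x y z).
have e2 : ins (vf_bracket x y) f = ins (vf_tri x y) f - ins (vf_tri y x) f.
  by rewrite vf_bracketE; apply: multilin_consB.
rewrite /sact_fun -/x -/y !insB !derB !der_rho !ins_der.
rewrite (symm_swap x y sf) -/(vf_bracket x y).
apply/funext => s; rewrite !fctE !rhoB /ins.
have := congr1 (@^~ s) e1; rewrite !fctE => <-.
have := congr1 (@^~ s) e2; rewrite !fctE /ins => ->.
by rewrite rho_bracket; zmod.
Qed.

Fact sact_rel X f : symrel f -> symrel (sact_fun X f).
Proof.
move=> [lf sf]; split.
  apply: multilinD; first apply: multilinD.
  - by move=> s1 c x y s2; rewrite lf rho_linear.
  - exact/multilinN/multilin_ins.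
  - by apply/multilinN/multilin_der => // *; apply: vf_tri_linr.
move=> s1 x y s2; rewrite /sact_fun !fctE sf (symm_der _ sf).
by rewrite (symm_ins (val X) sf).
Qed.
Definition sact X (f : symJ) : symJ := mks (sact_rel X (symv_rel f)).
Lemma symv_act X f s : symv (sact X f) s =
  rho X (symv f s) - symv f (val X :: s) - der (vf_tri (val X)) (symv f) s.
Proof. by []. Qed.

Definition symJ_lc : lcmod g.
refine (@LCMod F n g symJ sact _ _ _ _).
- move=> X c u v; apply: symv_inj => s; rewrite !symvE !symv_act !symvE.
  rewrite [symv (_ + _)](_ : _ = iota c *: symv u + symv v) // derD der_scale.
  by rewrite !fctE rho_linear !scalerBr; zmod.
- move=> c X Y v; apply: symv_inj => s; rewrite !symvE !symv_act.
  have [lv sv] := symv_rel v.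
  have := congr1 (@^~ s) (multilin_cons c (val X) (val Y) lv); rewrite !fctE /ins => ->.
  rewrite [vf_tri _](_ : _ = fun y => c *: vf_tri (val X) y + vf_tri (val Y) y); last first.
    by apply/funext => y; rewrite -vf_tri_linl.
  rewrite (der_linT _ _ _ lv) rho_linearl !fctE !scalerBr; zmod.
- move=> X Y v; apply: symv_inj => s; rewrite !symvE !symv_act.
  exact: (congr1 (@^~ s) (sact_fun_br X Y (symv_rel v))).
- move=> X f v; apply: symv_inj => s; rewrite !symvE !symv_act !symvE.
  rewrite [symv (_ *: _)](_ : _ = f *: symv v) // der_scale !fctE -rho_compat.
  by rewrite !scalerBr; zmod.
Defined.
End SymmetricModule.

Section Truncation.
Variables (F : fieldType) (L : lmodType F) (br : lie_bracket L).
Variables (K : comNzRingType) (iota : {rmorphism F -> K}) (M : lmodType K).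
Variable rho : lie_rep br iota M.
Implicit Types f : seq L -> M.

(** [local_homotopy] gives no control over the degree of the primitive. As d is homogeneous, the
    component of the right degree is again a primitive. *)
Definition trunc q f : seq L -> M := fun s => if size s == q then f s else 0.

Lemma supp_trunc q f : supp q (trunc q f).
Proof. by move=> s qs; rewrite /trunc (negPf qs). Qed.
Lemma trunc_supp q f : supp q f -> trunc q f = f.
Proof. by move=> sf; apply/funext => s; rewrite /trunc; case: eqP => // /eqP /sf ->. Qed.

Lemma cochain_trunc q f : cochain iota f -> cochain iota (trunc q f).
Proof.
move=> [lf af]; split=> [s1 c x y s2|s1 x s2]; rewrite /trunc !size_cat /=.
  by case: ifP => _; rewrite ?lf ?scaler0 ?addr0.
by rewrite af if_same.
Qed.

Lemma der_trunc q T f : der T (trunc q f) = trunc q (der T f).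
Proof.
apply/funext => s; elim: s q f => [|y s IH] q f; first by rewrite /trunc if_same.
rewrite -[LHS]/(ins y (der T _) s) ins_der fctD.
case: q => [|q].
  have -> : ins y (trunc 0 f) = 0 by [].
  by rewrite der0 addr0.
by rewrite -[ins y _]/(trunc q (ins y f)) IH /trunc /= /ins eqSS; case: ifP; rewrite ?addr0.
Qed.

Lemma lieD_trunc q x f : lieD rho x (trunc q f) = trunc q (lieD rho x f).
Proof.
rewrite !lieDE der_trunc; apply/funext => s; rewrite /trunc.
by case: ifP; rewrite ?act0 ?subr0.
Qed.

Lemma cdf_trunc q f : cdf rho (trunc q f) = trunc q.+1 (cdf rho f).
Proof.
apply/funext => s; elim: s q f => [|x s IH] q f //=.
rewrite lieD_trunc; case: q => [|q].
  have -> : ins x (trunc 0 f) = 0 by [].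
  rewrite cdf0 /trunc /= eqSS; case: s {IH} => [|y s] /=; rewrite ?subr0 //.
rewrite -[ins x _]/(trunc q (ins x f)) IH /trunc /= eqSS.
by case: ifP; rewrite ?subr0.
Qed.
End Truncation.

Fact hl_key : unit. Proof. exact: tt. Qed.

Section Acyclicity.
Variables (F : fieldType) (n : nat) (g : lie_subalg F n) (J : lcmod g).
Local Notation R := {mpoly F[n]}.
Local Notation W := (vf F n).
Local Notation L := (lie_elt g).
Local Notation iota := (mpolyC n (R := F)).
Local Notation S := (symJ_lc J).
Local Notation sd := (cdf (lc_rep S)).
Local Notation sL := (lieD (lc_rep S)).
Implicit Types (f : symJ J) (A : seq L -> S).

Lemma sins_rel y f : symrel (ins y (symv f)).
Proof.
have [lf sf] := symv_rel f; split; [exact: multilin_ins|exact: symm_ins].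
Qed.
Definition sins y f : symJ J := mks (sins_rel y f).
Lemma symv_ins y f s : symv (sins y f) s = symv f (y :: s). Proof. by []. Qed.

Definition pd y A : seq L -> S := fun t => sins y (A t).

Lemma sinsD y f h : sins y (f + h) = sins y f + sins y h.
Proof. by apply: symv_inj => s. Qed.
Lemma pdD y A B : pd y (A + B) = pd y A + pd y B.
Proof. by apply/funext => t; apply: sinsD. Qed.
Lemma sinsN y f : sins y (- f) = - sins y f.
Proof. by apply: symv_inj => s. Qed.

Lemma symv_pd y A t s : symv (pd y A t) s = symv (A t) (y :: s). Proof. by []. Qed.

Lemma ins_pd x y A : ins x (pd y A) = pd y (ins x A). Proof. by []. Qed.

Lemma der_pd T y A : der T (pd y A) = pd y (der T A).
Proof. by apply: der_map => u v; rewrite sinsD. Qed.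

Lemma sins_act X y f :
  sins y (sact X f) = sact X (sins y f) - sins (vf_tri (val X) y) f.
Proof.
apply: symv_inj => s; rewrite symvD symvN !symv_ins !symv_act !symv_ins /=.
rewrite -[der _ _ s]/(der _ (ins y (symv f)) s).
have [_ sf] := symv_rel f; have /= -> := sf [::] y (val X) s.
by zmod.
Qed.

Lemma pd_lieD X y A : pd y (sL X A) = sL X (pd y A) - pd (vf_tri (val X) y) A.
Proof.
apply/funext => t; rewrite !lieDE !fctE der_pd /pd sinsD sinsN.
by rewrite [sins y (lc_rep S X _)]sins_act; zmod.
Qed.

(** The commutator of d with contraction by the symmetric letter [y], see [pd_cdf]: exterior
    multiplication by the form that sends X to the contraction with X |> y. *)
Fixpoint xi y A (t : seq L) : S :=
  if t is X :: t' then sins (vf_tri (val X) y) (A t') - xi y (ins X A) t' else 0.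

Lemma ins_xi X y A :
  ins X (xi y A) = pd (vf_tri (val X) y) A - xi y (ins X A).
Proof. by []. Qed.

Lemma pd_cdf y A : pd y (sd A) = sd (pd y A) - xi y A.
Proof.
apply/funext => t; elim: t A => [|X t IH] A.
  by apply: symv_inj => s; rewrite !fctE /= symvD symvN symv_pd subr0.
rewrite -[LHS]/(pd y (ins X (sd A)) t) -[RHS]/(ins X _ t) ins_cdf.
rewrite -[RHS]/((ins X (sd (pd y A)) - ins X (xi y A)) t) ins_cdf ins_pd.
have e := IH (ins X A); rewrite fctE in e.
rewrite -[LHS]/(sins y (sL X A t - sd (ins X A) t)) sinsD sinsN.
rewrite -[sins y (sL X A t)]/(pd y (sL X A) t) pd_lieD.
rewrite -[sins y (sd _ t)]/(pd y (sd (ins X A)) t) e ins_xi !fctE.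
by zmod.
Qed.

(* A retraction of W onto g, which splits g off from S(W). *)
Variable pr : W -> L.
Hypothesis pr_lin : forall c x y, pr (c *: x + y) = c *: pr x + pr y.
Hypothesis prK : forall X : L, pr (val X) = X.

(** The Koszul homotopy: each letter of the symmetric list in turn is removed and becomes, through
    [pr], the first exterior argument. *)
Fixpoint kap_fun (B : seq L -> seq W -> J) (t : seq L) (s : seq W) : J :=
  if s is y :: s' then B (pr y :: t) s' + kap_fun (fun t' s'' => B t' (y :: s'')) t s'
  else 0.

Lemma kap_fun_lin a (B B' : seq L -> seq W -> J) t s :
  kap_fun (fun t s => a *: B t s + B' t s) t s = a *: kap_fun B t s + kap_fun B' t s.
Proof.
elim: s B B' => [|y s IH] B B' /=; first by rewrite scaler0 addr0.
by rewrite IH scalerDr; zmod.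
Qed.

Lemma kap_fun_rel (B : seq L -> seq W -> J) t : (forall t, symrel (B t)) ->
  (forall t s c X Y, B ((c *: X + Y) :: t) s = iota c *: B (X :: t) s + B (Y :: t) s) ->
  symrel (kap_fun B t).
Proof.
move=> sB lB; split=> s1.
  elim: s1 B sB lB => [|z s1 IH] B sB lB c x y s2 /=.
    rewrite pr_lin lB.
    rewrite [X in kap_fun X](_ : _ = fun t s => iota c *: B t (x :: s) + B t (y :: s)).
      by rewrite kap_fun_lin scalerDr; zmod.
    by apply/funext => t'; apply/funext => s; have [lf _] := sB t'; apply: (lf [::]).
  have [lf _] := sB (pr z :: t); rewrite lf IH; first by rewrite scalerDr; zmod.
    move=> t'; have [lf' sf'] := sB t'.
    by split; [exact: multilin_ins|exact: symm_ins].
  by move=> *; apply: lB.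
elim: s1 B sB lB => [|z s1 IH] B sB lB x y s2 /=.
  rewrite addrCA; congr (_ + (_ + kap_fun _ _ _)).
  by apply/funext => t'; apply/funext => s; have [_ sf] := sB t'; apply: (sf [::]).
have [_ sf] := sB (pr z :: t); rewrite sf; congr (_ + _); apply: IH => //.
move=> t'; have [lf' sf'] := sB t'.
by split; [exact: multilin_ins|exact: symm_ins].
Qed.

(** The values are multilinear in the symmetric letters only if [A] is multilinear in its first
    exterior argument; without this, 0 is a default value. *)
Definition kap A : seq L -> S := fun t =>
  if pselect (multilin iota A) is left lA then
    mks (@kap_fun_rel (fun t => symv (A t)) t (fun t => symv_rel (A t))
      (fun t s c X Y => congr1 (fun f : symJ J => symv f s) (lA [::] c X Y t)))
  else 0.

Lemma kapE A t s : multilin iota A ->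
  symv (kap A t) s = kap_fun (fun t => symv (A t)) t s.
Proof. by rewrite /kap; case: pselect. Qed.

Lemma multilin_pd y A : multilin iota A -> multilin iota (pd y A).
Proof.
move=> lA s1 c X Y s2; apply: symv_inj => s.
by rewrite symv_pd lA.
Qed.

Lemma pd_kap y A : multilin iota A -> pd y (kap A) = ins (pr y) A + kap (pd y A).
Proof.
move=> lA; apply/funext => t; apply: symv_inj => s.
rewrite symv_pd !fctE symvD !kapE //; exact: multilin_pd.
Qed.

Lemma kap_nil A t : symv (kap A t) [::] = 0.
Proof. by rewrite /kap; case: pselect. Qed.

Lemma kap_comb c A B : multilin iota A -> multilin iota B ->
  kap (iota c *: A + B) = iota c *: kap A + kap B.
Proof.
move=> lA lB; have lAB : multilin iota (iota c *: A + B).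
  by rewrite -(scale1r B); apply: multilin_comb.
apply/funext => t; apply: symv_inj => s.
by rewrite kapE // !fctE symvD symvZ !kapE // -kap_fun_lin.
Qed.

Lemma kapD A B : multilin iota A -> multilin iota B -> kap (A + B) = kap A + kap B.
Proof.
by move=> lA lB; have := kap_comb 1 lA lB; rewrite !rmorph1 !scale1r.
Qed.
Lemma kap0 : kap 0 = 0.
Proof.
have := kapD (@multilin0 _ _ iota _ S) (@multilin0 _ _ iota _ S).
by rewrite addr0 -[X in X = _]addr0 => /addrI.
Qed.
Lemma kapN A : multilin iota A -> kap (- A) = - kap A.
Proof.
move=> lA; apply/eqP; rewrite -addr_eq0 -kapD ?addNr ?kap0 //.
exact: multilinN.
Qed.

Lemma multilin_kap A : multilin iota A -> multilin iota (kap A).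
Proof.
move=> lA s1 c X Y s2; apply: symv_inj => s; rewrite symvD symvZ !kapE //.
elim: s A lA => [|y s IH] A lA /=; first by rewrite scaler0 addr0.
rewrite (lA (pr y :: s1)) symvD symvZ.
have := IH _ (multilin_pd y lA); rewrite /pd => e.
by rewrite -![kap_fun (fun _ s0 => symv _ (y :: s0)) _ _]/(kap_fun (fun t => symv (pd y A t)) _ _)
  IH ?scalerDr; [zmod|apply: multilin_pd].
Qed.

Lemma cochain_pd y A : cochain iota A -> cochain iota (pd y A).
Proof.
move=> [lA aA]; split; first exact: multilin_pd.
by move=> s1 X s2; apply: symv_inj => s; rewrite symv_pd aA.
Qed.

Lemma cochain_kap A : cochain iota A -> cochain iota (kap A).
Proof.
move=> cA; have [lA _] := cA; split; first exact: multilin_kap.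
move=> s1 X s2; apply: symv_inj => s; rewrite kapE //.
elim: s A cA {lA} => [|y s IH] A cA //=; have [_ aA] := cA.
rewrite (aA (pr y :: s1)) add0r.
exact: (IH _ (cochain_pd y cA)).
Qed.

Lemma ins_kap X A : cochain iota A -> ins X (kap A) = - kap (ins X A).
Proof.
move=> cA; have [lA _] := cA; have [lX _] := cochain_ins X cA.
apply/funext => t; apply: symv_inj => s; rewrite !fctE symvN /ins kapE // kapE //.
elim: s A cA {lA lX} => [|y s IH] A cA /=; first by rewrite oppr0.
have := congr1 (fun A : seq L -> S => symv (A t) s) (cochain_swap (pr y) X cA).
rewrite /ins fctE symvN => e.
rewrite e -[kap_fun _ t s]opprK.
have := IH _ (cochain_pd y cA); rewrite /pd /ins => <-; zmod.
Qed.

Lemma supp_kap q A : multilin iota A -> supp q.+1 A -> supp q (kap A).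
Proof.
move=> lA sA t qt; apply: symv_inj => s; rewrite kapE //.
elim: s A lA sA => [//|y s IH] A lA sA /=; rewrite sA // add0r.
apply: (IH _ (multilin_pd y lA)) => t' qt'; apply: symv_inj => s'.
by rewrite symv_pd sA.
Qed.

Definition hl := locked_with hl_key (hlap sd kap).
Lemma hlE : hl = hlap sd kap. Proof. by rewrite /hl unlock. Qed.

Lemma cochain_xi y A : cochain iota A -> cochain iota (xi y A).
Proof.
move=> cA; have -> : xi y A = sd (pd y A) - pd y (sd A) by rewrite pd_cdf; zmod.
by apply: cochainB; [apply/cochain_cdf/cochain_pd|apply/cochain_pd/cochain_cdf].
Qed.

(** This is the recursion that computes [hl] on a symmetric list y :: s. The Lie derivative along
    [pr y] gives a diagonal contribution, while the two terms with [xi] use only values of [A] on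
    lists shorter than y :: s. *)
Lemma pd_hl y A : cochain iota A ->
  pd y (hl A) = hl (pd y A) + sL (pr y) A - xi y (kap A) - kap (xi y A).
Proof.
move=> cA; have [lA _] := cA; have [ldA _] := cochain_cdf (lc_rep S) cA.
rewrite hlE /hlap [LHS]pdD pd_cdf !pd_kap // cdfD ins_cdf pd_cdf.
have [ldp _] := cochain_cdf (lc_rep S) (cochain_pd y cA).
have [lx _] := cochain_xi y cA.
by rewrite (kapD ldp (multilinN lx)) kapN //; zmod.
Qed.

Definition van k A := forall t s, size s = k -> symv (A t) s = 0.

Lemma van_kap0 A : van 0 (kap A).
Proof. by move=> t [|//] _; apply: kap_nil. Qed.

Lemma van_kap k A : multilin iota A -> van k A -> van k.+1 (kap A).
Proof.
move=> lA vA t s; rewrite kapE //.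
elim: s k A lA vA => [//|y s IH] k A lA vA [sk] /=; rewrite vA // add0r.
case: k sk vA => [|k] sk vA; first by case: s sk {IH}.
apply: (IH k _ (multilin_pd y lA)) => // t' s' ks'.
by rewrite symv_pd vA //= ks'.
Qed.

Lemma van_xi y k A : van k.+1 A -> van k (xi y A).
Proof.
move=> vA t; elim: t A vA => [//|X t IH] A vA s sk /=.
rewrite symvD symvN symv_ins vA /= ?sk // IH ?subr0 //.
by move=> t' s' ks'; apply: vA.
Qed.

Lemma der_eq0 (E : Type) (M : zmodType) T (f : seq E -> M) s :
  (forall s', size s' = size s -> f s' = 0) -> der T f s = 0.
Proof.
elim: s f => [//|y s IH] f f0 /=; rewrite f0 // add0r.
by apply: IH => s' ss'; apply: f0; rewrite /= ss'.
Qed.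

Lemma lieD_van X k A t s : van k A -> size s = k ->
  symv (sL X A t) s = - symv (A t) (val X :: s).
Proof.
move=> vA sk; rewrite lieDE symvD symvN.
have -> : symv (der (lie_elt_bracket g X) A t) s = 0.
  elim: t A vA => [//|Y t IH] A vA /=; rewrite symvD vA // add0r.
  by apply: IH => t' s' ks'; apply: vA.
rewrite subr0 [symv _ _]symv_act vA // der_eq0; last first.
  by move=> s' ss'; rewrite vA // ss'.
by rewrite subr0 [rho X _](act0 (lc_rep J)) sub0r.
Qed.

(** On the empty symmetric list only the part of the action that inserts X_s survives, with a minus
    sign. [kap] moves this letter back, as [pr] is the identity on g, so every exterior argument
    contributes once. *)
Lemma cdf_kap_nil A t : cochain iota A ->
  symv (sd (kap A) t) [::] = - ((size t)%:R *: symv (A t) [::]).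
Proof.
elim: t A => [|X t IH] A cA; first by rewrite scale0r oppr0.
rewrite [sd (kap A) _]/= symvD symvN (lieD_van _ _ (van_kap0 A)) //.
rewrite ins_kap // cdfN fctN symvN IH; last exact: cochain_ins.
rewrite kapE /=; last by case: cA.
by rewrite addr0 prK /ins -natr1 scalerDl scale1r; zmod.
Qed.

(* On functions that vanish on the lists s of length < k, the operator
   d kap + kap d is diagonalizable in length k with the eigenvalues -(q + j), where
   j is the number of letters of s in g and q > 0 is the degree of the cochain. *)
Lemma hl_lead A t s : cochain iota A -> (forall k, (k < size s)%N -> van k A) ->
  symv (hl A t) s =
  - ((size t)%:R *: symv (A t) s + der (fun y => val (pr y)) (symv (A t)) s).
Proof.
elim: s A => [|y s IH] A cA vA.
  by rewrite hlE /hlap symvD kap_nil cdf_kap_nil // !addr0.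
have [lA _] := cA; have [lx _] := cochain_xi y cA.
rewrite -symv_pd pd_hl // !fctE !symvD !symvN.
rewrite (lieD_van _ _ (vA (size s) _)) //= IH; first last.
- by move=> k ks t' s' ss'; rewrite symv_pd (vA k.+1) //= ss'.
- exact: cochain_pd.
have -> : symv (xi y (kap A) t) s = 0.
  have vx : van (size s) (xi y (kap A)).
    by apply: van_xi; apply: van_kap => //; apply: vA.
  exact: vx.
have -> : symv (kap (xi y A) t) s = 0.
  case ss : s => [|z s'] in vA *; first exact: kap_nil.
  have vx : van (size s').+1 (kap (xi y A)).
    by apply: van_kap => //; apply/van_xi/vA; rewrite /=.
  exact: vx.
rewrite symv_pd -[der _ (symv (pd _ _ _)) _]/(der _ (ins y (symv (A t))) s).
by zmod.
Qed.

Definition pure (y : W) := (val (pr y) == y) || (pr y == 0).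

Lemma pr_comb0 : pr 0 = 0.
Proof. by have := pr_lin (-1) 0 0; rewrite !scaleN1r !addNr. Qed.
Lemma prN x : pr (- x) = - pr x.
Proof. by have := pr_lin (-1) x 0; rewrite !scaleN1r pr_comb0 !addr0. Qed.
Lemma prD x y : pr (x + y) = pr x + pr y.
Proof. by have := pr_lin 1 x y; rewrite !scale1r. Qed.

Lemma der_pure (f : seq W -> J) s : multilin iota f -> all pure s ->
  der (fun y => val (pr y)) f s = (count (fun y => pr y != 0) s)%:R *: f s.
Proof.
elim: s f => [|y s IH] f lf /=; first by rewrite scale0r.
move=> /andP[py ps]; rewrite (IH _ (multilin_ins y lf)) // natrD scalerDl; congr (_ + _).
have [p0|p0] := eqVneq (pr y) 0.
  rewrite p0 scale0r; exact: (congr1 (@^~ s) (multilin_cons0 lf)).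
by move: py; rewrite /pure (negPf p0) orbF => /eqP ->; rewrite scale1r.
Qed.

(** W(n) is the sum of g and the kernel of [pr], so a multilinear function is determined by its
    values on lists of eigenvectors of the retraction. *)
Lemma pure_eq0 (f : seq W -> J) k : multilin iota f ->
  (forall s, all pure s -> size s = k -> f s = 0) -> forall s, size s = k -> f s = 0.
Proof.
elim: k f => [|k IH] f lf pf s; first by case: s => // _; apply: pf.
case: s => [//|y s] [sk].
have pz z : pure z -> f (z :: s) = 0.
  move=> zp; apply: (IH _ (multilin_ins z lf)) => // s' ps' ss'.
  by apply: pf; rewrite /= ?zp ?ss'.
rewrite -(subrK (val (pr y)) y).
have := congr1 (@^~ s) (multilin_consD (y - val (pr y)) (val (pr y)) lf).
rewrite fctE /ins => ->; rewrite !pz ?addr0 //.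
  by rewrite /pure prK eqxx.
by rewrite /pure prD prN prK subrr eqxx orbT.
Qed.

Hypothesis char0 : [pchar F] =i pred0.

Definition symev (p : seq L * seq W) (A : seq L -> S) : J := symv (A p.1) p.2.

Lemma symev_sep A B : (forall p, symev p A = symev p B) -> A = B.
Proof.
move=> AB; apply/funext => t; apply: symv_inj => s; exact: (AB (t, s)).
Qed.

Lemma conv_ins X b l : conv symev b l ->
  conv symev (fun N => ins X (b N)) (ins X l).
Proof. by move=> bl [t s]; apply: (bl (X :: t, s)). Qed.

Lemma evl_ext (M : Type) (u u' : nat -> M) l l' :
  (forall N, u N = u' N) -> l = l' -> evl u' l' -> evl u l.
Proof. by move=> uu -> [N0 h]; exists N0 => N /h <-. Qed.

Lemma evl_sub (M : zmodType) (u u' : nat -> M) l l' :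
  evl u l -> evl u' l' -> evl (fun N => u N - u' N) (l - l').
Proof. exact: (evl_map2 (fun x y => x - y)). Qed.
Lemma evl_add (M : zmodType) (u u' : nat -> M) l l' :
  evl u l -> evl u' l' -> evl (fun N => u N + u' N) (l + l').
Proof. exact: (evl_map2 (fun x y => x + y)). Qed.

Lemma evl_der (E : Type) (M : zmodType) T (h : nat -> seq E -> M) k s :
  (forall s, evl (h^~ s) (k s)) -> evl (fun N => der T (h N) s) (der T k s).
Proof.
elim: s h k => [|y s IH] h k hk /=; first exact: evl_cst.
apply: evl_add; first exact: hk.
by apply: (IH (fun N => ins y (h N)) (ins y k)) => s'; apply: hk.
Qed.

Lemma symv_lieD X A t s : symv (sL X A t) s =
  rho X (symv (A t) s) - symv (A t) (val X :: s) - der (vf_tri (val X)) (symv (A t)) s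
  - symv (der (lie_elt_bracket g X) A t) s.
Proof. by rewrite lieDE symvD symvN [symv (lc_rep S X _) _]symv_act. Qed.

Lemma symv_der T Y A t s : symv (der T A (Y :: t)) s =
  symv (A (T Y :: t)) s + symv (der T (ins Y A) t) s.
Proof. exact: symvD. Qed.

Lemma symv_sd X A t s : symv (sd A (X :: t)) s =
  symv (sL X A t) s - symv (sd (ins X A) t) s.
Proof. by rewrite [sd A _]/= symvD symvN. Qed.

Lemma conv_lieD X b l : conv symev b l ->
  conv symev (fun N => sL X (b N)) (sL X l).
Proof.
move=> bl [t s]; apply: evl_ext => [N||]; [exact: symv_lieD|exact: symv_lieD|].
have bl' t' s' : evl (fun N => symv (b N t') s') (symv (l t') s') by exact: (bl (t', s')).
apply: evl_sub; last first.
  elim: t b l bl {bl'} => [|Y t IH] b l bl; first exact: evl_cst.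
  apply: evl_ext => [N||]; [exact: symv_der|exact: symv_der|].
  apply: evl_add; first exact: (bl (_ :: t, s)).
  by apply: IH; apply: conv_ins.
apply: evl_sub; first by apply: evl_sub; [apply: evl_map; exact: bl'|exact: bl'].
apply: (@evl_der _ _ _ (fun N => symv (b N t))) => s'; exact: bl'.
Qed.

Lemma conv_sd b l : conv symev b l -> conv symev (fun N => sd (b N)) (sd l).
Proof.
move=> bl [t s]; elim: t b l bl => [|X t IH] b l bl; first exact: evl_cst.
apply: evl_ext => [N||]; [exact: symv_sd|exact: symv_sd|].
apply: evl_sub; first exact: (conv_lieD X bl (t, s)).
by apply: IH; apply: conv_ins.
Qed.

Lemma conv_kap b l : (forall N, cochain iota (b N)) -> cochain iota l ->
  conv symev b l -> conv symev (fun N => kap (b N)) (kap l).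
Proof.
move=> cb [ll _] bl [t s]; rewrite /symev /=.
have -> : (fun N => symv (kap (b N) t) s) =
    fun N => kap_fun (fun t => symv (b N t)) t s.
  by apply/funext => N; rewrite kapE //; case: (cb N).
rewrite kapE //.
have gen (B : nat -> seq L -> seq W -> J) B' t' s' :
    (forall t s, evl (fun N => B N t s) (B' t s)) ->
    evl (fun N => kap_fun (B N) t' s') (kap_fun B' t' s').
  elim: s' B B' => [|y s' IH] B B' BB /=; first exact: evl_cst.
  by apply: evl_add; [exact: BB|apply: IH => *; exact: BB].
by apply: (gen (fun N t => symv (b N t))) => t' s'; apply: (bl (t', s')).
Qed.

Lemma sym_limit b : (forall N, cochain iota (b N)) ->
  (forall p, exists l, evl (fun N => symev p (b N)) l) ->
  exists2 l, cochain iota l & conv symev b l.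
Proof.
move=> cb /choice[l0 bl].
have lin t : symrel (fun s => l0 (t, s)).
  split=> [s1 c x y s2|s1 x y s2].
    apply: (evl_uniq (bl (t, _))).
    have := evl_map2 (fun u v => iota c *: u + v) (bl (t, s1 ++ x :: s2)) (bl (t, s1 ++ y :: s2)).
    have -> // : (fun N => symev (t, s1 ++ (c *: x + y) :: s2) (b N)) = fun N =>
       iota c *: symev (t, s1 ++ x :: s2) (b N) + symev (t, s1 ++ y :: s2) (b N).
    by apply/funext => N; have [lf _] := symv_rel (b N t); apply: lf.
  apply: (evl_uniq (bl (t, _))).
  have := bl (t, s1 ++ y :: x :: s2); congr evl; apply/funext => N.
  by have [_ sf] := symv_rel (b N t); apply: sf.
exists (fun t => mks (lin t)); last by move=> [t s]; apply: bl.
split=> [s1 c x y s2|s1 x s2]; apply: symv_inj => s.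
  apply: (evl_uniq (bl (_, s))).
  have := evl_map2 (fun u v => iota c *: u + v) (bl (s1 ++ x :: s2, s)) (bl (s1 ++ y :: s2, s)).
  congr evl; apply/funext => N.
  by have [lf _] := cb N; rewrite /symev /= lf.
apply: (evl_uniq (bl (_, s))); exists 0%N => N _.
by have [_ af] := cb N; rewrite /symev /= af.
Qed.

(** All negative integers, each infinitely often: these contain the eigenvalues in [hl_lead] in
    positive degree. *)
Let lam (N : nat) : F := - ((logn 2 N.+1).+1)%:R.

Lemma symJ_acyclic q A : cochain iota A -> supp q.+1 A -> sd A = 0 ->
  exists2 B, cochain iota B & sd B = A.
Proof.
move=> cA sA dA.
have cp (u v : seq L -> S) c : cochain iota u -> cochain iota v ->
    cochain iota (iota c *: u + v).
  by move=> cu cv; apply: cochainD => //; apply: cochainZ.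
have sdl c u v : sd (iota c *: u + v) = iota c *: sd u + sd v.
  by rewrite cdfD cdf_scale.
have kl c u v : cochain iota u -> cochain iota v ->
    kap (iota c *: u + v) = iota c *: kap u + kap v.
  by move=> [lu _] [lv _]; apply: kap_comb.
pose res := residual iota sd kap lam A.
have cres N : cochain iota (res N).
  apply: (residual_S (S := fun A : seq L -> S => cochain iota A)) => //; last 1 first.
  - by move=> v [lv _]; apply: cdf_cdf.
  - by move=> c u v; apply: cp.
  - exact: cochain0.
  - by move=> v; apply: cochain_cdf.
  - exact: cochain_kap.
have resS N : res N.+1 = iota (- (lam N)^-1) *: hl (res N) + res N by rewrite hlE.
have sres N : supp q.+1 (res N).
  elim: N => [//|N IH]; rewrite resS; apply: suppD => //; apply: suppZ.
  rewrite hlE; apply: suppD.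
    by apply/supp_cdf/supp_kap => //; case: (cres N).
  apply: supp_kap; last exact: supp_cdf.
  by have [] := cochain_cdf (lc_rep S) (cres N).
(* Suppose that from stage N1 on the residuals vanish on symmetric lists shorter than k. On a pure
   list of length k with a letters outside the kernel of [pr], [hl] is then multiplication by -(q +
   1 + a). The next factor with this eigenvalue gives 0, and later factors keep it. Only k + 1
   values of a occur, so that a maximum of stages exists. *)
have key k : exists N0, forall N, (N0 <= N)%N -> forall k', (k' < k)%N -> van k' (res N).
  elim: k => [|k [N1 IH]]; first by exists 0%N.
  have step a : exists Na, forall N, (Na <= N)%N -> forall t s, size s = k ->
      all pure s -> count (fun y => pr y != 0) s = a -> symv (res N t) s = 0.
    have [Na N1a loga] := recurrent_logn (q + a) N1.
    exists Na.+1 => N NaN t s sk ps ca.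
    have [tq|tq] := eqVneq (size t) q.+1; last by rewrite sres.
    have stepN M : (N1 <= M)%N -> symv (res M.+1 t) s =
        iota (((logn 2 M.+1).+1)%:R^-1) *: (- ((q + a).+1%:R *: symv (res M t) s))
        + symv (res M t) s.
      move=> N1M; rewrite resS !fctE symvD symvZ hl_lead //; last first.
        by rewrite sk; apply: IH.
      rewrite der_pure //; last by case: (symv_rel (res M t)).
      by rewrite ca tq -scalerDl -natrD addSn /lam invrN opprK.
    elim: N NaN => [//|N IHN]; rewrite leq_eqVlt => /orP[/eqP[<-]|NaN].
      rewrite stepN // loga scalerN scalerA.
      have -> : iota ((q + a).+1%:R^-1) * (q + a).+1%:R = 1.
        rewrite -[X in _ * X](rmorph_nat iota) -rmorphM mulVf ?rmorph1 //.
        exact: natS_neq0.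
      by rewrite scale1r addNr.
    rewrite stepN; last exact: leq_trans N1a (ltnW NaN).
    by rewrite IHN // scaler0 oppr0 scaler0 addr0.
  have [Nf hNf] := choice step.
  exists (maxn N1 (\max_(a < k.+1) Nf a)) => N; rewrite geq_max => /andP[N1N NfN] k'.
  rewrite ltnS leq_eqVlt => /orP[/eqP ->|]; last exact: IH.
  have vp t : forall s : seq W, all pure s -> size s = k -> symv (res N t) s = 0.
    move=> s ps sk; have ck : (count (fun y => pr y != 0%R) s < k.+1)%N.
      by rewrite ltnS -sk count_size.
    apply: (hNf _ N _ t s sk ps erefl); apply: leq_trans NfN.
    exact: (leq_bigmax (Ordinal ck)).
  by move=> t; apply: pure_eq0 (vp t); case: (symv_rel (res N t)).
have [] := @local_homotopy _ _ iota _ _ _ symev symev_sep (fun A : seq L -> S => cochain iota A) sd kap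
  (fun c u v => cp u v c) (@cochain0 _ _ _ _ _) _ cochain_kap sdl kl _ _ conv_kap
  sym_limit _ lam A cA dA _.
- by move=> v; apply: cochain_cdf.
- by move=> v [lv _]; apply: cdf_cdf.
- by move=> b l _ _; apply: conv_sd.
- by move=> [t s] c u u' v; rewrite /symev /= !symvD !symvZ => ->.
- move=> [t s]; have [N0 hN] := key (size s).+1; exists N0 => N N0N.
  by rewrite /symev /= (hN N N0N (size s)).
- by move=> B [cB dB] _; exists B.
Qed.
End Acyclicity.

Section InjectiveAcyclic.
Variables (F : fieldType) (n : nat) (g : lie_subalg F n).
Local Notation R := {mpoly F[n]}.
Local Notation L := (lie_elt g).
Local Notation iota := (mpolyC n (R := F)).

Definition constf (J : lcmod g) (m : J) : seq (vf F n) -> J :=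
  fun s => if s is [::] then m else 0.

Fact constf_rel (J : lcmod g) (m : J) : symrel (constf m).
Proof. by split=> [[|z s1] c x y s2|[|z s1] x y s2] //=; rewrite scaler0 addr0. Qed.
Definition sym_unit (J : lcmod g) (m : J) : symJ_lc J := mks (constf_rel m).

Lemma sym_unit_hom (J : lcmod g) : is_lchom (@sym_unit J).
Proof.
split=> [a u v|X v]; apply: symv_inj => s.
  by rewrite symvD symvZ; case: s => [|y s] //=; rewrite ?scaler0 ?addr0.
rewrite [RHS]symv_act /=; case: s => [|y s]; first by rewrite /= !subr0.
have r0 : rho X (0 : J) = 0 := act0 (lc_rep J) X.
have d0 : der (vf_tri (val X)) (constf v) (y :: s) = 0 by apply: der_eq0; case.
by rewrite [symv (sym_unit v)]/(constf v) d0 /= r0 !subr0.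
Qed.

Lemma sym_unit_inj (J : lcmod g) : injective (@sym_unit J).
Proof. by move=> u v /(congr1 (fun f : symJ J => symv f [::])). Qed.

Lemma lie_elt_retraction : exists pr : vf F n -> L,
  (forall c x y, pr (c *: x + y) = c *: pr x + pr y) /\ forall X : L, pr (val X) = X.
Proof.
pose G (p : lmod_fspace (vf F n) * lmod_fspace L) := p.1 = val (p.2 : L).
have [||pr [pl pG]] := linear_selection (G := G).
- by [].
- by move=> c [x X] [y Y]; rewrite /G /= => -> ->.
exists pr; split=> [//|X]; apply: val_inj; apply: esym.
exact: (pG (val X : vf F n) X).
Qed.

Definition lc_push (M N : lcmod g) (f : M -> N) (a : seq L -> M) : seq L -> N :=
  fun s => f (a s).

Section Push.
Variables (M N : lcmod g) (f : M -> N).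
Hypothesis fh : is_lchom f.
Implicit Types a : seq L -> M.

Lemma lc_pushE a : lc_push f a = pull id f a.
Proof. by apply/funext => s; rewrite /pull map_id. Qed.
Let f_lin (c : F) u v : f (iota c *: u + v) = iota c *: f u + f v.
Proof. by rewrite (lchomD fh) (lchomZ fh). Qed.

Lemma lc_pushD a b : lc_push f (a + b) = lc_push f a + lc_push f b.
Proof. by apply/funext => s; apply: lchomD. Qed.
Lemma lc_pushZ k a : lc_push f (k *: a) = k *: lc_push f a.
Proof. by apply/funext => s; apply: lchomZ. Qed.
Lemma lc_push0 : lc_push f 0 = 0.
Proof. by apply/funext => s; apply: lchom0. Qed.
Lemma lc_pushN a : lc_push f (- a) = - lc_push f a.
Proof. by apply/funext => s; apply: lchomN. Qed.
Lemma lc_pushB a b : lc_push f (a - b) = lc_push f a - lc_push f b.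
Proof. by rewrite lc_pushD lc_pushN. Qed.
Lemma cochain_push a : cochain iota a -> cochain iota (lc_push f a).
Proof. by move=> ca; rewrite lc_pushE; apply: cochain_pull. Qed.
Lemma supp_push q a : supp q a -> supp q (lc_push f a).
Proof. by move=> sa s qs; rewrite /lc_push sa ?(lchom0 fh). Qed.
Lemma cdf_push a : cdf (lc_rep N) (lc_push f a) = lc_push f (cdf (lc_rep M) a).
Proof.
by rewrite !lc_pushE; apply: cdf_pull => // X m; rewrite [LHS](lchom_act fh).
Qed.
End Push.

Lemma injective_acyclic (J : lcmod g) q (a : seq L -> J) : [pchar F] =i pred0 ->
  lc_injective J -> cochain iota a -> supp q.+1 a -> cdf (lc_rep J) a = 0 ->
  exists b, [/\ cochain iota b, supp q b & cdf (lc_rep J) b = a].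
Proof.
move=> char0 Jinj ca sa da.
have [h hh hK] := Jinj _ _ _ id (sym_unit_hom J) (@sym_unit_inj J)
  (conj (fun _ _ _ => erefl) (fun _ _ => erefl)).
have [pr [pr_lin prK]] := lie_elt_retraction.
have uh := sym_unit_hom J.
have [|||B cB dB] := @symJ_acyclic F n g J pr pr_lin prK char0 q (lc_push (@sym_unit J) a).
- exact: cochain_push.
- exact: supp_push.
- by rewrite cdf_push // da lc_push0.
exists (trunc q (lc_push h B)); split.
- by apply/cochain_trunc/cochain_push.
- exact: supp_trunc.
rewrite cdf_trunc cdf_push // dB.
rewrite [lc_push h _](_ : _ = a) ?trunc_supp //.
by apply/funext => s; apply: hK.
Qed.
End InjectiveAcyclic.

(** * Comparison of the two complexes *)

Section Staircase.
Variables (F : fieldType) (n : nat) (g : lie_subalg F n).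
Hypothesis char0 : [pchar F] =i pred0.
Local Notation R := {mpoly F[n]}.
Local Notation L := (lie_elt g).
Local Notation iota := (mpolyC n (R := F)).

Record coch (N : lcmod g) (p : nat) (x : seq L -> N) : Prop :=
  Coch { coch_cochain : cochain iota x; coch_supp : supp p x }.

Definition cd (N : lcmod g) : (seq L -> N) -> seq L -> N := cdf (lc_rep N).

Section CochFacts.
Variable N : lcmod g.
Implicit Types x y : seq L -> N.

Lemma coch_comb c p x y : coch p x -> coch p y -> coch p (iota c *: x + y).
Proof.
move=> [cx sx] [cy sy]; split; first by apply: cochainD => //; apply: cochainZ.
by apply: suppD => //; apply: suppZ.
Qed.
Lemma coch0 p : coch p (0 : seq L -> N).
Proof. by split; [exact: cochain0|]. Qed.
Lemma cochB p x y : coch p x -> coch p y -> coch p (x - y).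
Proof. by move=> [cx sx] [cy sy]; split; [exact: cochainB|exact: suppB]. Qed.
Lemma cochD p x y : coch p x -> coch p y -> coch p (x + y).
Proof. by move=> [cx sx] [cy sy]; split; [exact: cochainD|exact: suppD]. Qed.
Lemma coch_cd p x : coch p x -> coch p.+1 (cd x).
Proof. by move=> [cx sx]; split; [exact: cochain_cdf|exact: supp_cdf]. Qed.
Lemma cd_cd p x : coch p x -> cd (cd x) = 0.
Proof. by move=> [[lx _] _]; exact: cdf_cdf. Qed.
Lemma cd_comb c x y : cd (iota c *: x + y) = iota c *: cd x + cd y.
Proof. by rewrite /cd cdfD cdf_scale. Qed.
Lemma cdB x y : cd (x - y) = cd x - cd y. Proof. exact: cdfB. Qed.
Lemma cdD x y : cd (x + y) = cd x + cd y. Proof. exact: cdfD. Qed.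
Lemma cd0 : cd (0 : seq L -> N) = 0. Proof. exact: cdf0. Qed.
End CochFacts.

Section PushFacts.
Variables (M N : lcmod g) (f : M -> N).
Hypothesis fh : is_lchom f.
Implicit Type x : seq L -> M.
Lemma coch_push p x : coch p x -> coch p (lc_push f x).
Proof. by move=> [cx sx]; split; [exact: cochain_push|exact: supp_push]. Qed.
Lemma cd_push x : cd (lc_push f x) = lc_push f (cd x).
Proof. exact: cdf_push. Qed.

Lemma push_inj : injective f -> injective (lc_push f).
Proof.
by move=> fi x y xy; apply/funext => s; apply: fi; exact: (congr1 (@^~ s) xy).
Qed.

(** Compose y with a linear section of [f] over its image. The section need respect neither R nor g,
    since multilinearity and alternation of cochains are conditions over F. *)
Lemma push_lift p (y : seq L -> N) : coch p y -> (forall t, exists u, y t = f u) ->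
  exists2 x, coch p x & lc_push f x = y.
Proof.
move=> [[ly ay] sy] yf.
pose G (q : rmod_fspace N * rmod_fspace M) := q.1 = f q.2.
have [||h [hl hG]] := linear_selection (G := G).
- by rewrite /G /= (lchom0 fh).
- by move=> c [v u] [v' u']; rewrite /G /= => -> ->; rewrite (lchomD fh) (lchomZ fh).
have h0 : h 0 = 0.
  have := hl 1 0 0; rewrite !fsc1 addr0 -[X in X = _]addr0.
  by move=> /addrI.
exists (fun t => h (y t)).
  split; last by move=> s qs; rewrite sy.
  split; first by move=> s1 c u v s2; rewrite ly; exact: hl.
  by move=> s1 u s2; rewrite ay.
apply/funext => t; have [u yu] := yf t.
by rewrite /lc_push yu; apply/esym/(hG (f u) u).
Qed.
End PushFacts.

Variables (M : lcmod g) (I : injres M).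
Local Notation eps := (lc_push (ir_aug I)).
Local Notation dI := (lc_push (@ir_d _ _ _ _ I _)).

Let eps_hom := ir_aug_hom I.
Let d_hom k := ir_d_hom I k.

Lemma dI_eps (a : seq L -> M) : dI (eps a) = 0.
Proof. by apply/funext => t; apply/ir_exact0; exists (a t). Qed.
Lemma dI_dI k (x : seq L -> I k) : dI (dI x) = 0.
Proof. by apply/funext => t; apply/ir_exact; exists (x t). Qed.

Lemma eps_lift p (x : seq L -> I 0%N) : coch p x -> dI x = 0 ->
  exists2 a, coch p a & eps a = x.
Proof.
move=> cx dx; apply: push_lift => // t; apply/ir_exact0.
exact: (congr1 (@^~ t) dx).
Qed.
Lemma dI_lift p k (x : seq L -> I k.+1) : coch p x -> dI x = 0 ->
  exists2 y : seq L -> I k, coch p y & dI y = x.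
Proof.
move=> cx dx; apply: push_lift => // t; apply/ir_exact.
exact: (congr1 (@^~ t) dx).
Qed.
Lemma cd_lift p k (x : seq L -> I k) : coch p.+1 x -> cd x = 0 ->
  exists2 y : seq L -> I k, coch p y & cd y = x.
Proof.
move=> [cx sx] dx; have [y [cy sy dy]] := injective_acyclic char0 (@ir_inj _ _ _ _ I k) cx sx dx.
by exists y.
Qed.

(* zig a p y: a staircase joins eps a, in bidegree (p + k, 0), to y in (p, k). *)
Fixpoint zig (a : seq L -> M) (p k : nat) : (seq L -> I k) -> Prop :=
  match k with
  | 0 => fun y => y = eps a
  | k'.+1 => fun y => exists t : seq L -> I k',
      [/\ coch p t, dI t = y & @zig a p.+1 k' (cd t)]
  end.

Definition cocyc p (a : seq L -> M) := coch p a /\ cd a = 0.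
Definition bicyc p k (y : seq L -> I k) := [/\ coch p y, cd y = 0 & dI y = 0].

Lemma zig_bicyc a p k (y : seq L -> I k) : cocyc (p + k) a -> zig a p y -> bicyc p y.
Proof.
elim: k p y => [|k IH] p y [ca da] /=.
  move=> ->; split; last exact: dI_eps.
    by apply: coch_push => //; rewrite addn0 in ca.
  by rewrite cd_push // da lc_push0.
move=> [t [ct <- zt]]; have [|cx dx ddx] := IH p.+1 _ _ zt; first by rewrite addSnnS.
split; last exact: dI_dI.
  exact: coch_push.
by rewrite cd_push.
Qed.

Lemma zig_left p k a : cocyc (p + k) a -> exists y, @zig a p k y.
Proof.
elim: k p => [|k IH] p; first by exists (eps a).
move=> ca; have ca' : cocyc (p.+1 + k) a by rewrite addSnnS.
have [x zx] := IH _ ca'; have [cx dx ddx] := zig_bicyc ca' zx.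
have [t ct tx] := cd_lift cx dx.
by exists (dI t); exists t; split => //; rewrite tx.
Qed.

Lemma zig_right p k (y : seq L -> I k) : bicyc p y ->
  exists2 a, cocyc (p + k) a & zig a p y.
Proof.
elim: k p y => [|k IH] p y [cy dy ddy].
  have [a ca ay] := eps_lift cy ddy; exists a => //; split; first by rewrite addn0.
  apply: (push_inj (@ir_aug_inj _ _ _ _ I)); rewrite lc_push0 //.
  by rewrite -cd_push // ay.
have [t ct ty] := dI_lift cy ddy.
have [|a ca za] := IH p.+1 (cd t).
  split; first exact: coch_cd.
    exact: cd_cd ct.
  by rewrite -cd_push // ty.
by exists a; [rewrite -addSnnS|exists t].
Qed.

Lemma zig_comb c p k a a' (y y' : seq L -> I k) : zig a p y -> zig a' p y' ->
  zig (iota c *: a + a') p (iota c *: y + y').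
Proof.
elim: k p y y' => [|k IH] p y y' /=.
  by move=> -> ->; rewrite lc_pushD // lc_pushZ.
move=> [t [ct <- zt]] [t' [ct' <- zt']]; exists (iota c *: t + t'); split.
- exact: coch_comb.
- by rewrite lc_pushD // lc_pushZ.
- by rewrite cd_comb; apply: IH.
Qed.

Definition exactC p (a : seq L -> M) : Prop :=
  match p with 0 => a = 0 | p'.+1 => exists2 b, coch p' b & cd b = a end.

(** Two ways for a bicocycle to be trivial: it is a boundary in one direction of an element that is
    closed in the other. At p = 0, [trivH] says that a cocycle of Gamma(I) is a coboundary; at k =
    0, [trivV] says the same in C(M), through the augmentation. *)
Definition trivV p k (x : seq L -> I k) : Prop :=
  match p with 0 => x = 0 | p'.+1 => exists w, [/\ coch p' w, cd w = x & dI w = 0] end.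
Definition trivH p k : (seq L -> I k) -> Prop :=
  match k with 0 => fun y => y = 0
  | k'.+1 => fun y => exists w : seq L -> I k', [/\ coch p w, cd w = 0 & dI w = y] end.

(** The closed element w is itself a boundary in that direction, by exactness of I one way and by
    acyclicity of I^k the other; commuting the two differentials exchanges the roles. *)
Lemma trivVH p k (y : seq L -> I k.+1) : trivV p.+1 y <-> trivH p.+1 y.
Proof.
split=> [[w [cw <- dw]]|[w [cw dw <-]]].
  have [v cv vw] := dI_lift cw dw; exists (cd v); split; first exact: coch_cd.
    exact: cd_cd cv.
  by rewrite -cd_push // vw.
have [v cv vw] := cd_lift cw dw; exists (dI v); split; first exact: coch_push.
  by rewrite cd_push // vw.
exact: dI_dI.
Qed.

(** Triviality moves one step along the staircase: if y = dI t and w witnesses the horizontal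
    triviality of y, then t - w witnesses the vertical triviality of cd t, and conversely. *)
Lemma zig_triv a p k (y : seq L -> I k) : zig a p y ->
  ((0 < p)%N -> (trivV p y <-> exactC (p + k) a)) /\
  ((0 < k)%N -> (trivH p y <-> exactC (p + k) a)).
Proof.
elim: k p y => [|k IH] p y /=.
  move=> ->; split=> //; case: p => [//|p] _; rewrite addn0 /=; split.
    move=> [w [cw dw ddw]]; have [b cb bw] := eps_lift cw ddw; exists b => //.
    apply: (push_inj (@ir_aug_inj _ _ _ _ I)).
    by rewrite -cd_push // bw.
  move=> [b cb <-]; exists (eps b); split; first exact: coch_push.
    by rewrite cd_push.
  exact: dI_eps.
move=> [t [ct ty zt]]; have [IHV _] := IH _ _ zt; have {IHV} IHV := IHV isT.
have H : trivH p (k := k.+1) y <-> exactC (p + k.+1) a.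
  rewrite -addSnnS -IHV -ty /=; split=> [[w [cw dw ww]]|[w [cw dw ww]]].
    exists (t - w); split; first exact: cochB.
      by rewrite cdB dw subr0.
    by rewrite lc_pushB // ww subrr.
  exists (t - w); split; first exact: cochB.
    by rewrite cdB dw subrr.
  by rewrite lc_pushB // ww subr0.
split=> // p0; rewrite -H; case: p p0 {ct zt IHV H} => // p _; exact: trivVH.
Qed.
End Staircase.

(** * Cohomology classes and relations between them *)

Section CohFacts.
Variables (K : nzRingType) (C : cochain_complex K) (q : nat).
Implicit Types (z : cobj C q) (c : coh C q).

Lemma coh_class_ex c : exists z, coh_class z c.
Proof. by have [z ->] := pi_mod_surj c; exists (val z), z. Qed.

Lemma coh_class_cocycle z c : coh_class z c -> is_cocycle z.
Proof. by move=> [z' <- _]; apply: (elimT (smembP _ _) (valP z')). Qed.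

Definition cocycle_elt z (dz : is_cocycle z) : sub_mod (cocycles C q) :=
  exist (fun x => x \in smemb (cocycles C q)) z (introT (smembP (cocycles C q) z) dz).

Lemma cocycle_class z : is_cocycle z -> exists c, coh_class z c.
Proof.
by move=> dz; exists (pi_mod (coboundaries C q) (cocycle_elt dz)), (cocycle_elt dz).
Qed.

Lemma pi_modZ (V : lmodType K) (N : submod V) a v : pi_mod N (a *: v) = a *: pi_mod N v.
Proof. by rewrite -quo_scaleE. Qed.

Lemma coh_class_comb a z z' c c' : coh_class z c -> coh_class z' c' ->
  coh_class (a *: z + z') (a *: c + c').
Proof.
move=> [y <- ->] [y' <- ->]; exists (a *: y + y') => //.
by rewrite pi_modD pi_modZ.
Qed.

Lemma pi_mod0 (V : lmodType K) (N : submod V) : pi_mod N 0 = 0.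
Proof. by rewrite -(scale0r (0 : V)) pi_modZ scale0r. Qed.

Lemma coh_class_eq0 z c : coh_class z c -> (c = 0 <-> is_coboundary z).
Proof.
move=> [y <- ->]; rewrite -(pi_mod0 (coboundaries C q)).
by rewrite (pi_modE (coboundaries C q)) subr0.
Qed.

Lemma coh_class_eq z z' c c' : coh_class z c -> coh_class z' c' ->
  (c = c' <-> is_coboundary (z - z')).
Proof.
move=> zc zc'; have := coh_class_comb (-1) zc' zc.
rewrite !scaleN1r addrC [- c' + c]addrC => /coh_class_eq0 <-.
by split=> [->|/eqP]; rewrite ?subrr // subr_eq0 => /eqP.
Qed.
End CohFacts.

(** The comparisons of cohomology groups are relations, expressed through representatives.
    Compatibility with differences reduces well-definedness and injectivity to the case of 0. The
    scalars form an abstract type with an element that acts as -1, since the two groups may be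
    modules over different rings. *)
Lemma linear_relation_iso (A B : zmodType) (S : Type) (sA : S -> A -> A) (sB : S -> B -> B)
  (s1 : S) (Rel : A -> B -> Prop) :
  (forall a, sA s1 a = - a) -> (forall b, sB s1 b = - b) ->
  (forall c a b a' b', Rel a b -> Rel a' b' -> Rel (sA c a + a') (sB c b + b')) ->
  (forall a, exists b, Rel a b) -> (forall b, exists a, Rel a b) ->
  (forall a b, Rel a b -> (a = 0 <-> b = 0)) ->
  exists phi : A -> B, [/\ bijective phi, forall a, Rel a (phi a),
     forall a b, Rel a b -> b = phi a &
     forall c a a', phi (sA c a + a') = sB c (phi a) + phi a'].
Proof.
move=> sA1 sB1 Rlin Rl Rr R0.
have Rsub a b a' b' : Rel a b -> Rel a' b' -> Rel (a - a') (b - b').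
  by move=> ab ab'; have := Rlin s1 _ _ _ _ ab' ab; rewrite sA1 sB1 ![- _ + _]addrC.
have RB a b b' : Rel a b -> Rel a b' -> b = b'.
  move=> ab ab'; apply/eqP; rewrite -subr_eq0; apply/eqP.
  by apply/(R0 _ _ (Rsub _ _ _ _ ab ab')); rewrite subrr.
have RA a a' b : Rel a b -> Rel a' b -> a = a'.
  move=> ab ab'; apply/eqP; rewrite -subr_eq0; apply/eqP.
  by apply/(R0 _ _ (Rsub _ _ _ _ ab ab')); rewrite subrr.
have [phi hphi] := choice Rl; have [psi hpsi] := choice Rr.
exists phi; split=> //.
- exists psi => x; first exact: RA (hpsi _) (hphi _).
  exact: RB (hphi _) (hpsi _).
- by move=> a b ab; apply: RB ab (hphi a).
- by move=> c a a'; apply: RB (hphi _) _; apply: Rlin.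
Qed.

Section GammaBridge.
Variables (F : fieldType) (n : nat) (g : lie_subalg F n) (N : lcmod g).
Local Notation R := {mpoly F[n]}.
Local Notation L := (lie_elt g).
Local Notation iota := (mpolyC n (R := F)).

(** A morphism from R is determined by the image of 1, a vector annihilated by g. Such vectors are
    the cocycles of degree 0, which puts Gamma(I) on an edge of the double complex. *)
Definition gam_list (z : Gamma N) : seq L -> N := fun t => if t is [::] then val z 1 else 0.

Lemma GammaP (z : Gamma N) : is_lchom (val z : lcR g -> N).
Proof. exact: (elimT (smembP _ _) (valP z)). Qed.

Lemma GammaE (z : Gamma N) r : val z r = r *: val z 1.
Proof.
have := lchomZ (GammaP z) r (1 : R^o).
by rewrite [r *: (1 : R^o)]mulr1.
Qed.

Lemma rho_Gamma1 (z : Gamma N) X : rho X (val z 1) = 0.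
Proof.
rewrite -(lchom_act (GammaP z)) -[rho X _]/(lie_act X 1) /lie_act -mpolyC1 vf_actC.
exact: (lchom0 (GammaP z)).
Qed.

Lemma coch_gam z : coch 0 (gam_list z).
Proof.
split; last by case.
split; last by move=> [|? ?].
by move=> [|u s1] c x y s2 /=; rewrite scaler0 addr0.
Qed.

Lemma cd_coch0 (y : seq L -> N) : coch 0 y ->
  (cd y = 0 <-> forall X, rho X (y [::]) = 0).
Proof.
move=> [_ sy]; split=> [dy X|ry].
  have := congr1 (@^~ [:: X]) dy; rewrite /cd /= lieD_nil subr0.
  by [].
apply/funext => -[//|X s]; rewrite /cd /= (supp_ins0 _ sy) cdf0 subr0.
by case: s => [|Y s]; [rewrite lieD_nil; exact: ry|rewrite (supp_lieD _ _ sy)].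
Qed.

Lemma cd_gam z : cd (gam_list z) = 0.
Proof. by apply/cd_coch0; [exact: coch_gam|move=> X; exact: rho_Gamma1]. Qed.

Lemma gam_list_inj : injective gam_list.
Proof.
move=> z z' zz'; have e : val z 1 = val z' 1 := congr1 (@^~ [::]) zz'.
by apply: val_inj; apply/funext => r; rewrite (GammaE z) (GammaE z') e.
Qed.

Lemma gam_list_surj (y : seq L -> N) : coch 0 y -> cd y = 0 -> exists z, gam_list z = y.
Proof.
move=> cy /(cd_coch0 cy) ry; have [_ sy] := cy.
have zG : Gamma_mem (fun r : R => r *: y [::]).
  split=> [a u v|X u]; first by rewrite scalerDl scalerA.
  have := rho_compat X u (y [::]); rewrite ry scaler0 subr0 => ->.
  by [].
pose z : Gamma N := exist (fun x => x \in smemb (Submod (@Gamma_mem0 _ _ g N) (@Gamma_memP _ _ g N))) _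
   (introT (smembP (Submod (@Gamma_mem0 _ _ g N) (@Gamma_memP _ _ g N)) _) zG).
exists z; apply/funext => -[|X t] /=; first by rewrite scale1r.
by rewrite sy.
Qed.

Lemma omegaE (a : R) : omega a = iota a.@[fun=> 0].
Proof. by []. Qed.

Lemma gam_list_comb (a : R) z z' :
  gam_list (a *: z + z') = omega a *: gam_list z + gam_list z'.
Proof. by apply/funext => -[//|X t]; rewrite !fctE /= scaler0 addr0. Qed.
End GammaBridge.

Lemma gam_list_diff (F : fieldType) n (g : lie_subalg F n) (M : lcmod g) (I : injres M) q
  (z : Gamma (I q)) (w : Gamma (I q.+1)) :
  Gamma_diff z w <-> lc_push (@ir_d _ _ _ _ I q) (gam_list z) = gam_list w.
Proof.
have dh := ir_d_hom I q.
split=> [zw|/(congr1 (@^~ [::])) e r].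
  by apply/funext => -[|X t]; rewrite /lc_push /= ?zw // (lchom0 dh).
by rewrite GammaE [val z r]GammaE (lchomZ dh) -[val w 1]/(gam_list w [::]) -e.
Qed.

(** * Alternating forms on tuples and cochains on lists *)

Section ListFun.
Variables (V : zmodType).

Definition flist q (x : {ffun 'I_q -> V}) : seq V := [seq x i | i <- enum 'I_q].
Definition lfun q (s : seq V) : {ffun 'I_q -> V} := [ffun i : 'I_q => s`_i].

Lemma size_flist q (x : {ffun 'I_q -> V}) : size (flist x) = q.
Proof. by rewrite size_map size_enum_ord. Qed.

Lemma nth_flist q (x : {ffun 'I_q -> V}) (i : 'I_q) : (flist x)`_i = x i.
Proof. by rewrite (nth_map i) ?size_enum_ord // nth_ord_enum. Qed.

Lemma flistK q : cancel (@flist q) (@lfun q).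
Proof. by move=> x; apply/ffunP => i; rewrite ffunE nth_flist. Qed.

Lemma lfunK q s : size s = q -> flist (lfun q s) = s.
Proof.
move=> sq; apply: (@eq_from_nth _ 0); first by rewrite size_flist.
move=> i; rewrite size_flist => iq; rewrite (nth_flist _ (Ordinal iq)).
by rewrite ffunE.
Qed.

Definition ftail q (x : {ffun 'I_q.+1 -> V}) : {ffun 'I_q -> V} :=
  [ffun i => x (fintype.lift ord0 i)].

Lemma flistS q (x : {ffun 'I_q.+1 -> V}) : flist x = x ord0 :: flist (ftail x).
Proof.
rewrite /flist enum_ordSl /= -map_comp; congr (_ :: _).
by apply: eq_map => i; rewrite /= ffunE.
Qed.

Lemma omit_ord0 q (x : {ffun 'I_q.+1 -> V}) (s : seq 'I_q) :
  omit x (ord0 :: map (fintype.lift ord0) s) = omit (ftail x) s.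
Proof.
rewrite /omit enum_ordSl /= filter_map -map_comp.
rewrite (eq_filter (a2 := fun k => k \notin s)) => [|k].
  by apply: eq_map => i; rewrite /= ffunE.
by rewrite /= !inE /= (mem_map (@lift_inj _ _)).
Qed.

Lemma omit_lift q (x : {ffun 'I_q.+1 -> V}) (s : seq 'I_q) :
  omit x (map (fintype.lift ord0) s) = x ord0 :: omit (ftail x) s.
Proof.
rewrite /omit enum_ordSl /=.
have -> : (ord0 \notin [seq fintype.lift ord0 i | i <- s]) = true.
  by apply/mapP => -[j _ /eqP]; rewrite (negPf (neq_lift _ _)).
rewrite /=; congr (_ :: _); rewrite filter_map -map_comp.
rewrite (eq_filter (a2 := fun k => k \notin s)) => [|k].
  by apply: eq_map => i; rewrite /= ffunE.
by rewrite /= (mem_map (@lift_inj _ _)).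
Qed.

Lemma omit_nil q (x : {ffun 'I_q -> V}) : omit x [::] = flist x.
Proof. by rewrite /omit (eq_filter (a2 := predT)) ?filter_predT. Qed.

Lemma size_omit1 q (x : {ffun 'I_q.+1 -> V}) s : size (omit x [:: s]) = q.
Proof.
elim: q x s => [|q IH] x s.
  rewrite (ord1 s); have := omit_ord0 x [::]; rewrite /= => ->.
  by rewrite omit_nil size_flist.
case: (unliftP ord0 s) => [j ->|->].
  by have := omit_lift x [:: j]; rewrite /= => ->; rewrite /= IH.
have := omit_ord0 x [::]; rewrite /= => ->.
by rewrite omit_nil size_flist.
Qed.

Lemma size_omit2 q (x : {ffun 'I_q.+1 -> V}) (s t : 'I_q.+1) :
  (s < t)%N -> (size (omit x [:: s; t])).+1 = q.
Proof.
elim: q x s t => [|q IH] x s t; first by rewrite (ord1 s) (ord1 t).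
case: (unliftP ord0 t) => [t' ->|-> //].
case: (unliftP ord0 s) => [s' ->|->]; last first.
  by have := omit_ord0 x [:: t']; rewrite /= => -> _; rewrite size_omit1.
rewrite /= /bump /= !add1n ltnS => st.
by have := omit_lift x [:: s'; t']; rewrite /= => ->; rewrite /= IH.
Qed.

Lemma lfun_ffset q (s1 s2 : seq V) x (y : V) (i : 'I_q) : i = size s1 :> nat ->
  lfun q (s1 ++ x :: s2) = ffset (lfun q (s1 ++ y :: s2)) i x.
Proof.
move=> si; apply/ffunP => j; rewrite !ffunE.
have [->|ij] := eqVneq j i.
  by rewrite si nth_cat ltnn subnn.
rewrite !nth_cat; case: ltnP => // sj.
have : (size s1 < j)%N by rewrite ltn_neqAle sj andbT -si eq_sym; exact: ij.
by rewrite -subn_gt0; case: (j - _)%N.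
Qed.

Lemma flist_ffset q (x : {ffun 'I_q -> V}) (i : 'I_q) y :
  flist (ffset x i y) = take i (flist x) ++ y :: drop i.+1 (flist x).
Proof.
have iq : (i < size (flist x))%N by rewrite size_flist.
rewrite -[LHS](lfunK (q := q)) ?size_flist // flistK.
rewrite -[RHS](lfunK (q := q)); last first.
  by rewrite size_cat /= size_takel ?size_drop ?size_flist ?(ltnW (ltn_ord i)) // subnSK ?subnKC // ltnW.
congr flist; rewrite (@lfun_ffset _ _ _ y (x i) i) ?size_takel ?size_flist ?(ltnW (ltn_ord i)) //.
by rewrite -(nth_flist x i) -drop_nth // cat_take_drop flistK.
Qed.

Lemma flist_split q (x : {ffun 'I_q -> V}) (i : 'I_q) :
  flist x = take i (flist x) ++ x i :: drop i.+1 (flist x).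
Proof.
by rewrite -(nth_flist x i) -drop_nth ?size_flist // cat_take_drop.
Qed.
End ListFun.

Section FunctionForms.
Variables (F : fieldType) (L : lmodType F) (K : comNzRingType).
Variables (iota : {rmorphism F -> K}) (M : lmodType K).

(** Skew symmetry moves one of the equal arguments next to the other. *)
Lemma altern_repeat (f : seq L -> M) s1 y s2 s3 : cochain iota f ->
  f (s1 ++ y :: s2 ++ y :: s3) = 0.
Proof.
move=> cf; elim: s1 f cf => [|z s1 IH] f cf /=; last exact: (IH _ (cochain_ins z cf)).
elim: s2 f cf => [|z s2 IH] f cf /=; first by case: cf => _ af; apply: (af [::]).
have /(congr1 (@^~ (s2 ++ y :: s3))) := cochain_swap y z cf; rewrite fctE /ins.
have -> : f (z :: y :: s2 ++ y :: s3) = 0 by exact: (IH (ins z f) (cochain_ins z cf)).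
by move=> /eqP; rewrite eq_sym oppr_eq0 => /eqP.
Qed.

Definition lform q (w : {ffun 'I_q -> L} -> M) : seq L -> M := fun s =>
  if size s == q then w (lfun q s) else 0.

Lemma lform_flist q (w : {ffun 'I_q -> L} -> M) x : lform w (flist x) = w x.
Proof. by rewrite /lform size_flist eqxx flistK. Qed.

Lemma supp_lform q (w : {ffun 'I_q -> L} -> M) : supp q (lform w).
Proof. by move=> s /negPf qs; rewrite /lform qs. Qed.

Lemma lform_ext q (w w' : {ffun 'I_q -> L} -> M) : lform w = lform w' -> forall x, w x = w' x.
Proof. by move=> ww x; rewrite -!lform_flist ww. Qed.

Lemma lform_eq q (f : seq L -> M) (w : {ffun 'I_q -> L} -> M) : supp q f ->
  (forall x, w x = f (flist x)) -> lform w = f.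
Proof.
move=> sf wf; apply/funext => s; rewrite /lform; case: (eqVneq (size s) q) => sq.
  by rewrite wf lfunK.
by rewrite sf.
Qed.

Lemma cochain_lform q (w : {ffun 'I_q -> L} -> M) :
  (forall x i c u v, w (ffset x i (c *: u + v)) = iota c *: w (ffset x i u) + w (ffset x i v)) ->
  (forall (x : {ffun 'I_q -> L}) i j, i != j -> x i = x j -> w x = 0) -> cochain iota (lform w).
Proof.
move=> wl wa; split=> [s1 c x y s2|s1 x s2]; rewrite /lform !size_cat /=.
  case: eqP => sq; last by rewrite scaler0 addr0.
  have iq : (size s1 < q)%N by rewrite -sq addnS ltnS leq_addr.
  rewrite (lfun_ffset s2 (c *: x + y) x (i := Ordinal iq)) // wl.
  rewrite -(lfun_ffset s2 x x (i := Ordinal iq)) //.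
  by rewrite -(lfun_ffset s2 y x (i := Ordinal iq)).
case: eqP => // sq.
have i1 : (size s1 < q)%N by rewrite -sq addnS ltnS leq_addr.
have i2 : ((size s1).+1 < q)%N by rewrite -sq !addnS !ltnS leq_addr.
apply: (@wa _ (Ordinal i1) (Ordinal i2)).
  by rewrite -val_eqE /= neq_ltn ltnSn.
by rewrite !ffunE /= !nth_cat ltnn subnn /= ltnNge leqnSn /= subSnn.
Qed.

Lemma flist_lin q (f : seq L -> M) x (i : 'I_q) c u v : cochain iota f ->
  f (flist (ffset x i (c *: u + v))) = iota c *: f (flist (ffset x i u)) + f (flist (ffset x i v)).
Proof. by case=> lf _; rewrite !flist_ffset lf. Qed.

Lemma flist_alt q (f : seq L -> M) (x : {ffun 'I_q -> L}) i j : cochain iota f ->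
  i != j -> x i = x j -> f (flist x) = 0.
Proof.
move=> cf ij xij; wlog lij : i j ij xij / (i < j)%N => [H|].
  have [ltij|ltji|/val_inj eij] := ltngtP i j; [exact: (H i j)| |].
    by apply: (H j i) => //; rewrite eq_sym.
  by rewrite eij eqxx in ij.
rewrite (flist_split x i).
have -> : drop i.+1 (flist x) = take (j - i.+1) (drop i.+1 (flist x)) ++ x i ::
    drop j.+1 (flist x).
  rewrite xij -{1}(cat_take_drop (j - i.+1) (drop i.+1 (flist x))); congr (_ ++ _).
  by rewrite drop_drop subnK // -(nth_flist x j) -drop_nth ?size_flist.
exact: altern_repeat.
Qed.
End FunctionForms.

Section ExplicitDifferential.
Variables (F : fieldType) (L : lmodType F) (br : lie_bracket L).
Variables (K : comNzRingType) (iota : {rmorphism F -> K}) (M : lmodType K).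
Variable rho : lie_rep br iota M.

Lemma der_explicit T q (x : {ffun 'I_q -> L}) (f : seq L -> M) : cochain iota f ->
  der T f (flist x) = \sum_(t < q) (-1) ^+ t *: f (T (x t) :: omit x [:: t]).
Proof.
elim: q x f => [|q IH] x f cf; first by rewrite /flist enum_ord0 big_ord0.
rewrite flistS /= IH; last exact: cochain_ins.
rewrite big_ord_recl scale1r; congr (f (_ :: _) + _).
  by have := omit_ord0 x [::]; rewrite /= => ->; rewrite omit_nil.
apply: eq_bigr => t _; rewrite ffunE.
have := omit_lift x [:: t]; rewrite /= => ->.
have /(congr1 (@^~ (omit (ftail x) [:: t]))) := cochain_swap (x ord0) (T (x (fintype.lift ord0 t))) cf.
rewrite !fctE /ins => e; by rewrite exprS mulN1r scaleNr e scalerN opprK.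
Qed.

(** Induction on the number of arguments. The summands with s = 0 come from the Lie derivative along
    the first argument. The others come from - d i_x, where the first argument is moved past a
    bracket at the cost of a sign. *)
Lemma cdf_explicit q (x : {ffun 'I_q -> L}) (f : seq L -> M) : cochain iota f ->
  cdf rho f (flist x) =
  \sum_(s < q) \sum_(t < q | (s < t)%N)
     (-1) ^+ (s + t) *: f (br (x s) (x t) :: omit x [:: s; t])
  + \sum_(s < q) (-1) ^+ s *: rho (x s) (f (omit x [:: s])).
Proof.
elim: q x f => [|q IH] x f cf.
  by rewrite /flist enum_ord0 !big_ord0 /= addr0.
rewrite flistS /= IH; last exact: cochain_ins.
have e0 := omit_ord0 x [::]; rewrite /= omit_nil in e0.
have E1 : \sum_(t < q.+1 | (@ord0 q < t)%N) (-1) ^+ (@ord0 q + t) *: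
      f (br (x ord0) (x t) :: omit x [:: ord0; t]) =
   - \sum_(t < q) (-1) ^+ t *: f (br (x ord0) (ftail x t) :: omit (ftail x) [:: t]).
  rewrite big_mkcond big_ord_recl /= add0r -sumrN; apply: eq_bigr => t _.
  rewrite add0n ffunE; have := omit_ord0 x [:: t]; rewrite /= => ->.
  by rewrite exprS mulN1r scaleNr.
have E2 : \sum_(i < q) \sum_(t < q.+1 | (fintype.lift ord0 i < t)%N)
     (-1) ^+ (fintype.lift ord0 i + t) *: f (br (x (fintype.lift ord0 i)) (x t) ::
       omit x [:: fintype.lift ord0 i; t]) =
   - \sum_(s < q) \sum_(t < q | (s < t)%N) (-1) ^+ (s + t) *:
       ins (x ord0) f (br (ftail x s) (ftail x t) :: omit (ftail x) [:: s; t]).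
  rewrite -sumrN; apply: eq_bigr => s _.
  rewrite big_mkcond big_ord_recl /= add0r -sumrN [RHS]big_mkcond.
  apply: eq_bigr => t _; rewrite /= /bump /= !add1n ltnS; case: ifP => // _.
  rewrite !ffunE; have := omit_lift x [:: s; t]; rewrite /= => ->.
  have /(congr1 (@^~ (omit (ftail x) [:: s; t]))) :=
    cochain_swap (x ord0) (br (x (fintype.lift ord0 s)) (x (fintype.lift ord0 t))) cf.
  rewrite !fctE /ins => ->.
  by rewrite addSn addnS !exprS !mulN1r opprK scalerN.
have E3 : \sum_(i < q) (-1) ^+ fintype.lift ord0 i *:
     rho (x (fintype.lift ord0 i)) (f (omit x [:: fintype.lift ord0 i]))
  = - \sum_(s < q) (-1) ^+ s *: rho (ftail x s) (ins (x ord0) f (omit (ftail x) [:: s])).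
  rewrite -sumrN; apply: eq_bigr => s _; rewrite ffunE.
  have := omit_lift x [:: s]; rewrite /= => ->.
  by rewrite exprS mulN1r scaleNr.
rewrite lieDE der_explicit // big_ord_recl [X in _ = _ + X]big_ord_recl E1 E2 E3.
by rewrite e0 expr0 scale1r; zmod.
Qed.
End ExplicitDifferential.

(** * Universal properties of exterior powers and scalar extension *)

Section QuotientLift.
Variables (K : nzRingType) (V W : lmodType K) (S : V -> Prop) (f : V -> W).
Hypothesis f_lin : forall a u v, f (a *: u + v) = a *: f u + f v.
Hypothesis f_S : forall v, S v -> f v = 0.

Definition quo_lift (x : quo_mod (span_mod S)) : W :=
  f (projT1 (cid (pi_mod_surj x))).

Lemma quo_lift_pi v : quo_lift (pi_mod (span_mod S) v) = f v.
Proof.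
have f0 : f 0 = 0.
  have := f_lin 1 0 0; rewrite !scale1r addr0 -[X in X = _]addr0.
  by move=> /addrI.
rewrite /quo_lift; case: cid => u /= /pi_modE span_vu.
(* [span_mod] quantifies over all submodules that contain the relations; the kernel of [f] is one of
   them. *)
pose N : submod V := @Submod K V (fun v => f v = 0) f0
  (fun a u v fu fv => etrans (f_lin a u v)
     (etrans (congr2 (fun x y => a *: x + y) fu fv)
        (etrans (congr1 (+%R^~ 0) (scaler0 W a)) (addr0 0)))).
have /= := span_vu N f_S; rewrite addrC -scaleN1r f_lin scaleN1r => /eqP.
by rewrite addrC subr_eq0 => /eqP.
Qed.

Lemma quo_lift_lin a x y : quo_lift (a *: x + y) = a *: quo_lift x + quo_lift y.
Proof.
have [u ->] := pi_mod_surj x; have [v ->] := pi_mod_surj y.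
by rewrite -pi_modZ -pi_modD !quo_lift_pi f_lin.
Qed.
End QuotientLift.

Lemma fglift_lin (K : nzRingType) (X : choiceType) (V : lmodType K) (f : X -> V) a D E :
  fglift f (a *: D + E) = a *: fglift f D + fglift f E.
Proof.
have fgD D' E' : fglift f (D' + E') = fglift f D' + fglift f E'.
  have fgB := lift_is_additive f.
  have fg0 : fglift f 0 = 0 by have := fgB 0 0; rewrite !subrr.
  have fgN y : fglift f (- y) = - fglift f y.
    by rewrite -[- y]add0r fgB fg0 sub0r.
  by rewrite -{1}[E']opprK fgB fgN opprK.
have fg0 : fglift f 0 = 0.
  have := fgD 0 0; rewrite addr0 -[X in X = _]addr0.
  by move=> /addrI.
have fgsum (I : Type) (r : seq I) (G : I -> {freeg X / K}) :
    fglift f (\sum_(i <- r) G i) = \sum_(i <- r) fglift f (G i).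
  exact: (big_morph _ fgD fg0).
rewrite fgD; congr (_ + _).
rewrite -{2}(freeg_sumE D) fgsum scaler_sumr.
rewrite [a *: D]/(fgscale a D) /fgscale fgsum; apply: eq_bigr => z _.
by rewrite !liftU scalerA.
Qed.

Section Restriction.
Variables (F : fieldType) (n : nat) (M : lmodType {mpoly F[n]}).
(** [M] with scalars restricted to F. The exterior power is a module over F, so maps from it to [M]
    need this second structure, which is put on a separate name. *)
Definition frestr : Type := M.
HB.instance Definition _ := GRing.Zmodule.copy frestr M.
Definition frestr_scale (c : F) (m : frestr) : frestr := (c%:MP_[n] *: (m : M)).
Fact frestr_scaleA a b m : frestr_scale a (frestr_scale b m) = frestr_scale (a * b) m.
Proof. by rewrite /frestr_scale scalerA mpolyCM. Qed.
Fact frestr_scale1 : left_id 1 frestr_scale.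
Proof. by move=> m; rewrite /frestr_scale mpolyC1 scale1r. Qed.
Fact frestr_scaleDr : right_distributive frestr_scale +%R.
Proof. by move=> a x y; apply: scalerDr. Qed.
Fact frestr_scaleDl m : {morph frestr_scale^~ m : a b / a + b}.
Proof. by move=> a b; rewrite /frestr_scale mpolyCD scalerDl. Qed.
HB.instance Definition _ := GRing.Zmodule_isLmodule.Build F frestr
  frestr_scaleA frestr_scale1 frestr_scaleDr frestr_scaleDl.
End Restriction.

Section Wedge.
Variables (F : fieldType) (V : lmodType F) (q : nat).
Implicit Types x : {ffun 'I_q -> V}.

Lemma ext_wedge_lin x i c u v : ext_wedge (ffset x i (c *: u + v)) =
  c *: ext_wedge (ffset x i u) + ext_wedge (ffset x i v).
Proof.
rewrite /ext_wedge -pi_modZ -pi_modD; apply/pi_modE => N; apply.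
exact: ExtLin.
Qed.
Lemma ext_wedge_alt x i j : i != j -> x i = x j -> ext_wedge x = 0.
Proof.
move=> ij xij; rewrite /ext_wedge -(pi_mod0 (span_mod (@ext_rel F V q))).
by apply/pi_modE => N; rewrite subr0; apply; apply: ExtAlt xij.
Qed.

Variables (A : lalgType F).
Lemma tpure_scale (a b : A) (v : V) : tpure (a * b) v = a *: tpure b v.
Proof. by rewrite /tpure -pi_modZ scalerA. Qed.
Lemma tpureE (a : A) (v : V) : tpure a v = a *: tpure 1 v.
Proof. by rewrite -tpure_scale mulr1. Qed.
Lemma tpure_lin (c : F) (u v : V) :
  tpure (1 : A) (c *: u + v) = c%:A *: tpure (1 : A) u + tpure (1 : A) v.
Proof.
rewrite /tpure !scale1r -pi_modZ -pi_modD; apply/pi_modE => N; apply.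
exact: TensLin.
Qed.
Lemma tpure0 : tpure (1 : A) (0 : V) = 0.
Proof.
have := tpure_lin (-1) 0 0.
by rewrite scaleN1r oppr0 addr0 scaleN1r scaleN1r addNr.
Qed.
End Wedge.

Lemma freegU_scale (K : nzRingType) (X : choiceType) (a : K) (x : X) :
  << a *g x >> = a *: << x >> :> {freeg X / K}.
Proof. by apply/eqP/freeg_eqP => y; rewrite coeffZ !coeffU mul1r. Qed.

Section CEBridge.
Variables (F : fieldType) (n : nat) (g : lie_subalg F n) (M : lcmod g).
Local Notation R := {mpoly F[n]}.
Local Notation L := (lie_elt g).
Local Notation iota := (mpolyC n (R := F)).
Variable q : nat.
Implicit Types u : CE M q.

Lemma CEP u : CE_mem (val u). Proof. exact: (elimT (smembP _ _) (valP u)). Qed.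

Lemma CE_D u x y : val u (x + y) = val u x + val u y.
Proof. by have := CEP u 1 x y; rewrite !scale1r. Qed.
Lemma CE_0 u : val u 0 = 0.
Proof. by apply: (addrI (val u 0)); rewrite -CE_D !addr0. Qed.
Lemma CE_Z u a x : val u (a *: x) = a *: val u x.
Proof. by have := CEP u a x 0; rewrite CE_0 !addr0. Qed.

Definition ce_list u : seq L -> M := lform (fun x : {ffun 'I_q -> L} => val u (tpure 1 (ext_wedge x))).

Lemma coch_ce u : coch q (ce_list u).
Proof.
split; last exact: supp_lform.
apply: cochain_lform => [x i c y z|x i j ij xij].
  by rewrite ext_wedge_lin tpure_lin CEP alg_mpolyC.
by rewrite (ext_wedge_alt ij xij) tpure0 CE_0.
Qed.

Lemma ce_list_comb (a : R) u v :
  ce_list (a *: u + v) = omega a *: ce_list u + ce_list v.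
Proof.
apply/funext => s; rewrite !fctE /ce_list /lform; case: ifP => _; last by rewrite scaler0 addr0.
by [].
Qed.

Lemma ext_pow_ind (P : ext_pow L q -> Prop) :
  (forall x : {ffun 'I_q -> L}, P (ext_wedge x)) ->
  (forall (c : F) w w', P w -> P w' -> P (c *: w + w')) -> P 0 -> forall w, P w.
Proof.
move=> Pw Pl P0 w; have [D ->] := pi_mod_surj w.
rewrite -(freeg_sumE D).
elim: (dom D) => [|z r IH]; first (rewrite big_nil pi_mod0; exact: P0).
rewrite big_cons freegU_scale pi_modD pi_modZ; apply: Pl; [exact: Pw|exact: IH].
Qed.

Lemma tens_ind (P : CE_dom g q -> Prop) : (forall w, P (tpure 1 w)) ->
  (forall (a : R) x y, P x -> P y -> P (a *: x + y)) -> P 0 -> forall x, P x.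
Proof.
move=> Pw Pl P0 x; have [D ->] := pi_mod_surj x.
rewrite -(freeg_sumE D).
elim: (dom D) => [|z r IH]; first (rewrite big_nil pi_mod0; exact: P0).
rewrite big_cons freegU_scale pi_modD pi_modZ; apply: Pl => //.
by have := Pw z; rewrite /tpure scale1r.
Qed.

Lemma CE_ext u v : (forall x, val u (tpure 1 (ext_wedge x)) = val v (tpure 1 (ext_wedge x))) ->
  u = v.
Proof.
move=> uv; apply: val_inj; apply/funext; apply: tens_ind => [w|a x y ex ey|].
- move: w; apply: ext_pow_ind => [//|c w w' ew ew'|].
    by rewrite tpure_lin !CE_D !CE_Z ew ew'.
  by rewrite tpure0 !CE_0.
- by rewrite !CE_D !CE_Z ex ey.
- by rewrite !CE_0.
Qed.

Lemma ce_listE u x : val u (tpure 1 (ext_wedge x)) = ce_list u (flist x).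
Proof. by rewrite /ce_list lform_flist. Qed.

Lemma ce_list_inj : injective ce_list.
Proof. by move=> u v uv; apply: CE_ext => x; rewrite !ce_listE uv. Qed.

(** Three universal properties in succession: the free F-module on tuples ([G0]), its quotient the
    exterior power ([G1]), and the extension of scalars to R as a quotient of a free R-module ([G2],
    [G3]). *)
Lemma ce_list_surj f : coch q f -> exists u, ce_list u = f.
Proof.
move=> [cf sf].
pose G0 (D : {freeg {ffun 'I_q -> L} / F}) : frestr M :=
  fglift (fun x : {ffun 'I_q -> L} => f (flist x) : frestr M) D.
have G0S D : @ext_rel F L q D -> G0 D = 0.
  case=> [x i c y z|x i j ij xij].
    rewrite /G0 addrC -scaleN1r fglift_lin fglift_lin !liftU !scale1r.
    rewrite (flist_lin _ _ _ _ _ cf) scaleN1r; exact: addNr.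
  by rewrite /G0 liftU scale1r; apply: (flist_alt cf ij xij).
pose G1 := quo_lift (S := @ext_rel F L q) G0.
have G0l a D E : G0 (a *: D + E) = a *: G0 D + G0 E by apply: fglift_lin.
have G1l := quo_lift_lin G0l G0S.
pose G2 (D : {freeg (ext_pow L q) / R}) : M := fglift (fun w => G1 w : M) D.
have G2l a D E : G2 (a *: D + E) = a *: G2 D + G2 E by apply: fglift_lin.
have G2S D : @tens_rel F R (ext_pow L q) D -> G2 D = 0.
  case=> c w w'; rewrite /G2 addrC -scaleN1r fglift_lin fglift_lin !liftU !scale1r.
  have -> : G1 (c *: w + w') = c *: G1 w + G1 w' by exact: G1l.
  rewrite alg_mpolyC scaleN1r; exact: addNr.
pose G3 : umap (CE_dom g q) M := quo_lift (S := @tens_rel F R (ext_pow L q)) G2.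
have G3C : CE_mem G3 by apply: quo_lift_lin.
pose u : CE M q := exist (fun x => x \in smemb (Submod (@CE_mem0 _ _ g M q) (@CE_memP _ _ g M q))) G3
  (introT (smembP (Submod (@CE_mem0 _ _ g M q) (@CE_memP _ _ g M q)) G3) G3C).
exists u; apply: (lform_eq sf) => x; rewrite /= /G3 /tpure scale1r quo_lift_pi // /G2 liftU scale1r.
by rewrite /G1 quo_lift_pi // /G0 liftU scale1r.
Qed.
End CEBridge.

Section CEDiff.
Variables (F : fieldType) (n : nat) (g : lie_subalg F n) (M : lcmod g) (q : nat).
Local Notation R := {mpoly F[n]}.
Local Notation L := (lie_elt g).

Lemma CE_formulaE (u : CE M q) (r : R) (x : {ffun 'I_q.+1 -> L}) :
  CE_formula (val u) r x = r *: cd (ce_list u) (flist x).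
Proof.
have [cu _] := coch_ce u.
have gen s : size s = q -> val u (CE_gen q r s) = r *: ce_list u s.
  by move=> sq; rewrite /CE_gen tpureE CE_Z /ce_list /lform sq eqxx.
have gen1 s : size s = q -> val u (CE_gen q 1 s) = ce_list u s.
  by move=> sq; rewrite /CE_gen /ce_list /lform sq eqxx.
rewrite /CE_formula /cd cdf_explicit // scalerDr !scaler_sumr; congr (_ + _).
  apply: eq_bigr => s _; rewrite scaler_sumr; apply: eq_bigr => t st.
  by rewrite gen ?scalerA 1?mulrC //= size_omit2.
by apply: eq_bigr => s _; rewrite gen1 ?size_omit1 // scalerA mulrC -scalerA.
Qed.

Lemma CE_diffE (u : CE M q) (v : CE M q.+1) :
  CE_diff u v <-> cd (ce_list u) = ce_list v.
Proof.
have [_ su] := coch_cd (coch_ce u); have [_ sv] := coch_ce v.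
split=> [uv|uv r x].
  apply/funext => s; have [sq|sq] := eqVneq (size s) q.+1; last by rewrite su // sv.
  rewrite -(lfunK sq) -ce_listE uv CE_formulaE scale1r //.
by rewrite CE_formulaE tpureE CE_Z ce_listE uv.
Qed.
End CEDiff.

Section CohomologyComparison.
Variables (F : fieldType) (n : nat) (g : lie_subalg F n).
Hypothesis char0 : [pchar F] =i pred0.
Variables (M : lcmod g) (I : injres M).
Local Notation R := {mpoly F[n]}.

Definition zig_class q (a : RGamma I q) (b : coh (CE_complex M) q) : Prop :=
  exists z u, [/\ @coh_class _ (Gamma_complex I) q z a,
    @coh_class _ (CE_complex M) q u b & zig (ce_list u) 0 (gam_list z)].

Lemma cocycle_CE q (u : CE M q) : @is_cocycle _ (CE_complex M) q u <-> cocyc q (ce_list u).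
Proof.
have c0 : ce_list (0 : CE M q.+1) = 0.
  by apply/funext => s; rewrite /ce_list /lform; case: ifP.
have E := CE_diffE u 0; rewrite c0 in E.
by split=> [/E du|[_ /E]] //; split => //; apply: coch_ce.
Qed.

Lemma coboundary_CE q (u : CE M q) :
  @is_coboundary _ (CE_complex M) q u <-> exactC q (ce_list u).
Proof.
have c0 k : ce_list (0 : CE M k) = 0.
  by apply/funext => s; rewrite /ce_list /lform; case: ifP.
case: q u => [|q] u /=.
  by split=> [->//|]; rewrite -(c0 0%N) => /ce_list_inj.
split=> [[w /CE_diffE wu]|[b cb bu]]; first by exists (ce_list w) => //; apply: coch_ce.
have [w wb] := ce_list_surj cb; exists w; apply/CE_diffE; by rewrite wb.
Qed.

Lemma gam_list0 (N : lcmod g) : gam_list (0 : Gamma N) = 0.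
Proof. by apply/funext => -[]. Qed.

Lemma cocycle_Gamma q (z : Gamma (I q)) :
  @is_cocycle _ (Gamma_complex I) q z <-> bicyc (I := I) 0 (gam_list z).
Proof.
have E := gam_list_diff z 0; rewrite gam_list0 in E.
by split=> [/E dz|[_ _ /E]] //; split=> //; [exact: coch_gam|exact: cd_gam].
Qed.

Lemma coboundary_Gamma q (z : Gamma (I q)) :
  @is_coboundary _ (Gamma_complex I) q z <-> trivH (I := I) 0 (gam_list z).
Proof.
case: q z => [|q] z /=.
  split=> [->|]; first exact: gam_list0.
  by rewrite -(gam_list0 (I 0%N)) => /gam_list_inj.
split=> [[w /gam_list_diff wz]|[w [cw dw wz]]].
  by exists (gam_list w); split=> //; [exact: coch_gam|exact: cd_gam].
have [y yw] := gam_list_surj cw dw; exists y; apply/gam_list_diff.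
by rewrite yw.
Qed.

Lemma zig_trivial q a (y : seq (lie_elt g) -> I q) : zig (I := I) a 0 y ->
  (trivH (I := I) 0 y <-> exactC q a).
Proof.
case: q y => [|q] y zy; last by have [_ ->] := zig_triv char0 zy.
(* In degree 0 the staircase has no steps, and only injectivity of the augmentation is used. *)
rewrite /= in zy *; rewrite zy -(lc_push0 (ir_aug_hom I)).
by split=> [/(push_inj (@ir_aug_inj _ _ _ _ I))|->].
Qed.

Lemma zig_class_comb q c a a' b b' : @zig_class q a b -> @zig_class q a' b' ->
  zig_class (c *: a + a') (c *: b + b').
Proof.
move=> [z [u [za ub zz]]] [z' [u' [za' ub' zz']]].
exists (c *: z + z'), (c *: u + u'); split; try exact: coh_class_comb.
(* Under the unity action a polynomial acts by its constant term, so combinations with scalars from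
   F suffice. *)
by rewrite ce_list_comb gam_list_comb !omegaE; apply: zig_comb.
Qed.

Lemma zig_class_iso q : exists phi : RGamma I q -> coh (CE_complex M) q,
  [/\ bijective phi, forall a, zig_class a (phi a),
     forall a b, zig_class a b -> b = phi a &
     forall c a a', phi (c *: a + a') = c *: phi a + phi a'].
Proof.
apply: (@linear_relation_iso _ _ R (fun c a => c *: a) (fun c b => c *: b) (-1)).
- exact: scaleN1r.
- exact: scaleN1r.
- by move=> *; apply: zig_class_comb.
- move=> a; have [z za] := coh_class_ex a.
  have bz := (cocycle_Gamma z).1 (coh_class_cocycle za).
  have [f cf zf] := zig_right bz; have [ccf _] := cf.
  have [u uf] := ce_list_surj ccf.
  have [|b ub] := @cocycle_class _ (CE_complex M) q u; first by apply/cocycle_CE; rewrite uf.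
  by exists b, z, u; rewrite uf.
- move=> b; have [u ub] := coh_class_ex b.
  have cu := (cocycle_CE u).1 (coh_class_cocycle ub).
  have [y zy] := zig_left char0 (p := 0) I cu; have [cy dy ddy] := zig_bicyc (p := 0) cu zy.
  have [z zE] := gam_list_surj cy dy.
  have [|a za] := @cocycle_class _ (Gamma_complex I) q z.
    by apply/cocycle_Gamma; rewrite zE.
  by exists a, z, u; rewrite zE.
- move=> a b [z [u [za ub zu]]].
  rewrite (coh_class_eq0 za) (coh_class_eq0 ub) coboundary_CE coboundary_Gamma.
  exact: zig_trivial.
Qed.

Lemma RGamma_CE q : exists phi : {linear RGamma I q -> coh (CE_complex M) q}, bijective phi.
Proof.
have [phi [bij _ _ lin]] := zig_class_iso q.
pose mx := GRing.isLinear.Build R (RGamma I q) (coh (CE_complex M) q) _ phi lin.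
pose f : {linear RGamma I q -> coh (CE_complex M) q} := HB.pack phi mx.
by exists f.
Qed.
End CohomologyComparison.

(** * Restriction of cochains of W(n) to gl(n) *)

Section PolyCoeff.
Variables (F : fieldType) (n : nat).
Local Notation R := {mpoly F[n]}.

Lemma mcoeffMX_le (p : R) b c : (b <= c)%MM -> (p * 'X_[b])@_c = p@_(c - b).
Proof. by move=> bc; rewrite -{1}(submK bc) addmC mcoeffMX. Qed.

Lemma mcoeffMX_nle (p : R) b c : ~~ (b <= c)%MM -> (p * 'X_[b])@_c = 0.
Proof.
move=> bc; rewrite {1}[p]mpolyE mulr_suml raddf_sum big1 // => m _ /=.
rewrite -scalerAl -mpolyXD mcoeffZ mcoeffX; case: eqP => [e|_]; last by rewrite mulr0.
by move: bc; rewrite -e lem_addl.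
Qed.

Lemma mdeg_sub (b c : 'X_{1..n}) : (b <= c)%MM -> (mdeg (c - b)%MM + mdeg b = mdeg c)%N.
Proof. by move=> bc; rewrite -mdegD submK. Qed.

Lemma mcoeff_mulX_eq0 (p : R) (b c : 'X_{1..n}) :
  (forall c' : 'X_{1..n}, (mdeg c' + mdeg b = mdeg c)%N -> p@_c' = 0) -> ('X_[b] * p)@_c = 0.
Proof.
move=> p0; rewrite mulrC; have [bc|bc] := boolP (b <= c)%MM.
  by rewrite mcoeffMX_le // p0 // mdeg_sub.
exact: mcoeffMX_nle.
Qed.

Lemma mnm_le1 i (b : 'X_{1..n}) : (U_(i) <= b)%MM = (0 < b i)%N.
Proof.
apply/mnm_lepP/idP => [/(_ i)|bi j]; rewrite mnm1E ?eqxx //.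
by case: eqP => [<-|].
Qed.

Lemma mcoeff_euler (p : R) c : (\sum_i 'X_i * p^`M(i))@_c = (mdeg c)%:R * p@_c.
Proof.
have XE m : \sum_(i < n) 'X_i * ('X_[m])^`M(i) = (mdeg m)%:R *: 'X_[m] :> R.
  rewrite mdegE natr_sum scaler_suml; apply: eq_bigr => i _.
  rewrite mderivX -scalerAr -mpolyXD; have [mi|mi] := posnP (m i).
    by rewrite mi !scale0r.
  by rewrite addmC submK // mnm_le1.
rewrite {1}[p]mpolyE.
have -> : \sum_i 'X_i * (\sum_(m <- msupp p) p@_m *: 'X_[m])^`M(i) =
    \sum_(m <- msupp p) p@_m *: ((mdeg m)%:R *: 'X_[m]) :> R.
  under eq_bigr => i _ do rewrite raddf_sum mulr_sumr.
  rewrite exchange_big; apply: eq_bigr => m _ /=.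
  rewrite -XE scaler_sumr; apply: eq_bigr => i _.
  by rewrite mderivZ -scalerAr.
rewrite [in RHS](mpolyE p) !(raddf_sum (mcoeff c)) mulr_sumr; apply: eq_bigr => m _ /=.
rewrite !mcoeffZ mcoeffX; case: eqP => [->|_]; last by rewrite !mulr0.
by rewrite !mulr1 mulrC.
Qed.

Lemma vf_actX (X : {ffun 'I_n -> R}) i : vf_act X 'X_i = X i.
Proof.
rewrite /vf_act (bigD1 i) //= mderivX mnm1E eqxx scale1r big1 => [|j ji].
  have -> : (U_(i) - U_(i))%MM = 0%MM :> 'X_{1..n} by apply/mnmP => k; rewrite !mnmE subnn.
  by rewrite mpolyX0 mulr1 addr0.
by rewrite mderivX mnm1E eq_sym (negPf ji) scale0r mulr0.
Qed.
End PolyCoeff.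

Fact qlap_key : unit. Proof. exact: tt. Qed.

Section WittFields.
Variables (F : fieldType) (n : nat).
Local Notation R := {mpoly F[n]}.
Local Notation iota := (mpolyC n (R := F)).
Local Notation L := (lie_elt (W_alg F n)).
Local Notation br := (lie_elt_bracket (W_alg F n)).
Implicit Types (X Y : L) (b c : 'X_{1..n}).

Definition toW (X : vf F n) : L :=
  exist (fun Z => Z \in smemb (W_alg F n)) X (introT (smembP (W_alg F n) X) I).
Definition cmp X (j : 'I_n) : R := (val X : {ffun 'I_n -> R}) j.

Lemma W_ext X Y : (forall j, cmp X j = cmp Y j) -> X = Y.
Proof. by move=> XY; apply: val_inj; apply: vf_ext. Qed.
Lemma cmp_toW (X : vf F n) j : cmp (toW X) j = (X : {ffun 'I_n -> R}) j. Proof. by []. Qed.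
Lemma cmpD X Y j : cmp (X + Y) j = cmp X j + cmp Y j. Proof. by rewrite /cmp ffunE. Qed.
Lemma cmpZ a X j : cmp (a *: X) j = a *: cmp X j. Proof. by rewrite /cmp ffunE. Qed.
Lemma cmp_br X Y j : cmp (br X Y) j = lie_act X (cmp Y j) - lie_act Y (cmp X j).
Proof. by rewrite /cmp ffunE. Qed.
Lemma cmp_sum (J : Type) (r : seq J) (G : J -> L) j :
  cmp (\sum_(k <- r) G k) j = \sum_(k <- r) cmp (G k) j.
Proof.
elim: r => [|k r IH]; first by rewrite !big_nil /cmp ffunE.
by rewrite !big_cons cmpD IH.
Qed.
Lemma lie_actE X f : lie_act X f = \sum_i cmp X i * f^`M(i). Proof. by []. Qed.

Definition mf b (j : 'I_n) : L := toW (vf_single 'X_[b] j).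
(** The constant field along the j-th coordinate, not a differential form. *)
Definition dx (j : 'I_n) : L := mf 0%MM j.
Definition euler : L := toW [ffun i => 'X_i].

Lemma cmp_mf b j k : cmp (mf b j) k = if k == j then 'X_[b] else 0.
Proof. by rewrite /cmp ffunE. Qed.

Lemma act_mf b j f : lie_act (mf b j) f = 'X_[b] * f^`M(j).
Proof.
rewrite lie_actE (bigD1 j) //= cmp_mf eqxx big1 ?addr0 // => i /negPf ij.
by rewrite cmp_mf ij mul0r.
Qed.

Lemma act_euler f c : (lie_act euler f)@_c = (mdeg c)%:R * f@_c.
Proof.
rewrite lie_actE -mcoeff_euler; congr (_@_c); apply: eq_bigr => i _.
by rewrite cmp_toW ffunE.
Qed.

Lemma act_eulerX b : lie_act euler 'X_[b] = (mdeg b)%:R *: 'X_[b].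
Proof.
apply/mpolyP => c; rewrite act_euler mcoeffZ mcoeffX.
by case: eqP => [->|_]; rewrite ?mulr0.
Qed.

Lemma br_euler b j : br euler (mf b j) = ((mdeg b)%:R - 1) *: mf b j.
Proof.
apply: W_ext => k; rewrite cmp_br cmpZ !cmp_mf act_mf cmp_toW ffunE mderivX mnm1E.
case: eqP => [->|kj].
  have -> : (U_(j) - U_(j))%MM = 0%MM :> 'X_{1..n} by apply/mnmP => i; rewrite !mnmE subnn.
  by rewrite act_eulerX scale1r mpolyX0 mulr1 scalerBl scale1r.
by rewrite scale0r mulr0 subr0 scaler0 lie_actE big1 // => i _; rewrite mderiv0 mulr0.
Qed.

Lemma br_dx i b j : br (dx i) (mf b j) = (b i)%:R *: mf (b - U_(i))%MM j.
Proof.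
apply: W_ext => k; rewrite cmp_br cmpZ !cmp_mf !act_mf mpolyX0 mul1r.
have d1 : forall m, ((if k == i then 1 else 0 : R))^`M(m) = 0.
  by move=> m; case: ifP => _; rewrite ?mderiv0 // -mpolyC1 mderivC.
rewrite d1 mulr0 subr0; case: ifP => _; last by rewrite mderiv0 scaler0.
by rewrite mderivX.
Qed.

Local Notation A := (lcR (W_alg F n)).
Implicit Types a : seq L -> A.
Local Notation dA := (cd (N := A)).
Local Notation lA := (lieD (lc_rep A)).

(** Exterior multiplication by the differential of x_i, the form that sends X to X(x_i). By
    [cd_mulX] it measures how far d is from commuting with multiplication by x_i. *)
Fixpoint th i a (t : seq L) : A :=
  if t is X :: t' then (cmp X i : R) *: a t' - th i (ins X a) t' else 0.

Lemma ins_th X i a : ins X (th i a) = cmp X i *: a - th i (ins X a).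
Proof. by []. Qed.

Lemma thN i a : th i (- a) = - th i a.
Proof.
apply/funext => t; elim: t a => [|X t IH] a; first by rewrite fctN oppr0.
by rewrite fctN /= insN IH !fctN scalerN; zmod.
Qed.

Lemma lieD_mul X (f : R) a : lA X (f *: a) = f *: lA X a + lie_act X f *: a.
Proof.
apply/funext => t; rewrite !lieDE der_scale !fctE.
have e : lc_rep A X (f *: a t) = f *: lc_rep A X (a t) + lie_act X f *: a t.
  by apply/eqP; rewrite addrC -subr_eq; apply/eqP/(rho_compat X f (a t)).
by rewrite e scalerBr; zmod.
Qed.

Lemma cd_mulX i a : dA ('X_i *: a) = 'X_i *: dA a + th i a.
Proof.
apply/funext => t; elim: t a => [|X t IH] a.
  by rewrite !fctE /cd /= scaler0 addr0.
rewrite -[LHS]/(ins X (cdf (lc_rep A) _) t) ins_cdf lieD_mul ins_scale !fctE.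
rewrite [cdf _ _ _]IH !fctE -[dA a (X :: t)]/(ins X (cdf (lc_rep A) a) t) ins_cdf !fctE.
rewrite [lie_act X _]vf_actX scalerBr -[th i a _]/(ins X (th i a) t) ins_th !fctE.
by rewrite -[cmp X i]/(val X i); zmod.
Qed.

Definition euler_half a : seq L -> A := \sum_(i < n) 'X_i *: ins (dx i) a.
Definition wsig a : seq L -> A := euler_half a + euler_half a - ins (euler : L) a.

Definition qlap := locked_with qlap_key (hlap dA wsig).
Lemma qlapE : qlap = hlap dA wsig. Proof. by rewrite /qlap unlock. Qed.

Definition qhalf a : seq L -> A := \sum_(i < n) ('X_i *: lA (dx i) a + th i (ins (dx i) a)).

Lemma cd_sum (J : Type) (r : seq J) (G : J -> seq L -> A) :
  dA (\sum_(k <- r) G k) = \sum_(k <- r) dA (G k).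
Proof. exact: (big_morph _ (@cdD _ _ _ A) (@cd0 _ _ _ A)). Qed.

Lemma qlap_lie a : qlap a = qhalf a + qhalf a - lA (euler : L) a.
Proof.
have e1 : dA (euler_half a) + euler_half (dA a) = qhalf a.
  rewrite /euler_half cd_sum -big_split; apply: eq_bigr => i _ /=.
  by rewrite cd_mulX /cd ins_cdf scalerBr; zmod.
have e2 : ins (euler : L) (dA a) = lA euler a - dA (ins (euler : L) a) by exact: ins_cdf.
by rewrite qlapE /hlap /wsig cdB cdD -e1 e2; zmod.
Qed.

(** The commutator of [qhalf] with contraction by [X]; it enters [qlap_cons] twice because [wsig]
    contains [euler_half] twice. *)
Definition qrest X a : seq L -> A :=
  \sum_(i < n) (cmp X i *: ins (dx i) a - 'X_i *: ins (br (dx i) X) a).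

Lemma ins_sum X (J : Type) (r : seq J) (G : J -> seq L -> A) :
  ins X (\sum_(k <- r) G k) = \sum_(k <- r) ins X (G k).
Proof. exact: (big_morph _ (insD X) (ins0 _ X)). Qed.

Lemma qlap_cons X a : cochain iota a ->
  ins X (qlap a) = qlap (ins X a) + (qrest X a + qrest X a) + ins (br euler X) a.
Proof.
move=> ca; have e1 : ins X (qhalf a) = qhalf (ins X a) + qrest X a.
  rewrite /qhalf /qrest ins_sum -big_split; apply: eq_bigr => i _ /=.
  rewrite insD ins_th ins_scale ins_lieD (cochain_swap X _ ca) thN scalerBr; zmod.
by rewrite !qlap_lie insB insD e1 ins_lieD; zmod.
Qed.

Lemma qrest_mf b j a : multilin iota a -> qrest (mf b j) a =
  'X_[b] *: ins (dx j) a - \sum_(i < n) iota (b i)%:R *: ('X_i *: ins (mf (b - U_(i))%MM j) a).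
Proof.
move=> la; rewrite /qrest sumrB; congr (_ - _).
  rewrite (bigD1 j) //= cmp_mf eqxx big1 ?addr0 // => i /negPf ij.
  by rewrite cmp_mf ij scale0r.
apply: eq_bigr => i _; rewrite br_dx (multilin_consZ _ _ la) !scalerA.
by rewrite mulrC.
Qed.

Lemma qlap_nil a c : (qlap a [::] : R)@_c = (mdeg c)%:R * (a [::] : R)@_c.
Proof.
have sumE (G : 'I_n -> seq L -> A) t : (\sum_(i < n) G i) t = \sum_(i < n) G i t.
  by rewrite fct_sumE.
have e1 : qhalf a [::] = lie_act euler (a [::] : R).
  rewrite /qhalf sumE lie_actE; apply: eq_bigr => i _.
  rewrite !fctE /= addr0 lieD_nil cmp_toW ffunE.
  have -> : lc_rep A (dx i) (a [::]) = 'X_[0] * (a [::] : R)^`M(i) by exact: act_mf.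
  by rewrite mpolyX0 mul1r.
rewrite qlap_lie !fctE e1 lieD_nil.
have -> : lc_rep A (euler : L) (a [::]) = lie_act euler (a [::] : R) by [].
by rewrite addrK act_euler.
Qed.
End WittFields.

Section GlRestriction.
Variables (F : fieldType) (n : nat).
Local Notation R := {mpoly F[n]}.
Local Notation iota := (mpolyC n (R := F)).
Local Notation L := (lie_elt (W_alg F n)).
Local Notation br := (lie_elt_bracket (W_alg F n)).
Local Notation A := (lcR (W_alg F n)).
Local Notation gl := 'M[F]_n.

Definition gl_bracket : lie_bracket gl.
refine (@LieBracket _ _ (@gl_br F n) _ _ _ _).
- move=> x c y z; rewrite /gl_br mulmxDr mulmxDl -scalemxAl -scalemxAr scalerBr; zmod.
- move=> x c y z; rewrite /gl_br mulmxDr mulmxDl -scalemxAl -scalemxAr scalerBr; zmod.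
- by move=> x; rewrite /gl_br subrr.
- move=> x y z; rewrite /gl_br !mulmxBr !mulmxBl !mulmxA; zmod.
Defined.

Definition idF : {rmorphism F -> F} := idfun.
Definition gl_rep : lie_rep gl_bracket idF F^o.
refine (@LieRep _ _ _ _ _ _ (fun _ _ => 0) _ _ _).
- by move=> *; rewrite scaler0 addr0.
- by move=> *; rewrite scaler0 addr0.
- by move=> *; rewrite subr0.
Defined.

(** The elementary matrix E_ij goes to the field x_i d_j. With the transposed convention, brackets
    would change sign. *)
Definition hat (a : gl) : L := toW [ffun j => \sum_i a i j *: 'X_i].

Lemma cmp_hat a j : cmp (hat a) j = \sum_i a i j *: 'X_i :> R.
Proof. by rewrite cmp_toW ffunE. Qed.

Lemma hat_lin c a b : hat (c *: a + b) = c *: hat a + hat b.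
Proof.
apply: W_ext => j; rewrite cmpD cmpZ !cmp_hat scaler_sumr -big_split.
by apply: eq_bigr => i _; rewrite !mxE scalerDl scalerA.
Qed.

Lemma act_hatX a i : lie_act (hat a) 'X_i = \sum_k a k i *: 'X_k.
Proof. by rewrite [LHS]vf_actX ffunE. Qed.

Lemma hat_br a b : hat (gl_br a b) = br (hat a) (hat b).
Proof.
have e (u v : gl) j : lie_act (hat u) (\sum_i v i j *: 'X_i) = \sum_k (u *m v) k j *: 'X_k :> R.
  rewrite /lie_act vf_act_sum.
  under eq_bigr => i _ do rewrite vf_actZr [vf_act _ _]act_hatX scaler_sumr.
  rewrite exchange_big; apply: eq_bigr => k _; rewrite mxE scaler_suml.
  by apply: eq_bigr => i _; rewrite scalerA mulrC.
apply: W_ext => j; rewrite cmp_br !cmp_hat !e -sumrB; apply: eq_bigr => k _.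
by rewrite -scalerBl /gl_br !mxE.
Qed.

Definition ev0 (p : R^o) : F^o := (p : R)@_0%MM.

Lemma ev0_lin c (p q : R^o) : ev0 (iota c *: p + q) = idF c *: ev0 p + ev0 q.
Proof. by rewrite /ev0 mcoeffD [iota c *: p]/(iota c * p : R) mcoeffCM. Qed.

Lemma ev0M (p q : R) : (p * q)@_0%MM = p@_0%MM * q@_0%MM.
Proof. exact: (rmorphM (mcoeff 0%MM)). Qed.

Lemma ev0_X i : ('X_i : R)@_0%MM = 0.
Proof. by rewrite mcoeffX; case: eqP => // /eqP; rewrite mnm1_eq0. Qed.

(** A linear field vanishes at the origin, so evaluation there is equivariant for the trivial
    action. *)
Lemma ev0_act a (p : A) : ev0 (lc_rep A (hat a) p) = gl_rep a (ev0 p).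
Proof.
have -> : lc_rep A (hat a) p = \sum_j cmp (hat a) j * (p : R)^`M(j) by [].
rewrite /ev0 raddf_sum big1 // => j _ /=; rewrite ev0M cmp_hat raddf_sum big1 ?mul0r // => i _.
by rewrite /= mcoeffZ ev0_X mulr0.
Qed.

Definition res (a : seq L -> A) : seq gl -> F^o := pull hat ev0 a.

Definition linpart (X : L) : gl := \matrix_(i, j) (cmp X j)@_U_(i).

Lemma linpart_lin c X Y : linpart (c *: X + Y) = c *: linpart X + linpart Y.
Proof. by apply/matrixP => i j; rewrite !mxE cmpD cmpZ mcoeffD mcoeffZ. Qed.

Lemma linpart_hat a : linpart (hat a) = a.
Proof.
apply/matrixP => i j; rewrite mxE cmp_hat raddf_sum (bigD1 i) //= mcoeffZ mcoeffXU eqxx.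
rewrite mulr1 big1 ?addr0 // => k ki.
by rewrite mcoeffZ mcoeffXU (negPf ki) mulr0.
Qed.

(** A section of [res] on cochains. Taking linear parts is not a homomorphism on W(n), as the
    bracket of a constant and a quadratic field is linear; the extension of a cocycle need not be
    closed. *)
Definition glext (c : seq gl -> F^o) : seq L -> A := pull linpart (fun x : F^o => iota x : R^o) c.

Lemma res_glext c : res (glext c) = c.
Proof.
apply/funext => s; rewrite /res /glext /pull -map_comp /ev0 mcoeffC eqxx mulr1.
by rewrite map_id_in // => a _ /=; rewrite linpart_hat.
Qed.

Lemma glext_lin (c : F) (u v : F^o) : (iota (idF c *: u + v) : R^o) = iota c *: (iota u : R^o) + iota v.
Proof. by rewrite mpolyCD mpolyCM. Qed.

Lemma coch_glext q c : cochain idF c -> supp q c -> coch q (glext c).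
Proof.
move=> cc sc; split; first exact: (cochain_pull linpart_lin glext_lin cc).
exact: (supp_pull linpart glext_lin sc).
Qed.

Lemma cochain_res a : cochain iota a -> cochain idF (res a).
Proof. exact: (cochain_pull hat_lin ev0_lin). Qed.
Lemma supp_res q a : supp q a -> supp q (res a).
Proof. exact: (supp_pull hat ev0_lin). Qed.
Lemma resD a b : res (a + b) = res a + res b.
Proof. exact: (pullD hat ev0_lin). Qed.
Lemma resB a b : res (a - b) = res a - res b.
Proof. exact: (pullB hat ev0_lin). Qed.
Lemma res0 : res 0 = 0.
Proof. exact: (pull0 hat ev0_lin). Qed.
Lemma resZ c a : res (iota c *: a) = c *: res a.
Proof. exact: (pullZ hat ev0_lin). Qed.
Lemma cdf_res a : cdf gl_rep (res a) = res (cd a).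
Proof.
apply: (cdf_pull (rho1 := lc_rep A)) => //; [exact: hat_br|exact: ev0_lin|exact: ev0_act].
Qed.

Definition fld (t : seq ('X_{1..n} * 'I_n)) : seq L := [seq mf F u.1 u.2 | u <- t].
(* |mdeg b - 1| *)
Definition wt (b : 'X_{1..n}) : nat := ((mdeg b).-1 + (mdeg b == 0%N))%N.
Definition wts (t : seq ('X_{1..n} * 'I_n)) : nat := \sum_(u <- t) wt u.1.

Definition rows_vanish (k : nat) (a : seq L -> A) := forall t c,
  (mdeg c + wts t < k)%N -> (a (fld t) : R)@_c = 0.

Lemma wts_cons u t : wts (u :: t) = (wt u.1 + wts t)%N.
Proof. by rewrite /wts big_cons. Qed.

Lemma qlap_fld b j t (a : seq L -> A) c : cochain iota a ->
  (qlap a (fld ((b, j) :: t)) : R)@_c =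
  (qlap (ins (mf F b j) a) (fld t) : R)@_c
  + (('X_[b] * (a (fld ((0%MM, j) :: t)) : R))@_c
     - \sum_(i < n) (b i)%:R * ('X_i * (a (fld (((b - U_(i))%MM, j) :: t)) : R))@_c) *+ 2
  + ((mdeg b)%:R - 1) * (a (fld ((b, j) :: t)) : R)@_c.
Proof.
move=> ca; have [la _] := ca.
rewrite -[qlap a _]/(ins (mf F b j) (qlap a) (fld t)) qlap_cons // br_euler.
rewrite (multilin_consZ _ _ la); set D := qrest _ a.
have eD : (D (fld t) : R)@_c =
   ('X_[b] * (a (fld ((0%MM, j) :: t)) : R))@_c -
   \sum_(i < n) (b i)%:R * ('X_i * (a (fld (((b - U_(i))%MM, j) :: t)) : R))@_c.
  rewrite /D qrest_mf // !fctE mcoeffB fct_sumE raddf_sum; congr (_ - _).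
  by apply: eq_bigr => i _; rewrite /= !fctE; apply: mcoeffCM.
rewrite !fctE 3!mcoeffD eD mulr2n; congr (_ + _ + _).
exact: mcoeffCM.
Qed.

Lemma mdeg_subU (b : 'X_{1..n}) i : b i != 0%N -> (mdeg (b - U_(i))%MM).+1 = mdeg b.
Proof.
move=> bi; rewrite -(@mdeg_sub n U_(i)%MM b) ?mdeg1 ?addn1 //.
by rewrite mnm_le1 lt0n.
Qed.

(** Consider the degree d of the first field x^b d_j. For d = 0, the first term of [qrest] returns
    the row itself; counted twice, and with -1 from [e, X], it contributes 1. For d = 1, the two
    terms of [qrest] cancel. For d >= 2, both involve only coefficients of smaller weight, and
    [e, X] contributes d - 1. *)
Lemma qlap_rows a k t c : cochain iota a -> rows_vanish k a -> (mdeg c + wts t)%N = k ->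
  (qlap a (fld t) : R)@_c = k%:R * (a (fld t) : R)@_c.
Proof.
elim: t a k => [|[b j] t IH] a k ca va ck.
  by rewrite qlap_nil -ck /wts big_nil addn0.
rewrite wts_cons /= in ck; rewrite qlap_fld //.
rewrite (IH _ (k - wt b)%N (cochain_ins _ ca)); last by lia.
  2: move=> t' c' tc'; have := va ((b, j) :: t') c'; rewrite wts_cons /=; apply; lia.
rewrite -[ins (mf F b j) a (fld t)]/(a (fld ((b, j) :: t))).
set x := (a (fld ((b, j) :: t)) : R)@_c.
have kb : (wt b <= k)%N by lia.
have [b0|b1|b2] := ltngtP (mdeg b) 1.
- have {}b0 : b = 0%MM by apply/eqP; rewrite -mdeg_eq0; lia.
  rewrite /x b0 mdeg0 mpolyX0 mul1r big1 => [|i _]; last by rewrite mnmE mul0r.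
  have -> : wt (0%MM : 'X_{1..n}) = 1%N by rewrite /wt mdeg0.
  rewrite -b0 -/x subr0 sub0r mulN1r natrB; last by move: kb; rewrite b0 /wt mdeg0.
  by rewrite mulrBl mul1r mulr2n; zmod.
- have z0 (i : 'I_n) : b i != 0%N ->
      ('X_i * (a (fld (((b - U_(i))%MM, j) :: t)) : R))@_c = 0.
    move=> bi; apply: mcoeff_mulX_eq0 => c' cc'; apply: va; rewrite wts_cons /=.
    have := mdeg_subU bi; rewrite mdeg1 in cc'; move: ck; rewrite /wt.
    lia.
  rewrite big1 => [|i _]; last first.
    by have [->|bi] := eqVneq (b i) 0%N; rewrite ?mul0r // z0 ?mulr0.
  rewrite mcoeff_mulX_eq0 => [|c' cc']; last first.
    apply: va; rewrite wts_cons /=; move: ck; rewrite /wt mdeg0; lia.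
  have wb : wt b = (mdeg b - 1)%N by rewrite /wt; lia.
  rewrite subrr mul0rn addr0 wb !natrB; [|lia|lia].
  by rewrite -mulrDl; congr (_ * _); zmod.
- have /mdeg1P[i /eqP bi] : mdeg b == 1%N by rewrite b2.
  have -> : wt b = 0%N by rewrite /wt b2.
  rewrite b2 subrr mul0r addr0 subn0 (bigD1 i) //= big1 => [|k' ki]; last first.
    by rewrite bi mnm1E eq_sym (negPf ki) mul0r.
  have -> : (b - U_(i))%MM = 0%MM by rewrite bi; apply/mnmP => l; rewrite !mnmE subnn.
  by rewrite bi mnm1E eqxx mul1r addr0 subrr mul0rn addr0.
Qed.

(* Makes the weights of the nonzero rows bounded on any given list of fields, so
   that the residuals, which vanish in ever larger weights, become 0 there. *)
Definition bounded (M A0 B : nat) (a : seq L -> A) := forall t c,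
  all (fun u => mdeg u.1 <= M)%N t ->
  (B + \sum_(u <- t) mdeg u.1 < mdeg c + size t + A0)%N -> (a (fld t) : R)@_c = 0.

(** The condition bounds deg c - sum_s (deg X_s - 1), the degree with respect to the Euler field.
    All terms of [qlap] preserve this degree, and none raises the degree of a field. In the
    induction, [A0] counts the fields already contracted and [B] takes up their degrees. *)
Lemma qlap_bounded M A0 B a : cochain iota a -> bounded M A0 B a -> bounded M A0 B (qlap a).
Proof.
move=> ca ba t; elim: t A0 B a ca ba => [|[b j] t IH] A0 B a ca ba c tM tc.
  by rewrite qlap_nil (ba [::]) ?mulr0.
move: tM tc; rewrite /= big_cons /= => /andP[bM tM] tc.
have e0 : (qlap (ins (mf F b j) a) (fld t) : R)@_c = 0.
  apply: (IH A0.+1 (B + mdeg b)%N) => //; [exact: cochain_ins| |by lia].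
  move=> t' c' tM' tc'; apply: (ba ((b, j) :: t')); rewrite /= ?bM // big_cons /=; lia.
rewrite qlap_fld // e0.
rewrite mcoeff_mulX_eq0 => [|c' cc']; last first.
  apply: ba; rewrite /= ?mdeg0 // big_cons /= mdeg0; lia.
rewrite big1 => [|i _]; last first.
  have [->|bi] := eqVneq (b i) 0%N; first by rewrite mul0r.
  have bU := mdeg_subU bi.
  rewrite mcoeff_mulX_eq0 ?mulr0 // => c' cc'; rewrite mdeg1 in cc'.
  apply: ba; rewrite /= ?big_cons /= ?tM ?andbT; lia.
rewrite subrr mul0rn !addr0 add0r (ba ((b, j) :: t)) ?mulr0 //= ?bM ?tM // big_cons /=; lia.
Qed.

Lemma euler_hat : (euler F n : L) = hat 1%:M.
Proof.
apply: W_ext => j; rewrite cmp_hat cmp_toW ffunE (bigD1 j) //= mxE eqxx scale1r.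
by rewrite big1 ?addr0 // => i ij; rewrite mxE (negPf ij) scale0r.
Qed.

Lemma cochain_sum (J : Type) (r : seq J) (G : J -> seq L -> A) :
  (forall i, cochain iota (G i)) -> cochain iota (\sum_(i <- r) G i).
Proof.
move=> cG; elim/big_ind: _ => //; [exact: cochain0|exact: cochainD].
Qed.

Lemma cochain_sig (a : seq L -> A) : cochain iota a -> cochain iota (wsig a).
Proof.
move=> ca; have ch : cochain iota (euler_half a).
  by apply: cochain_sum => i; apply/cochainZ/cochain_ins.
by apply: cochainB; [exact: cochainD|exact: cochain_ins].
Qed.

Lemma supp_sig q (a : seq L -> A) : supp q.+1 a -> supp q (wsig a).
Proof.
move=> sa; have sh : supp q (euler_half a).
  rewrite /euler_half; elim/big_ind: _ => //; first exact: suppD.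
  by move=> i _; apply/suppZ/supp_ins.
by apply: suppB; [exact: suppD|exact: supp_ins].
Qed.

Lemma sig_lin c (a b : seq L -> A) : wsig (iota c *: a + b) = iota c *: wsig a + wsig b.
Proof.
have e : euler_half (iota c *: a + b) = iota c *: euler_half a + euler_half b.
  rewrite /euler_half scaler_sumr -big_split; apply: eq_bigr => i _ /=.
  by rewrite insD scalerDr ins_scale !scalerA mulrC.
by rewrite /wsig e insD ins_scale scalerBr scalerDr; zmod.
Qed.

(** The homotopy preserves the kernel of the restriction, because the coordinates x_i vanish at 0
    and e is itself a linear field. *)
Lemma res_sig (a : seq L -> A) : res a = 0 -> res (wsig a) = 0.
Proof.
move=> ra; apply/funext => s; rewrite /res /pull /wsig !fctE.
have e0 : ev0 (euler_half a [seq hat i | i <- s]) = 0.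
  rewrite /euler_half fct_sumE /ev0 raddf_sum big1 // => i _.
  by rewrite /= fctE [RHS]/= -[0](mul0r ((ins (dx F i) a [seq hat i | i <- s] : R)@_0%MM))
    -(ev0_X i); apply: ev0M.
have e1 : ev0 (ins (euler F n : L) a [seq hat i | i <- s]) = 0.
  by rewrite euler_hat; have := congr1 (@^~ (1%:M :: s)) ra.
rewrite /ev0 mcoeffB mcoeffD -!/(ev0 _) e0.
by rewrite [X in _ - X]e1 addr0 subr0.
Qed.

Lemma evl_cd b (l : seq L -> A) : (forall t, evl (b^~ t) (l t)) ->
  forall t, evl (fun N => cd (b N) t) (cd l t).
Proof.
move=> bl t; elim: t b l bl => [|X t IH] b l bl; first exact: evl_cst.
apply: evl_sub; last by apply: IH => t'; apply: bl.
rewrite lieDE; apply: evl_ext => [N||]; [by rewrite lieDE|by []|].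
by apply: evl_sub; [exact: (evl_map (lc_rep A X))|apply: evl_der].
Qed.

Lemma evl_bigsum (J : Type) (r : seq J) (u : J -> nat -> A) l :
  (forall i, evl (u i) (l i)) -> evl (fun N => \sum_(i <- r) u i N) (\sum_(i <- r) l i).
Proof.
move=> ul; elim: r => [|i r IH].
  by apply: evl_ext (evl_cst 0) => [N|]; rewrite big_nil.
by apply: evl_ext (evl_add (ul i) IH) => [N|]; rewrite big_cons.
Qed.

Lemma evl_sig b (l : seq L -> A) : (forall t, evl (b^~ t) (l t)) ->
  forall t, evl (fun N => wsig (b N) t) (wsig l t).
Proof.
move=> bl t; have h : evl (fun N => euler_half (b N) t) (euler_half l t).
  apply: (@evl_ext _ _ (fun N => \sum_(i < n) 'X_i *: (b N) (dx F i :: t)) _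
    (\sum_(i < n) 'X_i *: l (dx F i :: t))) => [N||].
  - by rewrite /euler_half fct_sumE.
  - by rewrite /euler_half fct_sumE.
  by apply: evl_bigsum => i; apply: (evl_map (fun v : A => 'X_i *: v)); apply: bl.
by apply: evl_sub; [exact: evl_add|exact: bl].
Qed.

Hypothesis char0 : [pchar F] =i pred0.
(** Only finitely many monomial fields have degree at most [M]. *)
Lemma max_exists (h : seq ('X_{1..n} * 'I_n) -> nat) M q : exists B, forall t,
  size t = q -> all (fun u => mdeg u.1 <= M)%N t -> (h t <= B)%N.
Proof.
elim: q h => [|q IH] h; first by exists (h [::]) => -[|//] _ _.
have [Bf hB] := choice (fun u => IH (fun t => h (u :: t))).
exists (\max_(v : 'X_{1..n < M.+1} * 'I_n) Bf (bmnm v.1, v.2)).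
move=> [//|[b j] t] [tq] /= /andP[bM tM].
apply: leq_trans (hB _ _ tq tM) _.
exact: (leq_bigmax (BMultinom (bound := M.+1) (bmnm := b) bM, j)).
Qed.

Lemma bounded_exists M q (a : seq L -> A) : supp q a -> exists B, bounded M 0 B a.
Proof.
move=> sa; have [B hB] := max_exists (fun t => msize (a (fld t) : R)) M q.
exists (B + q)%N => t c tM; have [tq|tq] := eqVneq (size t) q; last first.
  by rewrite sa ?size_map // mcoeff0.
rewrite tq addn0 => lt; apply: memN_msupp_eq0; apply: msize_mdeg_ge.
apply: leq_trans (hB t tq tM) _; lia.
Qed.

Lemma fld_eq0 M q (a : seq L -> A) : multilin iota a ->
  (forall t, size t = q -> all (fun u => mdeg u.1 <= M)%N t -> a (fld t) = 0) ->
  forall s : seq L, size s = q -> all (fun X : L => [forall j, (msize (cmp X j) <= M.+1)%N]) s -> a s = 0.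
Proof.
elim: q a => [|q IH] a la a0 s; first by case: s => // _ _; apply: (a0 [::]).
case: s => [//|X s] [sq] /= /andP[XM sM].
have XE : X = \sum_j \sum_(b <- msupp (cmp X j)) (cmp X j)@_b *: mf F b j.
  apply: W_ext => k; rewrite cmp_sum (bigD1 k) //= [X in _ + X]big1 => [|j jk].
    rewrite addr0 cmp_sum [LHS]mpolyE; apply: eq_bigr => b _.
    by rewrite cmpZ cmp_mf eqxx.
  rewrite cmp_sum big1 // => b _; rewrite cmpZ cmp_mf eq_sym (negPf jk).
  by rewrite scaler0.
have insE0 : ins (0 : L) a s = 0 by rewrite (multilin_cons0 la).
rewrite -[a _]/(ins X a s) XE.
have ins_add (Y Z : L) : ins Y a s = 0 -> ins Z a s = 0 -> ins (Y + Z) a s = 0.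
  by move=> Y0 Z0; rewrite (multilin_consD _ _ la) fctE Y0 Z0 addr0.
elim/big_ind: _ => // j _; rewrite big_seq; elim/big_ind: _ => // b bX.
rewrite (multilin_consZ _ _ la) fctE (IH (ins (mf F b j) a)) ?scaler0 //.
  exact: multilin_ins.
move=> t tq tM; apply: (a0 ((b, j) :: t)); rewrite /= ?tq ?tM ?andbT //.
have := msize_mdeg_lt bX; have /forallP/(_ j) := XM; lia.
Qed.

(** The positive weights, each infinitely often. The eigenvalue 0 is avoided by working in the
    kernel of [res]. *)
Let lam (N : nat) : F := ((logn 2 N.+1).+1)%:R.

Lemma ker_res_acyclic q (a : seq L -> A) : coch q a -> cd a = 0 -> res a = 0 ->
  exists b, [/\ cochain iota b, res b = 0 & cd b = a].
Proof.
move=> [ca sa] da ra.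
pose S (u : seq L -> A) := cochain iota u /\ res u = 0.
have Scomb c u v : S u -> S v -> S (iota c *: u + v).
  move=> [cu ru] [cv rv]; split; last by rewrite resD resZ ru rv scaler0 addr0.
  by apply: cochainD => //; apply: cochainZ.
have S0 : S 0 by split; [exact: cochain0|exact: res0].
have Sd u : S u -> S (cd u).
  by move=> [cu ru]; split; [exact: cochain_cdf|rewrite -cdf_res ru cdf0].
have Ss u : S u -> S (wsig u).
  by move=> [cu ru]; split; [exact: cochain_sig|exact: res_sig].
have resN N : S (residual iota (cd (N := A)) (@wsig F n) lam a N).
  apply: (residual_S (S := S)) => //; [exact: cd_comb|by move=> c u v _ _; apply: sig_lin|].
  by move=> v [[lv _] _]; apply: cdf_cdf.
pose rs := residual iota (cd (N := A)) (@wsig F n) lam a.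
have rsS N : rs N.+1 = iota (- (lam N)^-1) *: qlap (rs N) + rs N by rewrite qlapE.
have srs N : supp q (rs N).
  elim: N => [//|N IH]; rewrite rsS; apply: suppD => //; apply: suppZ.
  rewrite qlapE; apply: suppD; last exact/supp_sig/supp_cdf.
  case: q IH {sa} => [|q] IH; last exact/supp_cdf/supp_sig.
  have -> : wsig (rs N) = 0.
    have i0 X : ins X (rs N) = 0 by apply: supp_ins0.
    rewrite /wsig i0 subr0 /euler_half big1 ?addr0 // => i _.
    by rewrite i0 scaler0.
  by rewrite cd0.
have key k : exists N0, forall N, (N0 <= N)%N -> rows_vanish k.+1 (rs N).
  elim: k => [|k [N1 IH]].
    (* A row of weight 0 is a constant term at linear monomial fields, hence a value of [res], which
       is 0 on all residuals. *)
    exists 0%N => N _ t c; rewrite ltnS leqn0 addn_eq0 => /andP[/eqP c0 w0].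
    have [_ rN] := resN N; have -> : c = 0%MM by apply/eqP; rewrite -mdeg_eq0 c0.
    have t1 u : u \in t -> exists i, u.1 = U_(i)%MM.
      move=> ut; have : (wt u.1 == 0)%N.
        by rewrite -leqn0 -(eqP w0) /wts (big_rem u) //= leq_addr.
      rewrite /wt; have [/eqP/mdeg1P[i /eqP]|] := eqVneq (mdeg u.1) 1%N; first by exists i.
      by move=> u1 u0; exfalso; lia.
    have [s ts] : exists s, fld t = [seq hat m | m <- s].
      elim: t t1 {w0} => [|[b j] t IHt] t1; first by exists [::].
      have [s e] := IHt (fun u ut => t1 u (mem_behead (s := _ :: _) ut)).
      have [i /= bi] := t1 (b, j) (mem_head _ _).
      exists (delta_mx i j :: s); rewrite /fld /= -e; congr (_ :: _).
      apply: W_ext => k; rewrite cmp_mf cmp_hat bi (bigD1 i) //= mxE eqxx /=.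
      rewrite big1 => [|i' ii]; last by rewrite mxE (negPf ii) scale0r.
      by rewrite addr0; case: eqP; rewrite ?scale1r ?scale0r.
    by rewrite ts; exact: (congr1 (@^~ s) rN).
  have [Na N1a loga] := recurrent_logn k N1.
  exists Na.+1 => N NaN t c; rewrite ltnS leq_eqVlt => /orP[/eqP tc|]; last first.
    by move=> tc; apply: (IH N) => //; apply: leq_trans N1a (ltnW NaN).
  have stepN M : (N1 <= M)%N -> (rs M.+1 (fld t) : R)@_c =
      (- (lam M)^-1) * (k.+1%:R * (rs M (fld t) : R)@_c) + (rs M (fld t) : R)@_c.
    move=> N1M; have [cM _] := resN M.
    rewrite rsS !fctE mcoeffD -(qlap_rows cM (IH M N1M) tc); congr (_ + _).
    exact: mcoeffCM.
  elim: N NaN => [//|N IHN]; rewrite leq_eqVlt => /orP[/eqP[<-]|NaN].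
    by rewrite stepN // /lam loga mulNr mulKf ?addNr ?natS_neq0.
  rewrite stepN; last exact: leq_trans N1a (ltnW NaN).
  by rewrite IHN // !mulr0 addr0.
(* [key] clears the rows up to a given weight only. On a fixed list of fields, the bound [hbN],
   uniform in N, limits the weights of nonzero rows, so clearing finitely many weights is enough. *)
have conv0 (s : seq L) : evl (fun N => rs N s) (0 s).
  have [sq|sq] := eqVneq (size s) q; last by exists 0%N => N _; rewrite srs.
  pose M := (\max_(X <- s) \max_(j < n) msize (cmp X j))%N.
  have [B hB] := bounded_exists M sa.
  have hbN N : bounded M 0 B (rs N).
    elim: N => [//|N IH] t c tM tc; have [cN _] := resN N.
    rewrite rsS !fctE mcoeffD (IH t c tM tc) addr0.
    have -> : (iota (- (lam N)^-1) *: qlap (rs N) (fld t) : R)@_c =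
      - (lam N)^-1 * (qlap (rs N) (fld t) : R)@_c by exact: mcoeffCM.
    by rewrite (qlap_bounded cN IH) ?mulr0.
  (* Where [hbN] does not apply, deg c is at most B + q M, and each of the q fields has weight at
     most M + 1. *)
  have [N0 hN] := key (B + q * M + q * M.+1)%N.
  exists N0 => N /hN rv; have [[lN _] _] := resN N.
  apply: (fld_eq0 (M := M) lN _ sq); last first.
    apply/allP => X Xs; apply/forallP => j; apply: leqW.
    apply: leq_trans (leq_bigmax_seq _ Xs isT).
    exact: (leq_bigmax j).
  move=> t tq tM; apply/mpolyP => c; rewrite mcoeff0.
  have [tc|tc] := ltnP (B + \sum_(u <- t) mdeg u.1) (mdeg c + size t + 0).
    exact: (hbN N t c tM tc).
  have sumM : (\sum_(u <- t) mdeg u.1 <= size t * M)%N.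
    elim: t tM {tq tc} => [|u t IHt] /=; first by rewrite big_nil.
    move=> /andP[uM tM]; rewrite big_cons mulSn; apply: leq_add => //; exact: IHt.
  have wtsM : (wts t <= size t * M.+1)%N.
    elim: t tM {tq tc sumM} => [|u t IHt] /=; first by rewrite /wts big_nil.
    move=> /andP[uM tM]; rewrite wts_cons mulSn; apply: leq_add; last exact: IHt.
    by rewrite /wt; lia.
  apply: (rv t c); rewrite tq in tc sumM wtsM; lia.
have [] := @local_homotopy _ _ iota _ _ _ (fun t (u : seq L -> A) => u t)
  (fun u v => @funext _ _ u v) S (cd (N := A)) (@wsig F n) Scomb S0 Sd Ss _ _ _ _ _ _ _ lam a
  (conj ca ra) da conv0.
- exact: cd_comb.
- by move=> c u v _ _; apply: sig_lin.
- by move=> v [[lv _] _]; apply: cdf_cdf.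
- by move=> b l _ _; apply: evl_cd.
- by move=> b l _ _; apply: evl_sig.
- move=> b Sb /choice[l bl]; exists l => //; split.
    split=> [s1 c x y s2|s1 x s2].
      apply: (evl_uniq (bl _)).
      have := evl_map2 (fun u v : A => iota c *: u + v) (bl (s1 ++ x :: s2)) (bl (s1 ++ y :: s2)).
      by apply: evl_ext => // N; have [[lN _] _] := Sb N; rewrite lN.
    apply: (evl_uniq (bl _)); exists 0%N => N _.
    by have [[_ aN] _] := Sb N; rewrite aN.
  apply/funext => s; apply: evl_uniq (evl_map ev0 (bl (map hat s))) _.
  exists 0%N => N _; have [_ rN] := Sb N; exact: (congr1 (@^~ s) rN).
- by move=> t c u u' v e; rewrite !fctE e.
- by move=> b [[cb rb] db] _; exists b.
Qed.
End GlRestriction.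

(** * Products *)

Section Shuffles.
Variables (F : fieldType) (V : lmodType F).
Local Open Scope group_scope.
Local Open Scope ring_scope.

(** Shuffles with the block boundary as a number [p] instead of a decomposition of the type
    ['I_(p + q)], so that letters can be removed by induction on [m]. *)
Definition shuf p m (s : 'S_m) : bool :=
  [forall i : 'I_m, forall j : 'I_m, ((i < j) && ((j < p) || (p <= i)))%N ==> (s i < s j)%N].

Definition wed p m (a h : seq V -> F^o) (x : {ffun 'I_m -> V}) : F^o :=
  \sum_(s : 'S_m | shuf p s) (-1) ^+ s *
    (a [seq x (s i) | i : 'I_m <- enum 'I_m & (i < p)%N] * h [seq x (s i) | i : 'I_m <- enum 'I_m & (p <= i)%N]).

Lemma shufP p m (s : 'S_m) : reflect
  (forall i j : 'I_m, (i < j)%N -> (j < p)%N || (p <= i)%N -> (s i < s j)%N) (shuf p s).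
Proof.
apply: (iffP forallP) => [sh i j ij pij|sh i].
  by have /forallP/(_ j)/implyP := sh i; apply; rewrite ij.
by apply/forallP => j; apply/implyP => /andP[]; apply: sh.
Qed.

Lemma lift_perm_surj m (k l : 'I_m.+1) (s : 'S_m.+1) : s k = l ->
  exists s', s = lift_perm k l s'.
Proof.
move=> sk; pose f (j : 'I_m) := odflt j (unlift l (s (fintype.lift k j))).
have fE j : fintype.lift l (f j) = s (fintype.lift k j).
  rewrite /f; case: unliftP => [j' -> //|e].
  by have := neq_lift k j; rewrite -(inj_eq (@perm_inj _ s)) e sk eqxx.
have f_inj : injective f.
  move=> i j /(congr1 (fintype.lift l)); rewrite !fE => /perm_inj; exact: lift_inj.
exists (perm f_inj); apply/permP => j.
case: (unliftP k j) => [j' ->|->]; last by rewrite lift_perm_id.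
by rewrite lift_perm_lift permE fE.
Qed.

Lemma lift_perm_inj m (k l : 'I_m.+1) : injective (@lift_perm m k l).
Proof.
move=> s s' e; apply/permP => j; apply: (@lift_inj _ l).
by rewrite -!(lift_perm_lift k) e.
Qed.

Lemma reindex_lift_perm m (k l : 'I_m.+1) (P : pred 'S_m.+1) (G : 'S_m.+1 -> F^o) :
  \sum_(s : 'S_m.+1 | (s k == l) && P s) G s = \sum_(s' : 'S_m | P (lift_perm k l s')) G (lift_perm k l s').
Proof.
pose im := [set lift_perm k l s' | s' in [set s' : 'S_m | P (lift_perm k l s')]].
rewrite (eq_bigl (mem im)) => [|s].
  rewrite big_imset /=; last by move=> s s' _ _; apply: lift_perm_inj.
  by apply: eq_bigl => s; rewrite inE.
apply/andP/imsetP => [[/eqP/lift_perm_surj[s' ->] Ps]|[s']].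
  by exists s' => //; rewrite inE.
by rewrite inE => Ps ->; rewrite lift_perm_id eqxx.
Qed.

Lemma map_enum_inj m (f g : seq 'I_m) : [seq val i | i <- f] = [seq val i | i <- g] -> f = g.
Proof. exact: (inj_map val_inj). Qed.

Lemma enum_lt_lift m (k : 'I_m.+1) :
  [seq i : 'I_m.+1 <- enum 'I_m.+1 | (i < k)%N] = [seq fintype.lift k i | i : 'I_m <- enum 'I_m & (i < k)%N].
Proof.
apply: map_enum_inj; rewrite -map_comp.
set l := [seq i : 'I_m <- enum 'I_m | (i < k)%N].
have -> : [seq (val \o fintype.lift k) i | i <- l] = [seq val i | i <- l].
  apply/eq_in_map => i; rewrite mem_filter => /andP[ik _] /=.
  by rewrite /bump leqNgt ik.
rewrite /l.
have e N : [seq val i | i : 'I_N <- enum 'I_N & (i < k)%N] = [seq i <- iota 0 N | (i < k)%N].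
  by rewrite -val_enum_ord filter_map.
rewrite !e (_ : iota 0 m.+1 = iota 0 m ++ [:: m]); last by rewrite -addn1 iotaD.
by rewrite filter_cat /= ltnNge -ltnS ltn_ord cats0.
Qed.

Lemma enum_ge_lift m (k : 'I_m.+1) :
  [seq i : 'I_m.+1 <- enum 'I_m.+1 | (k <= i)%N] = k :: [seq fintype.lift k i | i : 'I_m <- enum 'I_m & (k <= i)%N].
Proof.
apply: map_enum_inj; rewrite /= -map_comp.
set l := [seq i : 'I_m <- enum 'I_m | (k <= i)%N].
have -> : [seq (val \o fintype.lift k) i | i <- l] = [seq i.+1 | i <- [seq val i | i <- l]].
  rewrite -map_comp; apply/eq_in_map => i; rewrite mem_filter => /andP[ik _] /=.
  by rewrite /bump ik.
rewrite /l.
have e N : [seq val i | i : 'I_N <- enum 'I_N & (k <= i)%N] = [seq i <- iota 0 N | (k <= i)%N].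
  by rewrite -val_enum_ord filter_map.
have ge N : (k <= N)%N -> [seq i <- iota 0 N | (k <= i)%N] = iota k (N - k).
  move=> kN; rewrite -{1}(subnKC kN) iotaD filter_cat add0n.
  rewrite (eq_in_filter (a2 := pred0)) => [|i]; last by rewrite mem_iota /= add0n => /ltn_geF.
  rewrite filter_pred0 (eq_in_filter (a2 := predT)) ?filter_predT // => i.
  by rewrite mem_iota => /andP[-> _].
have km : (k <= m)%N by rewrite -ltnS.
rewrite !e !ge ?(leqW km) // subSn //=; congr (_ :: _).
by rewrite -(add1n k) iotaDl; apply: eq_map => i; rewrite add1n.
Qed.

Lemma shuf_lift0 p m (s : 'S_m) : shuf p.+1 (lift_perm ord0 ord0 s) = shuf p s.
Proof.
apply/shufP/shufP => sh i j ij pij.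
  by have := sh (fintype.lift ord0 i) (fintype.lift ord0 j) ij pij; rewrite !lift_perm_lift.
move: ij pij; case: (unliftP ord0 j) => [j' ->|-> //].
case: (unliftP ord0 i) => [i' ->|->] ij pij; last by rewrite lift_perm_id lift_perm_lift.
by rewrite !lift_perm_lift; apply: sh.
Qed.

Lemma shuf_liftp m (k : 'I_m.+1) (s : 'S_m) : shuf k (lift_perm k ord0 s) = shuf k s.
Proof.
apply/shufP/shufP => sh i j ij pij.
  have := sh (fintype.lift k i) (fintype.lift k j); rewrite !lift_perm_lift; apply.
    by rewrite /= /bump; lia.
  by rewrite /= /bump; lia.
move: ij pij; case: (unliftP k i) => [i' ->|->]; case: (unliftP k j) => [j' ->|->].
- rewrite !lift_perm_lift /= /bump => ij pij; apply: sh; lia.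
- rewrite /= /bump => ij pij; exfalso; lia.
- by rewrite lift_perm_id lift_perm_lift.
- by rewrite ltnn.
Qed.

(** This is the recursion of [cup], read on shuffles: the value 0 is taken at the first position of
    one of the two blocks, and removing it leaves a shuffle of one letter less. In the second block
    this position is p, which costs the sign (-1)^p. *)
Lemma wed_cup p m (a h : seq V -> F^o) (x : {ffun 'I_m -> V}) : (p <= m)%N ->
  supp p a -> supp (m - p) h -> wed p a h x = cup (K := F) a h (flist x).
Proof.
elim: m p a h x => [|m IH] p a h x pm sa sh.
  have p0 : p = 0%N by lia.
  rewrite /wed (bigD1 1%g) /=; last by apply/shufP => -[].
  rewrite big1 => [|s /andP[_ /eqP]]; last by case; apply/permP => -[].
  by rewrite odd_perm1 expr0 mul1r addr0 /flist !enum_ord0.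
have xl k (s : 'S_m) (l : seq 'I_m) :
    [seq x (lift_perm k ord0 s i) | i <- [seq fintype.lift k i | i <- l]] =
    [seq ftail x (s i) | i <- l].
  by rewrite -map_comp; apply: eq_map => i; rewrite /= lift_perm_lift ffunE.
rewrite flistS /= /wed (bigID (fun s : 'S_m.+1 => ((s^-1)%g ord0 < p)%N)) /=; congr (_ + _).
  case: p pm sa sh => [|p] pm sa sh.
    by rewrite supp_ins0 // cup0l big1 // => s; rewrite ltn0 andbF.
  rewrite (eq_bigl (fun s : 'S_m.+1 => (s ord0 == ord0) && shuf p.+1 s)) => [|s].
    rewrite reindex_lift_perm -(IH p) //; last exact: supp_ins.
    rewrite /wed; apply: eq_big => [s|s _]; first by rewrite shuf_lift0.
    rewrite odd_lift_perm /= enum_ordSl /= !filter_map /= lift_perm_id !xl.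
    by congr (_ * (a (_ :: _) * h _)).
  rewrite andbC; apply: andb_id2r => /shufP sh'.
  apply/idP/eqP => [lt|s0]; last by rewrite -s0 permK.
  have [k0|k0] := posnP ((s^-1)%g ord0); last first.
    by have := sh' ord0 _ k0; rewrite lt permKV => /(_ isT).
  by have -> : ord0 = (s^-1)%g ord0 by [apply: val_inj]; rewrite permKV; apply: val_inj; rewrite /= k0.
have [pm'|mp] := leqP p m; last first.
  have -> : ins (x ord0) h = 0.
    by apply: supp_ins0; have <- : (m.+1 - p = 0)%N by lia.
  rewrite cup0r big1 // => s /andP[_ /negP]; case.
  by apply: leq_trans (ltn_ord _) _.
pose k : 'I_m.+1 := Ordinal (pm' : (p < m.+1)%N).
rewrite (eq_bigl (fun s : 'S_m.+1 => (s k == ord0) && shuf p s)) => [|s].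
  rewrite reindex_lift_perm (sgnf_supp sa) cupZl fctE -(IH p) //; last first.
    by apply: supp_ins; have <- : (m.+1 - p = (m - p).+1)%N by lia.
  rewrite /wed scaler_sumr; apply: eq_big => [s|s _]; first exact: (shuf_liftp k).
  rewrite odd_lift_perm /= addbF (enum_lt_lift k) (enum_ge_lift k) /= lift_perm_id !xl.
  rewrite signr_addb signr_odd -mulrA.
  by [].
rewrite andbC; apply: andb_id2r => /shufP sh'; rewrite -leqNgt.
apply/idP/eqP => [le|s0]; last by rewrite -s0 permK.
have [k0|k0|k0] := ltngtP k ((s^-1)%g ord0).
- by have := sh' _ _ k0; rewrite leqnn orbT permKV => /(_ isT).
- by move: k0; rewrite /= ltnNge le.
- by have -> : k = (s^-1)%g ord0 by [apply: val_inj]; rewrite permKV.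
Qed.

Lemma enum_lshift p q :
  [seq i : 'I_(p + q) <- enum 'I_(p + q) | (i < p)%N] = [seq lshift q i | i <- enum 'I_p].
Proof.
apply: map_enum_inj; rewrite -map_comp.
have -> : [seq (val \o lshift q) i | i <- enum 'I_p] = iota 0 p.
  by rewrite -(val_enum_ord p); apply: eq_map.
have -> : [seq val i | i : 'I_(p + q) <- enum 'I_(p + q) & (i < p)%N] =
    [seq i <- iota 0 (p + q) | (i < p)%N].
  by rewrite -val_enum_ord filter_map.
rewrite iotaD filter_cat (eq_in_filter (a2 := predT)) => [|i]; last by rewrite mem_iota.
rewrite filter_predT (eq_in_filter (a2 := pred0)) ?filter_pred0 ?cats0 // => i.
by rewrite mem_iota => /andP[pi _]; rewrite ltnNge pi.
Qed.

Lemma enum_rshift p q :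
  [seq i : 'I_(p + q) <- enum 'I_(p + q) | (p <= i)%N] = [seq rshift p i | i <- enum 'I_q].
Proof.
apply: map_enum_inj; rewrite -map_comp.
have -> : [seq (val \o @rshift p q) i | i <- enum 'I_q] = iota p q.
  rewrite -[p in iota p q]addn0 iotaDl -(val_enum_ord q) -map_comp; exact: eq_map.
have -> : [seq val i | i : 'I_(p + q) <- enum 'I_(p + q) & (p <= i)%N] =
    [seq i <- iota 0 (p + q) | (p <= i)%N].
  by rewrite -val_enum_ord filter_map.
rewrite iotaD filter_cat (eq_in_filter (a2 := pred0)) => [|i]; last first.
  by rewrite mem_iota /= add0n => /ltn_geF.
rewrite filter_pred0 (eq_in_filter (a2 := predT)) ?filter_predT // => i.
by rewrite mem_iota => /andP[pi _].
Qed.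

Lemma alt_wedgeE p q (a h : seq V -> F^o) (x : {ffun 'I_(p + q) -> V}) :
  supp p a -> supp q h ->
  \sum_(s : 'S_(p + q) | is_shuffle s) (-1) ^+ s *
    (a [seq x (s (lshift q i)) | i <- enum 'I_p] * h [seq x (s (rshift p j)) | j <- enum 'I_q])
  = cup (K := F) a h (flist x).
Proof.
move=> sa sh; rewrite -(wed_cup (p := p)) ?leq_addr //; last by rewrite addKn.
rewrite /wed; apply: eq_big => [s|s _].
  apply/andP/shufP => [[/forallP sl /forallP sr] i j|sh'].
    case: (split_ordP i) => i' ->; case: (split_ordP j) => j' -> /= ij.
    - by move=> _; have /forallP/(_ j')/implyP := sl i'; apply.
    - by move=> pij; exfalso; have := ltn_ord i'; lia.
    - by exfalso; have := ltn_ord j'; lia.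
    - by move=> _; have /forallP/(_ j')/implyP := sr i'; apply; rewrite ltn_add2l in ij.
  split; apply/forallP => i; apply/forallP => j; apply/implyP => ij; apply: sh' => //=.
  - by rewrite ltn_ord.
  - by rewrite ltn_add2l.
  - by rewrite leq_addr orbT.
by rewrite enum_lshift enum_rshift -!map_comp.
Qed.
End Shuffles.

(** * Cochains and cohomology of gl(n) *)

Section GlCochains.
Variables (F : fieldType) (n : nat).
Local Notation gl := 'M[F]_n.
Local Notation dgl := (cdf (gl_rep F n)).

Definition gl_coch q (x : seq gl -> F^o) : Prop := cochain (idF F) x /\ supp q x.

Section Degree.
Variable q : nat.
Implicit Types u : gl_cochain F n q.

Definition gl_list u : seq gl -> F^o := lform (val u).

Lemma gl_listE u x : gl_list u (flist x) = val u x.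
Proof. exact: lform_flist. Qed.

Lemma coch_gl u : gl_coch q (gl_list u).
Proof.
split; last exact: supp_lform.
have [ul ua] : alt_mem (val u) := elimT (smembP _ _) (valP u).
by apply: cochain_lform => [x i c y z|//]; exact: ul.
Qed.

Lemma gl_list_comb (a : F) u v : gl_list (a *: u + v) = a *: gl_list u + gl_list v.
Proof.
apply/funext => s; rewrite !fctE /gl_list /lform; case: ifP => _; last by rewrite scaler0 addr0.
by rewrite val_sub_mod !fctE.
Qed.

Lemma gl_list0 : gl_list 0 = 0.
Proof. by apply/funext => s; rewrite /gl_list /lform; case: ifP. Qed.

Lemma gl_list_inj : injective gl_list.
Proof. by move=> u v uv; apply: val_inj; apply/funext; apply: lform_ext. Qed.

Lemma gl_list_surj f : gl_coch q f -> exists u, gl_list u = f.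
Proof.
move=> [cf sf]; pose w (x : {ffun 'I_q -> gl}) : F^o := f (flist x).
have Hw : alt_mem w.
  split=> [x i c y z|x i j ij xij]; first by rewrite /w (flist_lin _ _ _ _ _ cf).
  exact: (flist_alt cf ij xij).
pose S := Submod (@alt_mem0 F n q) (@alt_memP F n q).
pose u : gl_cochain F n q := exist (fun x => x \in smemb S) w (introT (smembP S w) Hw).
by exists u; apply: (lform_eq sf).
Qed.
End Degree.

Lemma coch_dgl q (x : seq gl -> F^o) : gl_coch q x -> gl_coch q.+1 (dgl x).
Proof. by move=> [cx sx]; split; [exact: cochain_cdf|exact: supp_cdf]. Qed.

Lemma gl_diffE q (u : gl_cochain F n q) (v : gl_cochain F n q.+1) :
  gl_diff u v <-> dgl (gl_list u) = gl_list v.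
Proof.
have [cu su] := coch_gl u; have [_ sv] := coch_gl v; have [_ sd] := coch_dgl (coch_gl u).
have key x : dgl (gl_list u) (flist x) = \sum_(s < q.+1) \sum_(t < q.+1 | (s < t)%N)
       (-1) ^+ (s + t) *
         val u [ffun i : 'I_q => (gl_br (x s) (x t) :: omit x [:: s; t])`_i].
  rewrite cdf_explicit // [X in _ + X]big1 => [|s _]; last by rewrite /= scaler0.
  rewrite addr0; apply: eq_bigr => s _; apply: eq_bigr => t st.
  by rewrite /gl_list /lform /= size_omit2 // eqxx.
split=> [uv|uv x]; last by rewrite -key uv gl_listE.
apply: esym; apply: (lform_eq sd) => x; rewrite uv key //.
Qed.

Lemma gl_wedgeE p q (u : gl_cochain F n p) (v : gl_cochain F n q) (w : gl_cochain F n (p + q)) :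
  (forall x, val w x = alt_wedge (val u) (val v) x) <-> gl_list w = cup (gl_list u) (gl_list v).
Proof.
have [_ su] := coch_gl u; have [_ sv] := coch_gl v; have [_ sw] := coch_gl w.
have key x : cup (gl_list u) (gl_list v) (flist x) = alt_wedge (val u) (val v) x.
  rewrite -(alt_wedgeE _ su sv); apply: eq_bigr => s _; rewrite -!gl_listE /flist.
  by congr (_ * (gl_list u _ * gl_list v _)); apply: eq_map => i; rewrite ffunE.
split=> [E|E x]; last by rewrite -gl_listE E key.
by apply: (lform_eq (supp_cup su sv)) => x; rewrite key E.
Qed.
End GlCochains.

Section GlCohomology.
Variables (F : fieldType) (n : nat).
Local Notation gl := 'M[F]_n.
Local Notation dgl := (cdf (gl_rep F n)).
Local Notation A := (lcR (W_alg F n)).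
Local Notation L := (lie_elt (W_alg F n)).

Definition gl_cocyc q (x : seq gl -> F^o) := gl_coch q x /\ dgl x = 0.
Definition gl_exact q (x : seq gl -> F^o) : Prop :=
  match q with 0 => x = 0 | q'.+1 => exists2 b, gl_coch q' b & dgl b = x end.

Lemma gl_cocycleE q (u : gl_cochain F n q) :
  @is_cocycle _ (gl_complex F n) q u <-> gl_cocyc q (gl_list u).
Proof.
have E := gl_diffE u 0; rewrite gl_list0 in E.
by split=> [/E du|[_ /E]] //; split => //; apply: coch_gl.
Qed.

Lemma gl_coboundaryE q (u : gl_cochain F n q) :
  @is_coboundary _ (gl_complex F n) q u <-> gl_exact q (gl_list u).
Proof.
case: q u => [|q] u /=.
  by split=> [->|]; rewrite -?(gl_list0 F n 0%N) // => /gl_list_inj.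
split=> [[w /gl_diffE wu]|[b cb bu]]; first by exists (gl_list w) => //; apply: coch_gl.
have [w wb] := gl_list_surj cb; exists w; apply/gl_diffE; by rewrite wb.
Qed.

Lemma res_trunc q (a : seq L -> A) : res (trunc q a) = trunc q (res a).
Proof.
apply/funext => s; rewrite /res /pull /trunc size_map; case: ifP => // _.
by rewrite /ev0 mcoeff0.
Qed.

Lemma gl_coch_res q (a : seq L -> A) : coch q a -> gl_coch q (res a).
Proof. by move=> [ca sa]; split; [exact: cochain_res|exact: supp_res]. Qed.

Lemma res_cocyc q (a : seq L -> A) : cocyc q a -> gl_cocyc q (res a).
Proof. by move=> [ca da]; split; [exact: gl_coch_res|rewrite cdf_res da res0]. Qed.

Hypothesis char0 : [pchar F] =i pred0.

Lemma ker_res_exact q (a : seq L -> A) : coch q.+1 a -> cd a = 0 -> res a = 0 ->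
  exists b, [/\ coch q b, res b = 0 & cd b = a].
Proof.
move=> ca da ra; have [b [cb rb db]] := ker_res_acyclic char0 ca da ra.
exists (trunc q b); split; first by split; [exact: cochain_trunc|exact: supp_trunc].
  by rewrite res_trunc rb; apply: trunc_supp.
by rewrite /cd cdf_trunc -/(cd b) db trunc_supp //; case: ca.
Qed.

(** In positive degree, extend a primitive of [res a]; the differential of the extension differs
    from a by a cocycle in the kernel of [res], which is exact. In degree 0, a cocycle in that
    kernel is a coboundary from nothing, hence 0. *)
Lemma res_exact q (a : seq L -> A) : cocyc q a -> (gl_exact q (res a) <-> exactC q a).
Proof.
case: q => [|q] [ca da] /=; split.
- move=> ra; have [b [_ _ db]] := ker_res_acyclic char0 ca da ra.
  by apply/funext => -[|X s]; [rewrite -db|case: ca => _ ->].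
- by move=> ->; rewrite res0.
- move=> [c [cc sc] dc]; have cg := coch_glext cc sc.
  have [||| b [cb _ db]] := @ker_res_exact q (a - cd (glext c)).
  + by apply: cochB => //; apply: coch_cd.
  + by rewrite cdB da (cd_cd cg) subr0.
  + by rewrite resB -cdf_res res_glext dc subrr.
  by exists (b + glext c); [exact: cochD|rewrite cdD db subrK].
- by move=> [b cb <-]; exists (res b); [exact: gl_coch_res|rewrite cdf_res].
Qed.

(** The differential of the extension of c restricts to d c = 0. Hence it is the differential of
    some b in the kernel of [res], and subtracting b closes the extension without changing its
    restriction. *)
Lemma res_surj q c : gl_cocyc q c -> exists2 a : seq L -> A, cocyc q a & res a = c.
Proof.
move=> [[cc sc] dc]; have cg := coch_glext cc sc.
have [|||b [cb rb db]] := @ker_res_exact q (cd (glext c)).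
- exact: coch_cd.
- exact: (cd_cd cg).
- by rewrite -cdf_res res_glext dc.
exists (glext c - b); last by rewrite resB rb res_glext subr0.
by split; [exact: cochB|rewrite cdB db subrr].
Qed.
End GlCohomology.

(** * Endomorphisms of the resolution and products of staircases *)

Lemma injective_extend (F : fieldType) n (g : lie_subalg F n) (P N Q J : lcmod g)
  (e : P -> N) (d : N -> Q) (f : N -> J) :
  lc_injective J -> is_lchom e -> is_lchom d -> is_lchom f ->
  (forall x, d x = 0 <-> exists m, x = e m) -> (forall x, d x = 0 -> f x = 0) ->
  exists2 h : Q -> J, is_lchom h & forall x, h (d x) = f x.
Proof.
move=> Jinj eh dh fh de fd.
pose rep (x : coker_lc eh) : N := projT1 (cid (coker_pi_surj x)).
have repE x : x = coker_pi eh (rep x) := projT2 (cid (coker_pi_surj x)).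
have key (T : lcmod g) (k : N -> T) (kh : is_lchom k) : (forall x, d x = 0 -> k x = 0) ->
    (forall v, k (rep (coker_pi eh v)) = k v) /\ is_lchom (fun x : coker_lc eh => k (rep x)).
  move=> kd; have kr v : k (rep (coker_pi eh v)) = k v.
    apply/eqP; rewrite -subr_eq0 -(lchomB kh) kd //; apply/de.
    exact/coker_piE/esym/repE.
  have [cl cX] := coker_pi_hom eh; split=> //; split=> [a u v|X v].
    by rewrite [in LHS](repE u) [in LHS](repE v) -cl kr (lchomD kh) (lchomZ kh).
  by rewrite [in LHS](repE v) -cX kr (lchom_act kh).
have [dr drh] := key _ d dh (fun _ => id); have [fr frh] := key _ f fh fd.
(* [d] embeds the cokernel of [e] into Q, and [f] descends to that cokernel; injectivity of J
   extends it to Q. *)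
have [|h hh hE] := Jinj _ _ _ _ drh _ frh.
  move=> x y /eqP; rewrite -subr_eq0 -(lchomB dh) => /eqP/de xy.
  by rewrite (repE x) (repE y); apply/coker_piE.
by exists h => // x; rewrite -dr hE fr.
Qed.

Section Comparison.
Variables (F : fieldType) (n : nat) (g : lie_subalg F n) (I : injres (lcR g)).

Lemma resolution_endo q (v : Gamma (I q)) : (forall r, ir_d (val v r) = 0) ->
  exists B : forall k, I k -> I (k + q)%N,
  [/\ forall k, is_lchom (B k), forall k (x : I k), B k.+1 (ir_d x) = ir_d (B k x) &
      forall r, B 0%N (ir_aug I r) = val v r].
Proof.
move=> dv.
(* That B_k maps cocycles to cocycles is what lets d B_k vanish on the kernel of d, and so extend to
   B_{k+1}. *)
pose inv k (B : I k -> I (k + q)%N) := is_lchom B /\ forall x, ir_d x = 0 -> ir_d (B x) = 0.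
have step k (B : {B | @inv k B}) :
    {B' : {B' | @inv k.+1 B'} | forall x, sval B' (ir_d x) = ir_d (sval B x)}.
  apply: cid; case: B => B [Bh Bd].
  have [B' B'h B'E] : exists2 B' : I k.+1 -> I (k.+1 + q)%N, is_lchom B' &
      forall x, B' (ir_d x) = ir_d (B x).
    have dB : is_lchom (fun x => ir_d (B x)) := lchom_comp (ir_d_hom I (k + q)) Bh.
    case: k B Bh Bd dB => [|k] B Bh Bd dB.
      exact: (injective_extend (@ir_inj _ _ _ _ I _) (ir_aug_hom I) (ir_d_hom I 0) dB (@ir_exact0 _ _ _ _ I)).
    exact: (injective_extend (@ir_inj _ _ _ _ I _) (ir_d_hom I k) (ir_d_hom I k.+1) dB (@ir_exact _ _ _ _ I k)).
  have i' : @inv k.+1 B'.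
    split=> // x /ir_exact[y ->]; rewrite B'E; apply/ir_exact; by exists (B y).
  by exists (exist _ B' i').
have [B0 B0h B0E] := @ir_inj _ _ _ _ I q _ _ _ _ (ir_aug_hom I) (@ir_aug_inj _ _ _ _ I) (GammaP v).
have i0 : @inv 0%N B0 by split=> // x /ir_exact0[r ->]; rewrite B0E.
pose Bs := nat_rect (fun k => {B | @inv k B}) (exist _ B0 i0) (fun k B => sval (step k B)).
exists (fun k => sval (Bs k)); split=> [k|k x|//]; first by case: (Bs k) => B [].
exact: (svalP (step k (Bs k))).
Qed.
End Comparison.

Section ZigProduct.
Variables (F : fieldType) (n : nat) (g : lie_subalg F n).
Local Notation R := {mpoly F[n]}.
Local Notation L := (lie_elt g).
Local Notation iota := (mpolyC n (R := F)).
Local Notation A := (lcR g).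

Definition rcup (N : lcmod g) (a : seq L -> A) (h : seq L -> N) : seq L -> N :=
  cup (K := R) (M := N) a h.

Lemma rcup_push (N N' : lcmod g) (f : N -> N') a h : is_lchom f ->
  lc_push f (rcup a h) = rcup a (lc_push f h).
Proof.
move=> fh; apply/funext => s; rewrite /lc_push /rcup.
elim: s a h => [|x s IH] a h /=; first exact: (lchomZ fh).
by rewrite (lchomD fh) !IH.
Qed.

Lemma coch_rcup (N : lcmod g) p q a (h : seq L -> N) : coch p a -> coch q h ->
  coch (p + q) (rcup a h).
Proof. by move=> [ca sa] [ch sh]; split; [exact: (cochain_cup ca ch)|exact: (supp_cup sa sh)]. Qed.

Lemma cd_rcup (N : lcmod g) p a (h : seq L -> N) : cocyc p a ->
  cd (rcup a h) = iota ((-1) ^+ p) *: rcup a (cd h).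
Proof.
move=> [[ca sa] da].
have compat x (k : R^o) (m : N) :
    lc_rep N x (k *: m) = lc_rep A x k *: m + k *: lc_rep N x m.
  have -> : lc_rep N x (k *: m) = rho x (k *: m) by [].
  by apply/eqP; rewrite -subr_eq; apply/eqP; exact: rho_compat.
have := cdf_cup compat a h; rewrite /rcup /cd => ->.
have -> : cdf (lc_rep A) a = 0 := da.
rewrite cup0l add0r (sgnf_supp sa) cupZl; congr (_ *: _).
by rewrite rmorphXn rmorphN1.
Qed.

Variable I : injres A.
Implicit Types (al be ga : seq L -> A).

Lemma zig_scale c p k al (y : seq L -> I k) : zig al p y ->
  zig (iota c *: al) p (iota c *: y).
Proof.
(* Since c y = (c - 1) y + y, no separate statement about the zero staircase is required. *)
move=> zy; have := zig_comb (c - 1) zy zy.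
by rewrite mpolyCB mpolyC1 !scalerBl !scale1r !subrK.
Qed.

(** Multiplication by the cocycle [al] commutes with d up to (-1)^p, and each of the k steps of the
    staircase applies d once. *)
Lemma zig_rcup p m k al be (y : seq L -> I k) : cocyc p al -> zig be m y ->
  zig (iota ((-1) ^+ (p * k)) *: rcup al be) (p + m) (rcup al y).
Proof.
move=> cal; elim: k m y => [|k IH] m y /=.
  by move=> ->; rewrite muln0 mpolyC1 scale1r (rcup_push _ _ (ir_aug_hom I)).
move=> [t [ct <- zt]]; exists (rcup al t); split.
- by have [ca _] := cal; apply: coch_rcup.
- by rewrite (rcup_push _ _ (ir_d_hom I k)).
- rewrite (cd_rcup _ cal) mulnS exprD mpolyCM -scalerA.
  by apply: zig_scale; rewrite -addnS; apply: IH.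
Qed.

(** Applying B to every step of the staircase of [al] replaces its end, the augmented [al], by the
    image under B_0; there the given staircase of [ga] takes over. *)
Lemma zig_endo q (B : forall k, I k -> I (k + q)%N) : (forall k, is_lchom (B k)) ->
  (forall k (x : I k), B k.+1 (ir_d x) = ir_d (B k x)) ->
  forall p m k al ga (y : seq L -> I k), (m + k)%N = p ->
    zig ga p (lc_push (B 0%N) (lc_push (ir_aug I) al)) -> zig al m y ->
    @zig _ _ _ _ I ga m (k + q) (lc_push (B k) y).
Proof.
move=> Bh Bd p m k al ga; elim: k m => [|k IH] m y mk zg /=.
  by move=> ->; rewrite addn0 in mk; rewrite mk.
move=> [t [ct <- zt]]; exists (lc_push (B k) t); split.
- exact: coch_push.
- by apply/funext => s; rewrite /lc_push Bd.
- by rewrite (cd_push (Bh k)); apply: IH => //; rewrite addSnnS.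
Qed.

Lemma zig_yoneda p q al be (u : Gamma (I p)) (v : Gamma (I q)) (w : Gamma (I (p + q)))
  (B : forall k, I k -> I (k + q)%N) :
  cocyc p al -> zig (I := I) al 0 (gam_list u) -> zig (I := I) be 0 (gam_list v) ->
  (forall k, is_lchom (B k)) -> (forall k (x : I k), B k.+1 (ir_d x) = ir_d (B k x)) ->
  (forall r, B 0%N (ir_aug I r) = val v r) -> (forall r, val w r = B p (val u r)) ->
  zig (I := I) (iota ((-1) ^+ (p * q)) *: rcup al be) 0 (gam_list w).
Proof.
move=> cal zu zv Bh Bd Bv wB.
have -> : gam_list w = lc_push (B p) (gam_list u).
  by apply/funext => -[|x s]; rewrite /lc_push /= ?wB // (lchom0 (Bh p)).
apply: (zig_endo Bh Bd (p := p)) zu => //.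
have -> : lc_push (B 0%N) (lc_push (ir_aug I) al) = rcup al (gam_list v).
  apply/funext => s; rewrite /lc_push Bv GammaE /rcup cup_supp0 //.
  by case: (coch_gam v).
by rewrite -[X in zig _ X](addn0 p); apply: zig_rcup.
Qed.
End ZigProduct.

Section GlCup.
Variables (F : fieldType) (n : nat).
Local Notation gl := 'M[F]_n.
Local Notation dgl := (cdf (gl_rep F n)).
Local Notation A := (lcR (W_alg F n)).
Local Notation L := (lie_elt (W_alg F n)).

Definition fcup (x y : seq gl -> F^o) : seq gl -> F^o := cup (K := F) (M := F^o) x y.

Lemma res_cup (a b : seq L -> A) : res (rcup a b) = fcup (res a) (res b).
Proof.
have ev0Z (k : {mpoly F[n]}) (u : A) : @ev0 F n (k *: u) = @ev0 F n k *: @ev0 F n u := ev0M k u.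
have ev0_sign (e : bool) (k : {mpoly F[n]}) : @ev0 F n ((-1) ^+ e * k) = (-1) ^+ e * @ev0 F n k.
  by rewrite /ev0 ev0M; case: e; rewrite ?expr1 ?expr0 ?mcoeffN ?mcoeff1 ?eqxx.
exact: (esym (pull_cup (@hat F n) (@ev0_lin F n) ev0Z ev0_sign a b)).
Qed.

Lemma coch_fcup p q x y : @gl_coch F n p x -> @gl_coch F n q y -> gl_coch (p + q) (fcup x y).
Proof. by move=> [cx sx] [cy sy]; split; [exact: (cochain_cup cx cy)|exact: (supp_cup sx sy)]. Qed.

Lemma dgl_fcup p x y : @gl_coch F n p x -> 
  dgl (fcup x y) = fcup (dgl x) y + (-1) ^+ p *: fcup x (dgl y).
Proof.
move=> [cx sx]; have compat (z : gl) (k : F^o) (m : F^o) :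
    gl_rep F n z (k *: m) = gl_rep F n z k *: m + k *: gl_rep F n z m.
  by rewrite /= scale0r scaler0 addr0.
have := cdf_cup compat x y; rewrite /fcup => ->.
by rewrite (sgnf_supp sx) cupZl.
Qed.

Lemma gl_cochZ q c x : @gl_coch F n q x -> gl_coch q (c *: x).
Proof. by move=> [cx sx]; split; [exact: cochainZ|exact: suppZ]. Qed.

Lemma gl_exact0 q : @gl_exact F n q 0.
Proof. by case: q => [//|q]; exists 0; [split => //; exact: cochain0|exact: cdf0]. Qed.

Lemma gl_exactD q x y : @gl_exact F n q x -> gl_exact q y -> gl_exact q (x + y).
Proof.
case: q => [-> ->|q [b [cb sb] <-] [b' [cb' sb'] <-]]; first exact: addr0.
exists (b + b'); last exact: cdfD.
by split; [exact: cochainD|exact: suppD].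
Qed.

Lemma gl_exactZ q c x : @gl_exact F n q x -> gl_exact q (c *: x).
Proof.
case: q => [->|q [b cb <-]]; first exact: scaler0.
by exists (c *: b); [exact: gl_cochZ|exact: (cdf_scale (gl_rep F n))].
Qed.

Lemma gl_exact_cupl p q x y : @gl_exact F n p x -> gl_cocyc q y -> gl_exact (p + q) (fcup x y).
Proof.
case: p => [->|p [b cb <-]] [cy dy]; first by rewrite /fcup cup0l; apply: gl_exact0.
exists (fcup b y); first exact: coch_fcup.
by rewrite (dgl_fcup _ cb) dy {2}/fcup cup0r scaler0 addr0.
Qed.

Lemma gl_exact_cupr p q x y : @gl_cocyc F n p x -> gl_exact q y -> gl_exact (p + q) (fcup x y).
Proof.
move=> [cx dx]; case: q => [->|q [b cb <-]]; first by rewrite /fcup cup0r; apply: gl_exact0.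
rewrite addnS; exists ((-1) ^+ p *: fcup x b); first by apply: gl_cochZ; apply: coch_fcup.
have -> : dgl ((-1) ^+ p *: fcup x b) = (-1) ^+ p *: dgl (fcup x b).
  exact: (cdf_scale (gl_rep F n)).
rewrite (dgl_fcup _ cx) dx {1}/fcup cup0l add0r scalerA -exprMn mulrNN mulr1 expr1n.
exact: scale1r.
Qed.

(** The relation [gl_cup] is stated on representatives. Its independence of them is used for the
    converse implication in [ExtRR_gl]. *)
Lemma gl_cup_uniq p q (a : coh (gl_complex F n) p) (b : coh (gl_complex F n) q) c c' :
  gl_cup a b c -> gl_cup a b c' -> c = c'.
Proof.
move=> [u [v [w [ua vb wc /gl_wedgeE uvw]]]] [u' [v' [w' [ua' vb' wc' /gl_wedgeE uvw']]]].
have glB k (x y : gl_cochain F n k) : gl_list (x - y) = gl_list x - gl_list y.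
  by rewrite addrC -scaleN1r gl_list_comb scaleN1r addrC.
apply/(coh_class_eq wc wc')/gl_coboundaryE.
have /gl_coboundaryE uu := (coh_class_eq ua ua').1 erefl.
have /gl_coboundaryE vv := (coh_class_eq vb vb').1 erefl.
have /gl_cocycleE cv := coh_class_cocycle vb; have /gl_cocycleE cu := coh_class_cocycle ua'.
rewrite !glB in uu vv *; rewrite uvw uvw'.
have -> : cup (gl_list u) (gl_list v) - cup (gl_list u') (gl_list v') =
   fcup (gl_list u - gl_list u') (gl_list v) + fcup (gl_list u') (gl_list v - gl_list v').
  by rewrite /fcup cupDl cupDr cupNl cupNr; zmod.
by apply: gl_exactD; [exact: gl_exact_cupl|exact: gl_exact_cupr].
Qed.
End GlCup.

(** * The ring isomorphism *)

Section ExtRing.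
Variables (F : fieldType) (n : nat).
Hypothesis char0 : [pchar F] =i pred0.
Variable I : injres (lcR (W_alg F n)).
Local Notation A := (lcR (W_alg F n)).
Local Notation L := (lie_elt (W_alg F n)).
Local Notation iota := (mpolyC n (R := F)).

(* This sign absorbs the factor (-1)^(pq) of zig_yoneda. *)
Definition deg_sign q : F := (-1) ^+ 'C(q, 2).

Lemma deg_sign_add p q : deg_sign (p + q) * (-1) ^+ (p * q) = deg_sign p * deg_sign q.
Proof.
rewrite /deg_sign; have -> : 'C(p + q, 2) = ('C(p, 2) + 'C(q, 2) + p * q)%N.
  elim: p => [|p IH]; first by rewrite addn0.
  by rewrite addSn !binS !bin1 IH mulSn; lia.
by rewrite -exprD -addnA addnn -mul2n exprD exprM sqrrN !expr1n mulr1 exprD.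
Qed.

Lemma deg_signK q : deg_sign q * deg_sign q = 1.
Proof. by rewrite -exprD addnn -muln2 exprM sqrr_sign. Qed.

(** Related classes are linked through a cocycle [al] of W(n): a staircase leads from [al] to z, and
    restriction with the sign leads to u. *)
Definition ext_gl q (a : ExtRR I q) (b : coh (gl_complex F n) q) : Prop :=
  exists (z : Gamma (I q)) (al : seq L -> A) (u : gl_cochain F n q),
    [/\ @coh_class _ (Gamma_complex I) q z a, cocyc q al, zig (I := I) al 0 (gam_list z),
        @coh_class _ (gl_complex F n) q u b & gl_list u = deg_sign q *: res al].

Lemma gl_cocycZ q c x : @gl_cocyc F n q x -> gl_cocyc q (c *: x).
Proof.
move=> [cx dx]; split; first exact: gl_cochZ.
by have := cdf_scale (gl_rep F n) c x; rewrite dx scaler0.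
Qed.

Lemma ext_gl_comb q (c : F) a a' b b' : @ext_gl q a b -> @ext_gl q a' b' ->
  ext_gl (c%:MP *: a + a') (c *: b + b').
Proof.
move=> [z [al [u [za [cal dal] zz ub ual]]]] [z' [al' [u' [za' [cal' dal'] zz' ub' ual']]]].
exists (c%:MP *: z + z'), (iota c *: al + al'), (c *: u + u'); split.
- exact: coh_class_comb.
- by split; [exact: coch_comb|rewrite cd_comb dal dal' scaler0 addr0].
- rewrite gam_list_comb omegaE mevalC; exact: zig_comb.
- exact: coh_class_comb.
- by rewrite gl_list_comb ual ual' resD resZ scalerDr !scalerA mulrC.
Qed.

Lemma ext_gl_iso q : exists phi : ExtRR I q -> coh (gl_complex F n) q,
  [/\ bijective phi, forall a, ext_gl a (phi a), forall a b, ext_gl a b -> b = phi a &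
     forall (c : F) a a', phi (c%:MP *: a + a') = c *: phi a + phi a'].
Proof.
apply: (@linear_relation_iso _ _ F (fun c (a : ExtRR I q) => c%:MP *: a) (fun c b => c *: b) (-1)).
- by move=> a; rewrite mpolyCN mpolyC1 scaleN1r.
- exact: scaleN1r.
- by move=> *; apply: ext_gl_comb.
- move=> a; have [z za] := coh_class_ex a.
  have bz := (cocycle_Gamma z).1 (coh_class_cocycle za).
  have [al cal zal] := zig_right bz; have ral := gl_cocycZ (deg_sign q) (res_cocyc cal).
  have [u ual] := gl_list_surj ral.1.
  have [|b ub] := @cocycle_class _ (gl_complex F n) q u; first by apply/gl_cocycleE; rewrite ual.
  by exists b, z, al, u.
- move=> b; have [u ub] := coh_class_ex b.
  have cu := (gl_cocycleE u).1 (coh_class_cocycle ub).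
  have [al cal ral] := res_surj char0 (gl_cocycZ (deg_sign q) cu).
  have [y zy] := zig_left char0 (p := 0) I cal; have [cy dy ddy] := zig_bicyc (p := 0) cal zy.
  have [z zE] := gam_list_surj cy dy.
  have [|a za] := @cocycle_class _ (Gamma_complex I) q z.
    by apply/cocycle_Gamma; rewrite zE.
  exists a, z, al, u; split=> //; first by rewrite zE.
  by rewrite ral scalerA deg_signK scale1r.
- move=> a b [z [al [u [za cal zz ub ual]]]].
  rewrite (coh_class_eq0 za) (coh_class_eq0 ub) gl_coboundaryE coboundary_Gamma ual.
  rewrite (zig_trivial char0 zz) -(res_exact char0 cal).
  split=> [|/(gl_exactZ (deg_sign q))]; first exact: gl_exactZ.
  by rewrite scalerA deg_signK scale1r.
Qed.

Lemma ext_gl_yoneda p q (a : ExtRR I p) (b : ExtRR I q) (c : ExtRR I (p + q)) a' b' :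
  (forall x y y', @ext_gl p x y -> ext_gl x y' -> y = y') ->
  (forall x y y', @ext_gl q x y -> ext_gl x y' -> y = y') ->
  ext_gl a a' -> ext_gl b b' -> yoneda a b c -> exists2 c', ext_gl c c' & gl_cup a' b' c'.
Proof.
move=> up uq aa' bb' [u [v [w [B [[ua vb wc] Bh Bd Bv wB]]]]].
have [|al cal zal] := @zig_right _ _ _ _ I 0 p (gam_list u).
  by apply/cocycle_Gamma; apply: coh_class_cocycle ua.
have [|be cbe zbe] := @zig_right _ _ _ _ I 0 q (gam_list v).
  by apply/cocycle_Gamma; apply: coh_class_cocycle vb.
pose ga := iota ((-1) ^+ (p * q)) *: rcup al be.
have zga : zig (I := I) ga 0 (gam_list w) := zig_yoneda cal zal zbe Bh Bd Bv wB.
have cga : cocyc (p + q) ga.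
  have [ca _] := cal; have [cb db] := cbe.
  have cab := coch_rcup ca cb; split.
    by have := coch_comb ((-1) ^+ (p * q)) cab (coch0 _ (p + q)); rewrite addr0.
  have := cd_comb ((-1) ^+ (p * q)) (rcup al be) 0.
  by rewrite addr0 cd0 addr0 (cd_rcup _ cal) db /rcup cup0r !scaler0.
have ral := gl_cocycZ (deg_sign p) (res_cocyc cal).
have rbe := gl_cocycZ (deg_sign q) (res_cocyc cbe).
have rga := gl_cocycZ (deg_sign (p + q)) (res_cocyc cga).
have [U UE] := gl_list_surj ral.1; have [V VE] := gl_list_surj rbe.1.
have [W WE] := gl_list_surj rga.1.
have [|a1 Ua] := @cocycle_class _ (gl_complex F n) p U; first by apply/gl_cocycleE; rewrite UE.
have [|b1 Vb] := @cocycle_class _ (gl_complex F n) q V; first by apply/gl_cocycleE; rewrite VE.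
have [|c1 Wc] := @cocycle_class _ (gl_complex F n) (p + q) W; first by apply/gl_cocycleE; rewrite WE.
exists c1; first by exists w, ga, W.
have -> : a' = a1 by apply: up aa' _; exists u, al, U.
have -> : b' = b1 by apply: uq bb' _; exists v, be, V.
exists U, V, W; split=> //; apply/gl_wedgeE; rewrite WE UE VE resZ res_cup scalerA.
by rewrite deg_sign_add cupZl cupZr scalerA.
Qed.

(** The case of degree 0 of [res_exact], where exactness means being 0: an invariant polynomial is
    determined by its value at the origin. *)
Lemma cocyc0_unique (al be : seq L -> A) : cocyc 0 al -> cocyc 0 be ->
  ev0 (al [::]) = ev0 (be [::]) -> al = be.
Proof.
move=> [ca da] [cb db] ab; apply/eqP; rewrite -subr_eq0; apply/eqP.
have cab : cocyc 0 (al - be) by split; [exact: cochB|rewrite cdB da db subrr].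
apply/(res_exact char0 cab)/funext => -[|x s].
  by rewrite /res /pull /= fctE /ev0 mcoeffB; apply/eqP; rewrite subr_eq0; apply/eqP.
by have [_ sr] := gl_coch_res cab.1; exact: sr.
Qed.

Definition unit_coch : seq L -> A := fun s => if s is [::] then (1 : {mpoly F[n]}) else 0.

Lemma cocyc_unit : cocyc 0 unit_coch.
Proof.
have c1 : coch 0 unit_coch.
  split; last by case.
  by split=> [[|y s1] c x z s2|[|y s1] x s2] //=; rewrite scaler0 addr0.
split=> //; apply/(cd_coch0 c1) => X.
by rewrite -[rho X _]/(lie_act X 1) /lie_act -mpolyC1 vf_actC.
Qed.

Lemma ext_gl_one (e : ExtRR I 0) e' : ext_gl e e' -> (ext_one e <-> gl_one e').
Proof.
move=> [z [al [u [ze cal zz ue ual]]]]; rewrite /= in zz.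
have z1 : val z 1 = ir_aug I (al [::]) := congr1 (@^~ [::]) zz.
have flist0 (x : {ffun 'I_0 -> 'M[F]_n}) : flist x = [::] by rewrite /flist enum_ord0.
have uE x : val u x = ev0 (al [::]).
  by rewrite -gl_listE flist0 ual /deg_sign bin0n expr0 scale1r.
split=> [[z' ze' z'E]|[u' ue' u'E]].
  (* In degree 0 the only coboundary is 0, so a class determines its representative. *)
  have zz' : z = z' by apply/eqP; rewrite -subr_eq0; apply/eqP/(coh_class_eq ze ze').
  exists u => // x; rewrite uE.
  have -> : al [::] = 1 by apply: (@ir_aug_inj _ _ _ _ I); rewrite -z1 zz' z'E.
  by rewrite /ev0 mcoeff1 eqxx.
have uu' : u = u' by apply/eqP; rewrite -subr_eq0; apply/eqP/(coh_class_eq ue ue').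
exists z => // r; rewrite GammaE z1 -(lchomZ (ir_aug_hom I)).
have -> : al [::] = 1.
  rewrite (cocyc0_unique cal cocyc_unit) // -(uE [ffun=> 0]) uu' u'E.
  by rewrite /ev0 mcoeff1 eqxx.
by rewrite [r *: _]mulr1.
Qed.

Theorem ExtRR_gl : exists phi : forall q : nat, ExtRR I q -> coh (gl_complex F n) q,
  [/\ forall q : nat, bijective (phi q),
      forall (q : nat) (c : F) (a b : ExtRR I q),
        phi q (c%:MP *: a + b) = c *: phi q a + phi q b,
      forall (p q : nat) (a : ExtRR I p) (b : ExtRR I q) (c : ExtRR I (p + q)%N),
        yoneda a b c <-> gl_cup (phi p a) (phi q b) (phi (p + q)%N c) &
      forall e : ExtRR I 0, ext_one e <-> gl_one (phi 0%N e)].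
Proof.
pose phi q := projT1 (cid (ext_gl_iso q)); have hphi q := projT2 (cid (ext_gl_iso q)).
exists phi; split.
- by move=> q; have [] := hphi q.
- by move=> q; have [_ _ _] := hphi q.
- move=> p q a b c.
  have key c' : yoneda a b c' -> gl_cup (phi p a) (phi q b) (phi (p + q)%N c').
    have [_ rp up _] := hphi p; have [_ rq uq _] := hphi q; have [_ _ upq _] := hphi (p + q)%N.
    move=> y; have [||d cd] := ext_gl_yoneda _ _ (rp a) (rq b) y.
    + by move=> x t t' /up -> /up ->.
    + by move=> x t t' /uq -> /uq ->.
    by rewrite (upq _ _ cd).
  split=> [/key //|abc].
  (* For the converse, some Yoneda product c' of a and b is constructed from an endomorphism of the
     resolution. Its image is a cup product by the direct implication, so it equals that of c, and c
     = c' by injectivity. *)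
  have [u ua] := coh_class_ex a; have [v vb] := coh_class_ex b.
  have dv r : ir_d (val v r) = 0 by have := coh_class_cocycle vb r => <-.
  have [B [Bh Bd Bv]] := resolution_endo dv.
  have wG : Gamma_mem (fun r => B p (val u r)) by exact: (lchom_comp (Bh p) (GammaP u)).
  pose S := Submod (@Gamma_mem0 _ _ _ (I (p + q))) (@Gamma_memP _ _ _ (I (p + q))).
  pose w : Gamma (I (p + q)) := exist (fun x => x \in smemb S) _ (introT (smembP S _) wG).
  have [|c' wc'] := @cocycle_class _ (Gamma_complex I) (p + q) w.
    move=> r; rewrite /= -Bd -(coh_class_cocycle ua r); exact: (esym (lchom0 (Bh p.+1))).
  have abc' : yoneda a b c' by exists u, v, w, B; split.
  have [[psi phiK _] _ _ _] := hphi (p + q)%N.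
  by have /(can_inj phiK) -> := gl_cup_uniq abc (key _ abc').
- by move=> e; have [_ r0 _ _] := hphi 0%N; exact: ext_gl_one.
Qed.
End ExtRing.

(** Derived functors are expressed through an arbitrary injective resolution; the existence of one
    is part of the claim, so that the quantification over resolutions is not vacuous. *)
Theorem theorem1p2 (F : closedFieldType) (char0 : [pchar F] =i pred0) :
  (forall (n : nat) (g : lie_subalg F n), is_cartan g ->
   forall M : lcmod g,
     inhabited (injres M) /\
     forall (I : injres M) (q : nat),
       exists phi : {linear RGamma I q -> coh (CE_complex M) q}, bijective phi)
  /\
  (forall (n : nat),
     inhabited (injres (lcR (W_alg F n))) /\
     forall (I : injres (lcR (W_alg F n))),
       exists phi : forall q : nat, ExtRR I q -> coh (gl_complex F n) q,
       [/\ forall q : nat, bijective (phi q),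
           forall (q : nat) (c : F) (a b : ExtRR I q),
             phi q (c%:MP *: a + b) = c *: phi q a + phi q b,
           forall (p q : nat) (a : ExtRR I p) (b : ExtRR I q)
                  (c : ExtRR I (p + q)%N),
             yoneda a b c <-> gl_cup (phi p a) (phi q b) (phi (p + q)%N c) &
           forall e : ExtRR I 0, ext_one e <-> gl_one (phi 0%N e)]).
Proof.
split=> [n g _ M|n]; split; try exact: injres_exists.
  by move=> I q; exact: RGamma_CE.
by move=> I; exact: ExtRR_gl.
Qed.
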